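(* Let $\{\tilde S_n\}_{n\ge1}$ be the pure-echoing random walk ($p=1$, $X\equiv1$) with echo law $\xi$ described in the context. Then there exists a random variable $\mathcal L^{(\xi)}\in L^1(\mathbb P)$ such that $$\lim_{n\to\infty}\frac{\tilde S_n}{n^{m_1}}=\mathcal L^{(\xi)}\quad\text{almost surely.}$$ Furthermore: (i) If $\mathbb E[\xi\log\xi]<m_1$, then this convergence holds in $L^\gamma(\mathbb P)$ for every $\gamma>1$ with $m_\gamma<\gamma m_1$, and $\mathcal L^{(\xi)}\in L^\gamma(\mathbb P)$ for such $\gamma$. Moreover, $\mathcal L^{(\xi)}$ is non-degenerate if $\mathbb P(\xi=1)<1$, and $\mathbb E\,\mathcal L^{(\xi)}=\dfrac1{\Gamma(1+m_1)}$. (ii) If $\mathbb E[\xi\log\xi]\ge m_1$, then $\mathcal L^{(\xi)}=0$ almost surely.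
   Context: $\xi$ is a random variable with $\xi\ge0$ a.s., $\mathbb P(\xi=0)<1$ and $\xi\in L^\alpha(\mathbb P)$ for some $\alpha>1$; $m_\gamma=\mathbb E\,\xi^\gamma$; $0\log0=0$. Pure-echoing walk: let $\{\xi_n\}_{n\ge2}$ be i.i.d. copies of $\xi$ and $\{\mathcal U[n]\}_{n\ge2}$ independent random variables with $\mathcal U[n]$ uniform on $\{1,\dots,n-1\}$, the two families being independent. Set $\tilde X_1=1$, $\tilde X_n=\xi_n\tilde X_{\mathcal U[n]}$ for $n\ge2$, and $\tilde S_n=\tilde X_1+\cdots+\tilde X_n$. A random variable is non-degenerate if it is not almost surely constant. *)

(* Defs.v *)
From HB Require Import structures.
From mathcomp Require Import all_boot all_order all_algebra.
From mathcomp Require Import all_classical all_reals all_analysis.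

Set Implicit Arguments.
Unset Strict Implicit.
Unset Printing Implicit Defensive.

Import Order.TTheory GRing.Theory Num.Theory.
Import numFieldNormedType.Exports.

Local Open Scope classical_set_scope.
Local Open Scope ring_scope.

Section Independence.
Context d d' (T : measurableType d) (T' : measurableType d') (R : realType).
Local Open Scope ereal_scope.

Definition mutually_independent (P : probability T R) (D : set nat)
    (X : nat -> T -> T') :=
  forall (J : seq nat) (A : nat -> set T'),
    uniq J -> (forall i, i \in J -> D i) -> (forall i, measurable (A i)) ->
    P (\big[setI/setT]_(i <- J) (X i @^-1` A i)) =
    \prod_(i <- J) P (X i @^-1` A i).

(* The sigma-algebra sigma(X_i, i in D). *)
Definition family_sigma (D : set nat) (X : nat -> T -> T') : set (set T) :=
  <<s \bigcup_(i in D) preimage_set_system setT (X i) measurable >>.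

Definition same_law (P : probability T R) (X Y : T -> T') :=
  forall A, measurable A -> P (X @^-1` A) = P (Y @^-1` A).

End Independence.

Section RandomVariables.
Context d (T : measurableType d) (R : realType) (P : probability T R).
Local Open Scope ereal_scope.

Definition independent_systems (F G : set (set T)) :=
  forall A B, F A -> G B -> P (A `&` B) = P A * P B.

Definition uniform_on_lt (n : nat) (U : T -> nat) :=
  forall k, (1 <= k < n)%N -> P [set w | U w = k] = (n.-1%:R^-1)%:E.

(* m_gamma = E[X^gamma], possibly +oo; for X >= 0 almost surely. *)
Definition moment (X : T -> R) (gamma : R) : \bar R :=
  'E_P[fun w => (X w `^ gamma)%R].

(* [ln 0 = 0], and the convention 0 log 0 = 0 holds in any case. *)
Definition mean_xlogx (X : T -> R) : \bar R := 'E_P[fun w => (X w * ln (X w))%R].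

Definition non_degenerate (X : T -> R) :=
  ~ exists c : R, {ae P, forall w, X w = c}.

Definition cvg_Lp (p : R) (f : nat -> T -> R) (g : T -> R) :=
  [/\ forall n, f n \in Lfun P p%:E,
      g \in Lfun P p%:E &
      Lnorm P p%:E (fun w => (f n w - g w)%:E) @[n --> \oo] --> 0].

End RandomVariables.

Definition Gamma (R : realType) (z : R) : R :=
  \int[lebesgue_measure]_(x in `]0%R, +oo[) (x `^ (z - 1) * expR (- x)).

Section PureEchoing.
Context (R : realType).

(* The list of X_0, ..., X_n, with a dummy X_0 = 0: X_1 = 1 and, for n >= 2,
   X_n = x_n * X_{u_n}. A value u_n outside {1, ..., n-1} yields X_n = 0; this
   has probability 0 in the model. *)
Fixpoint echo_history (x : nat -> R) (u : nat -> nat) (n : nat) : seq R :=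
  match n with
  | 0 => [:: 0]
  | 1 => [:: 0; 1]
  | m.+1 => let s := echo_history x u m in
            rcons s (x m.+1 * nth 0 s (u m.+1))
  end.

Definition echo_step x u n : R := nth 0 (echo_history x u n) n.

Lemma echo_historySS x u n : echo_history x u n.+2 =
  rcons (echo_history x u n.+1)
    (x n.+2 * nth 0 (echo_history x u n.+1) (u n.+2)).
Proof. by []. Qed.

Lemma size_echo_history x u n : size (echo_history x u n) = n.+1.
Proof. by elim: n => [|[|n] IHn] //; rewrite echo_historySS size_rcons IHn. Qed.

Lemma nth_echo_history x u n k : (k <= n)%N ->
  nth 0 (echo_history x u n) k = echo_step x u k.
Proof.
elim: n => [|n IHn]; first by rewrite leqn0 => /eqP->.
rewrite leq_eqVlt => /predU1P[->//|kn]; rewrite -(IHn kn).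
case: n IHn kn => [|n] _ kn; first by case: k kn.
by rewrite echo_historySS nth_rcons size_echo_history kn.
Qed.

Lemma echo_step1 x u : echo_step x u 1 = 1.
Proof. by []. Qed.

Lemma echo_stepE x u n : (2 <= n)%N -> (1 <= u n < n)%N ->
  echo_step x u n = x n * echo_step x u (u n).
Proof.
case: n => [|[|n]] // _ /andP[_ un].
rewrite {1}/echo_step echo_historySS nth_rcons size_echo_history ltnn eqxx.
by rewrite nth_echo_history.
Qed.

Definition echo_walk x u n : R := \sum_(1 <= k < n.+1) echo_step x u k.

End PureEchoing.

(* Main.v *)
Require Import Defs.
From HB Require Import structures.
From mathcomp Require Import all_boot all_order all_algebra.
From mathcomp Require Import all_classical all_reals all_analysis.
From mathcomp Require Import measurable_realfun ring lra.

Set Implicit Arguments.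
Unset Strict Implicit.
Unset Printing Implicit Defensive.

Import Order.TTheory GRing.Theory Num.Theory.
Import numFieldNormedType.Exports.

Local Open Scope classical_set_scope.
Local Open Scope ring_scope.

(** Since the parent of the new vertex is uniform, [E(S_{n+1} | F_n) = (1 + m_1/n) S_n]:
    [M_n = S_n / a_n] with [a_n = \prod_{k<n} (1 + m_1/k)] is a nonnegative martingale,
    and [a_n ~ n^{m_1} / Gamma(1 + m_1)].

    If [m_gamma < gamma m_1], expanding [(S_n + X_{n+1})^gamma] to first order and using
    [\sum_{k<=n} E X_k^gamma = \prod_{k<n} (1 + m_gamma/k)] shows that [M] is bounded in
    [L^gamma]; Doob's inequality then gives convergence in [L^gamma]. Such a [gamma]
    exists when [E(xi log xi) < m_1], by differentiating [gamma |-> m_gamma] at 1. If the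
    limit is constant then [M_n = 1] almost surely, so both [X_2] and [X_3] are constant,
    which forces [xi = 1].

    If [E(xi log xi) >= m_1], kill every step that exceeds [K a_n] and let [q_n], [y_n],
    [l_n] be the normalized sums of [E Z_k], [E Z_k^{1+s}] and [E Z_k log(K a_n / Z_k)]
    over the remaining steps [Z_k]. As [m_{1+s} > (1+s) m_1], a multiple of [y_n / n] is
    dominated by the increments of a bounded sequence, while [l_n] grows by at most
    [O(y_n / n + n^-2)] and hence stays bounded; [y_n] is then bounded below when [q_n]
    is, so divergence of the harmonic series forces [q_n -> 0]. As [M] is almost surely
    bounded, Fatou's lemma makes its limit vanish. *)

(** Truncation is forced in the critical case: there [m_{1+s} > (1+s) m_1], so the criterion for
    boundedness of [M] in [L^{1+s}] fails and Doob's inequality gives nothing. Choose a vertex with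
    weight proportional to its step and read [ln n] as time: the distance [D = ln (K a_n / Z)] to
    the killing level then moves with mean drift [m_1 - E(xi log xi) <= 0]. The three normalized
    sums are the survival probability, [K^s E e^{-sD}] and [E D] on survival. A walk that does not
    drift away from the level has to be absorbed; the argument derives this from moments alone, so
    that a moment of order slightly above 1 is enough.

    In the subcritical case [gamma] may be close to 1, which excludes second moments. The expansion
    has a free precision [eta]; taking it as a small negative power of [n] makes both error terms
    summable, and the gap [gamma m_1 - m_gamma] leaves room for this choice.

    No conditional expectation is formed. Randomness enters through one product rule for
    [E(H 1{U=k} g(xi))] with [H] depending on the past, and martingales are tested against such
    [H]. *)

Section RealInequalities.
Context {R : realType}.
Implicit Types (x y a b t r s p g : R).

(** * Elementary inequalities for exponentials, logarithms and real powers *)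

Lemma expR_le_Taylor2 y : 0 <= y -> expR y <= 1 + y + y ^+ 2 * expR y.
Proof.
move=> y0; have h : expR y - 1 <= y * expR y.
  have := expR_ge1Dx (- y); rewrite expRN => h.
  have e0 := expR_gt0 y.
  have : (1 - y) * expR y <= 1 by rewrite -ler_pdivlMr // div1r.
  lra.
have : y * (expR y - 1) <= y * (y * expR y) by exact: ler_wpM2l.
lra.
Qed.

Lemma powRE a s : 0 < a -> a `^ s = expR (s * ln a).
Proof. by move=> a0; rewrite /powR gt_eqF. Qed.

Lemma powR1D_le_Taylor2 g t : 0 <= g -> 0 <= t <= 1 ->
  (1 + t) `^ g <= 1 + g * t + g ^+ 2 * expR g * t ^+ 2.
Proof.
move=> g0 /andP[t0 t1].
rewrite powRE; last lra.
have h : g * ln (1 + t) <= g * t by apply: ler_wpM2l => //; apply: le_ln1Dx; lra.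
apply: (le_trans (y := expR (g * t))); first by rewrite ler_expR.
have gt0 : 0 <= g * t by exact: mulr_ge0.
have h2 := expR_le_Taylor2 gt0.
have h3 : expR (g * t) <= expR g by rewrite ler_expR ler_piMr.
have h4 : (g * t) ^+ 2 * expR (g * t) <= (g * t) ^+ 2 * expR g.
  by apply: ler_wpM2l => //; exact: sqr_ge0.
by rewrite exprMn in h2 h4; lra.
Qed.

Lemma gt0_powRD a r s : 0 < a -> a `^ (r + s) = a `^ r * a `^ s.
Proof. by move=> a0; rewrite powRD // (gt_eqF a0) implybT. Qed.

Lemma powRD1 a g : 0 < a -> a `^ (g - 1) * a = a `^ g.
Proof.
by move=> a0; rewrite -[X in _ * X](powRr1 (ltW a0)) -gt0_powRD // subrK.
Qed.

Lemma powRDS a s : 0 <= a -> 0 <= s -> a `^ (1 + s) = a * a `^ s.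
Proof.
move=> a0 s0; rewrite powRD; first by rewrite powRr1.
by rewrite gt_eqF //; lra.
Qed.

(* Expansion of [(a + b) `^ g] to first order in [b], with a remainder that is absorbed
   by letting [eta] tend to 0. *)
Lemma powR_add_le g : 1 < g -> exists2 C, 0 < C &
  forall eta a b, 0 < eta <= 1 -> 0 < a -> 0 <= b ->
  (a + b) `^ g <= a `^ g + (g + C * eta) * (a `^ (g - 1) * b)
                  + C * eta `^ (- g) * b `^ g.
Proof.
move=> g1; exists (g ^+ 2 * expR g + 2 `^ g).
  apply: addr_gt0; last exact: powR_gt0.
  by rewrite mulr_gt0 ?expR_gt0// exprn_gt0; lra.
move=> eta a b /andP[e0 e1] a0 b0.
have K0 : 0 < g ^+ 2 * expR g by rewrite mulr_gt0 ?expR_gt0// exprn_gt0; lra.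
have K1 : 0 < 2 `^ g :> R by exact: powR_gt0.
set K := g ^+ 2 * expR g in K0 *; set K' := 2 `^ g in K1 *.
have P1 := powR_ge0 a (g - 1); have P2 := powR_ge0 eta (- g).
have P3 := powR_ge0 b g; have P4 := powR_ge0 a g.
(* For [b <= eta * a] the Taylor remainder at [b / a] carries an extra factor [b / a <= eta].
   Otherwise [a + b <= (2 / eta) * b], and the whole power fits into the last term. *)
have [bea|bea] := leP b (eta * a).
  have ba0 : 0 <= b / a by rewrite divr_ge0 // ltW.
  have bae : b / a <= eta by rewrite ler_pdivrMr.
  have ba1 : 0 <= b / a <= 1 by rewrite ba0 (le_trans bae).
  have := @powR1D_le_Taylor2 g (b / a) ltac:(lra) ba1; rewrite -/K => h.
  have -> : a + b = a * (1 + b / a) by rewrite mulrDr mulr1 mulrCA divff ?mulr1 ?gt_eqF.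
  rewrite powRM; [|lra|lra].
  have h' := ler_wpM2l P4 h.
  apply: (le_trans h').
  have E1 : a `^ g * (b / a) = a `^ (g - 1) * b.
    by rewrite -(powRD1 g a0) -mulrA; congr (_ * _); rewrite mulrCA divff ?mulr1 ?gt_eqF.
  have -> : a `^ g * (1 + g * (b / a) + K * (b / a) ^+ 2) =
    a `^ g + g * (a `^ g * (b / a)) + K * (b / a) * (a `^ g * (b / a)) by ring.
  rewrite E1.
  have Q : 0 <= a `^ (g - 1) * b by rewrite mulr_ge0.
  have Q1 : K * (b / a) * (a `^ (g - 1) * b) <= (K + K') * eta * (a `^ (g - 1) * b).
    apply: ler_wpM2r => //; apply: ler_pM => //; [exact: ltW|lra].
  have Q2 : 0 <= (K + K') * eta `^ (- g) * b `^ g.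
    by rewrite !mulr_ge0 // addr_ge0// ltW.
  lra.
have ab : a + b <= 2 / eta * b.
  have : a < b / eta by rewrite ltr_pdivlMr // mulrC.
  have : b <= b / eta by rewrite ler_pdivlMr // ler_piMr.
  have -> : 2 / eta * b = b / eta + b / eta by field; rewrite gt_eqF.
  lra.
have h : (a + b) `^ g <= (2 / eta * b) `^ g.
  apply: ge0_ler_powR => //; rewrite ?nnegrE; [lra|lra|].
  by rewrite mulr_ge0 // divr_ge0 // ltW.
apply: (le_trans h).
rewrite powRM //; last by rewrite divr_ge0 // ltW.
rewrite powRM //; last by rewrite invr_ge0 ltW.
rewrite -(powR_inv1 (ltW e0)) -powRrM mulN1r -/K'.
have Q : 0 <= (g + (K + K') * eta) * (a `^ (g - 1) * b).
  rewrite mulr_ge0 // ?mulr_ge0 // addr_ge0 //; first lra.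
  by rewrite mulr_ge0 // ?addr_ge0 // ltW.
have : K' * eta `^ (- g) * b `^ g <= (K + K') * eta `^ (- g) * b `^ g.
  by apply: ler_wpM2r => //; apply: ler_wpM2r => //; rewrite lerDr ltW.
lra.
Qed.

(** Young's inequality with exponents [p / (p - 1)] and [p]; equivalently, the convex map [b^p] lies
    above its tangent at [a]. *)
Lemma powR_young p a b : 1 < p -> 0 <= a -> 0 <= b ->
  p * (a `^ (p - 1) * b) <= b `^ p + (p - 1) * a `^ p.
Proof.
move=> p1 a0 b0.
have q0 : 0 < p / (p - 1) by rewrite divr_gt0; lra.
have := @conjugate_powR R (a `^ (p - 1)) b (p / (p - 1)) p (powR_ge0 _ _) b0 q0
  ltac:(lra).
rewrite -powRrM (_ : (p - 1) * (p / (p - 1)) = p); last first.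
  by field; rewrite gt_eqF; lra.
have E : (p / (p - 1))^-1 = (p - 1) / p by rewrite invf_div.
rewrite E => h.
have {}h := h ltac:(by field; rewrite gt_eqF; lra).
have p0 : 0 <= p by lra.
have := ler_wpM2l p0 h.
rewrite mulrDr.
have -> : p * (a `^ p * ((p - 1) / p)) = (p - 1) * a `^ p by field; rewrite gt_eqF; lra.
have -> : p * (b `^ p / p) = b `^ p by field; rewrite gt_eqF; lra.
lra.
Qed.

Lemma powR_bernoulli p t : 1 < p -> 0 <= t -> 1 + p * t <= (1 + t) `^ p.
Proof.
move=> p1 t0; have := @powR_young p 1 (1 + t) p1 ler01 ltac:(lra).
rewrite !powR1; lra.
Qed.

(** Cases [b <= e * a] and [b > e * a]. The free [e] lets Doob's inequality absorb the power of the
    running maximum into its left side. *)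
Lemma powR_young_eps p e a b : 1 < p -> 0 < e -> 0 <= a -> 0 <= b ->
  a `^ (p - 1) * b <= e * a `^ p + e^-1 `^ (p - 1) * b `^ p.
Proof.
move=> p1 e0 a0 b0.
have [ba|ba] := leP b (e * a).
  have h : a `^ (p - 1) * b <= a `^ (p - 1) * (e * a).
    by apply: ler_wpM2l => //; exact: powR_ge0.
  have -> : e * a `^ p = a `^ (p - 1) * (e * a).
    move: a0; rewrite le_eqVlt => /predU1P[<-|a0]; last by rewrite -(powRD1 p a0); ring.
    by rewrite !powR0 ?gt_eqF //; [rewrite mulr0 mul0r|lra|lra].
  by apply: (le_trans h); rewrite lerDl mulr_ge0 ?powR_ge0.
have b1 : 0 < b by apply: le_lt_trans ba; rewrite mulr_ge0 // ltW.
have h : a `^ (p - 1) <= (e^-1 * b) `^ (p - 1).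
  apply: ge0_ler_powR; rewrite ?nnegrE //; first lra.
    by rewrite mulr_ge0 // invr_ge0 ltW.
  by rewrite mulrC ler_pdivlMr // mulrC ltW.
have -> : e^-1 `^ (p - 1) * b `^ p = (e^-1 * b) `^ (p - 1) * b.
  by rewrite powRM ?invr_ge0 1?ltW // -(powRD1 p b1) mulrA.
by apply: ler_wpDl; [rewrite mulr_ge0 ?powR_ge0 // ltW|exact: ler_wpM2r].
Qed.

Lemma ln1D_ge x : 0 <= x -> x / (1 + x) <= ln (1 + x).
Proof.
move=> x0; have x1 : 0 < 1 + x by lra.
have := @le_ln1Dx R ((1 + x)^-1 - 1).
rewrite addrCA subrr addr0 lnV ?posrE // => h.
have : - ln (1 + x) <= (1 + x)^-1 - 1.
  by apply: h; rewrite ltrBrDr addNr invr_gt0.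
have -> : x / (1 + x) = 1 - (1 + x)^-1 by field; rewrite gt_eqF.
lra.
Qed.

(** Summability of [k^(-1-e)] in telescoping form: the decrement of [k^(-e)] is at least
    [e * (k+1)^(-1-e)], and [2^(1+e)] pays for replacing [k+1 <= 2 * k] by [k]. *)
Lemma powRN_telescope (e : R) (k : nat) : 0 < e -> (0 < k)%N ->
  k%:R `^ (- 1 - e) <= 2 `^ (1 + e) / e * (k%:R `^ (- e) - k.+1%:R `^ (- e)).
Proof.
move=> e0 k0.
have K0 : 0 < k%:R :> R by rewrite ltr0n.
have K1 : 0 < k.+1%:R :> R by rewrite ltr0n.
have K2 : k.+1%:R <= 2 * k%:R :> R.
  by rewrite -natrM ler_nat mul2n -addnn -addn1 leq_add2l.
have A1 : k%:R `^ (- e) - k.+1%:R `^ (- e) >= e * k.+1%:R `^ (- 1 - e).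
  have -> : k%:R `^ (- e) = k.+1%:R `^ (- e) * (1 + k%:R^-1) `^ e.
    have -> : (k.+1%:R : R) = k%:R * (1 + k%:R^-1).
      by rewrite mulrDr mulr1 divff ?gt_eqF // natr1.
    have kk : 0 < 1 + k%:R^-1 :> R by rewrite addr_gt0 // invr_gt0.
    rewrite powRM ?ltW // -mulrA -gt0_powRD //.
    by rewrite addNr powRr0 mulr1.
  have -> : k.+1%:R `^ (-1 - e) = k.+1%:R `^ (- e) / k.+1%:R :> R.
    by rewrite gt0_powRD // powR_inv1 ?ltW // mulrC.
  have h : 1 + e / k.+1%:R <= (1 + k%:R^-1) `^ e :> R.
    rewrite powRE; last by rewrite addr_gt0 // invr_gt0.
    apply: le_trans (expR_ge1Dx _); rewrite lerD2l (ler_wpM2l (ltW e0)) //.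
    apply: le_trans (ln1D_ge _); last by rewrite invr_ge0 ltW.
    rewrite le_eqVlt; apply/orP; left; apply/eqP.
    by rewrite -natr1; field; rewrite !gt_eqF // natr1.
  have P : 0 <= k.+1%:R `^ (- e) :> R by exact: powR_ge0.
  by have := ler_wpM2l P h; rewrite mulrDr mulr1 mulrCA lerBrDl.
have A2 : k%:R `^ (- 1 - e) <= 2 `^ (1 + e) * k.+1%:R `^ (- 1 - e).
  have -> : - 1 - e = - (1 + e) by lra.
  rewrite !powRN ler_pdivlMr ?powR_gt0 // mulrC ler_pdivrMr ?powR_gt0 //.
  rewrite -powRM ?(ltW K0) //; apply: ge0_ler_powR => //; rewrite ?nnegrE.
  - lra.
  - exact: ltW.
  - by rewrite mulr_ge0 // ltW.
apply: (le_trans A2).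
rewrite -mulrA; apply: ler_wpM2l; first exact: powR_ge0.
by rewrite mulrC ler_pdivlMr // mulrC.
Qed.

Lemma ln_le_powR s y : 0 < s -> 0 < y -> ln y <= y `^ s / s.
Proof.
move=> s0 y0; rewrite ler_pdivlMr // mulrC -ln_powR.
by apply/ltW/ln_sublinear; exact: powR_gt0.
Qed.

Lemma powR1D_ge s x : 0 <= x -> 0 <= s -> x + s * (x * ln x) <= x `^ (1 + s).
Proof.
move=> x0 s0; rewrite powRDS //; move: x0; rewrite le_eqVlt => /predU1P[<-|x0].
  by rewrite !mul0r mulr0 addr0.
rewrite powRE //; have := ler_wpM2l (ltW x0) (expR_ge1Dx (s * ln x)).
lra.
Qed.

(** The strictness away from 1 is what turns equality of expectations into [xi * ln xi = 0] almost
    surely in [power_moment_gt]. *)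
Lemma powR1D_gt s x : 0 < x -> 0 < s -> x != 1 ->
  x + s * (x * ln x) < x `^ (1 + s).
Proof.
move=> x0 s0 x1; rewrite (powRDS (ltW x0) (ltW s0)) powRE //.
have h : s * ln x != 0 by rewrite mulf_neq0 ?ln_eq0 // gt_eqF.
have := expR_gt1Dx h; rewrite -(ltr_pM2l x0).
lra.
Qed.

Lemma xlnx_ge x : 0 <= x -> - 1 <= x * ln x.
Proof.
rewrite le_eqVlt => /predU1P[<-|x0]; first by rewrite mul0r lerN10.
have := @le_ln1Dx R (x^-1 - 1); rewrite addrCA subrr addr0 lnV ?posrE // => h.
have {}h : - ln x <= x^-1 - 1 by apply: h; rewrite ltrBrDr addNr invr_gt0.
have := ler_wpM2l (ltW x0) h; rewrite mulrBr divff ?gt_eqF //.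
lra.
Qed.

Lemma norm_xlnx_le s x : 0 < s -> 0 <= x ->
  `|x * ln x| <= 1 + x `^ (1 + s) / s.
Proof.
move=> s0 x0; rewrite ler_norml; apply/andP; split.
  have := xlnx_ge x0; have : 0 <= x `^ (1 + s) / s.
    by rewrite divr_ge0 ?powR_ge0 // ltW.
  lra.
apply: ler_wpDl; first exact: ler01.
rewrite (powRDS x0 (ltW s0)) -mulrA; move: x0; rewrite le_eqVlt => /predU1P[<-|x0].
  by rewrite !mul0r.
by rewrite ler_pM2l // ln_le_powR.
Qed.

(** The difference quotient of [x^(1+s)] in [s] lies between the derivatives at 0 and at [s]; both
    bounds are [1 + y <= expR y], taken at [s * ln x] and at its opposite. *)
Lemma powR_incr_ratio_bounds s x : 0 < s -> 0 <= x ->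
  x * ln x <= (x `^ (1 + s) - x) / s <= x * ln x * x `^ s.
Proof.
move=> s0 x0; rewrite (powRDS x0 (ltW s0)); move: x0; rewrite le_eqVlt.
case/predU1P => [<-|x0]; first by rewrite !mul0r subrr mul0r lexx.
rewrite ler_pdivlMr // ler_pdivrMr // powRE //; set y := s * ln x.
have h1 := expR_ge1Dx y; have h2 := expR_ge1Dx (- y).
rewrite expRN in h2.
have h3 : (1 - y) * expR y <= 1 by rewrite -ler_pdivlMr ?expR_gt0 // div1r.
apply/andP; split.
  have -> : x * ln x * s = x * y by rewrite /y; ring.
  have := ler_wpM2l (ltW x0) h1; lra.
have -> : x * ln x * expR y * s = x * (y * expR y) by rewrite /y; ring.
have h4 : expR y - 1 <= y * expR y by lra.
have := ler_wpM2l (ltW x0) h4; lra.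
Qed.

(** A domination uniform in [s <= e]. For [x > 1] one [e] in the exponent bounds [x^s] and the other
    pays for the logarithm. *)
Lemma norm_powR_incr_ratio_le e s x : 0 < s <= e -> 0 <= x ->
  `|(x `^ (1 + s) - x) / s| <= 1 + x `^ (1 + (e + e)) / e.
Proof.
move=> /andP[s0 se] x0; have e0 : 0 < e by lra.
have /andP[h1 h2] := powR_incr_ratio_bounds s0 x0.
have P : 0 <= x `^ (1 + (e + e)) / e by rewrite divr_ge0 ?powR_ge0 // ltW.
rewrite ler_norml; apply/andP; split.
  by have := xlnx_ge x0; lra.
apply: (le_trans h2).
have [x1|x1] := leP x 1.
  have : x * ln x <= 0.
    by rewrite mulr_ge0_le0 // ln_le0.
  move=> h; have : x * ln x * x `^ s <= 0 by rewrite mulr_le0_ge0 ?powR_ge0.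
  lra.
apply: ler_wpDl; first exact: ler01.
have x2 : 0 < x by lra.
have -> : x `^ (1 + (e + e)) / e = x * (x `^ e / e) * x `^ e.
  by rewrite powRDS // ?addr_ge0 ?ltW // gt0_powRD //; ring.
apply: ler_pM; rewrite ?powR_ge0 //.
- by rewrite mulr_ge0 // ln_ge0 // ltW.
- by rewrite ler_pM2l // ln_le_powR.
- by apply: ler_powR => //; exact: ltW.
Qed.

(** To first order in [1 / n] the left side is [1 + (d + g * m) / n]. With [d] half of the gap
    [c - g * m], a margin [d / n] remains, which beats the terms of second order for large [n]. *)
Lemma powR_ratio_ge (g c m : R) : 1 < g -> 0 < m -> g * m < c ->
  exists2 d, 0 < d & exists n0 : nat, forall n, (n0 <= n)%N -> (0 < n)%N ->
    (1 + d / n%:R) * (1 + m / n%:R) `^ g <= 1 + c / n%:R.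
Proof.
move=> g1 m0 gmc; pose d := (c - g * m) / 2.
have d0 : 0 < d by rewrite /d; lra.
have cE : c = g * m + d + d by rewrite /d; lra.
clearbody d; exists d => //.
have := @powR1D_le_Taylor2 g; set K1 := g ^+ 2 * expR g => Taylor.
have K10 : 0 < K1 by rewrite mulr_gt0 ?expR_gt0 // exprn_gt0; lra.
clearbody K1; pose K := K1 * m ^+ 2.
have K0 : 0 < K by rewrite /K mulr_gt0 ?exprn_gt0.
(* The first summand gives [m / n <= 1], as the Taylor bound requires; the other two keep the terms
   of higher order below [d / n]. *)
pose B := m + d * g * m / d + (1 + d) * K / d.
exists (Num.truncn B).+1 => n n0 np.
have nB : B < n%:R.
  apply: lt_le_trans (truncnS_gt B) _.
  by rewrite ler_nat.
have N0 : 0 < n%:R :> R by rewrite ltr0n.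
have N1 : 1 <= n%:R :> R by rewrite ler1n.
set u := n%:R^-1 : R.
have u0 : 0 < u by rewrite invr_gt0.
have u1 : u <= 1 by rewrite invf_le1.
have un : u * n%:R = 1 by rewrite mulVf ?gt_eqF.
have B1 : 0 <= d * g * m / d by rewrite divr_ge0 ?mulr_ge0 //; lra.
have B2 : 0 <= (1 + d) * K / d by rewrite divr_ge0 ?mulr_ge0 //; lra.
have mu1 : m * u <= 1.
  by rewrite -un (mulrC m) ler_pM2l //; move: nB; rewrite /B; lra.
have mu0 : 0 <= m * u by rewrite mulr_ge0 ?ltW.
have := Taylor (m * u) ltac:(lra) ltac:(by rewrite mu0).
rewrite exprMn (mulrA K1) -/K => h; clearbody K u.
have du : 0 < 1 + d * u by rewrite addr_gt0 // mulr_gt0.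
have {}h := ler_wpM2l (ltW du) h.
apply: (le_trans h).
have key : (d * g * m + (1 + d) * K) * u <= d.
  have X : d * g * m + (1 + d) * K <= d * n%:R.
    by rewrite (mulrC d n%:R) -ler_pdivrMr // mulrDl; move: nB; rewrite /B; lra.
  by have := ler_wpM2r (ltW u0) X; rewrite -(mulrA d n%:R) (mulrC n%:R) un mulr1.
have key2 : (d * g * m + (1 + d) * K) * u * u <= d * u by rewrite ler_pM2r.
have u3 : d * u ^+ 3 * K <= d * K * u * u.
  have -> : d * u ^+ 3 * K = (d * K * u * u) * u by ring.
  by rewrite ler_piMr // !mulr_ge0 // ltW.
have E : (1 + d * u) * (1 + g * (m * u) + K * u ^+ 2) =
  1 + g * m * u + d * u + d * g * m * u * u + K * u * u + d * u ^+ 3 * K by ring.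
rewrite E cE; lra.
Qed.

End RealInequalities.

(** * The normalizing sequence *)

Section EchoNorm.
Context {R : realType}.
Implicit Types c : R.

(* [echo_norm c n] is E[S_n] when the echo law has mean [c]. *)
Definition echo_norm c n : R := \prod_(1 <= k < n) (1 + c / k%:R).

Lemma echo_norm1 c : echo_norm c 1 = 1.
Proof. by rewrite /echo_norm big_geq. Qed.

Lemma echo_normS c n : (0 < n)%N ->
  echo_norm c n.+1 = echo_norm c n * (1 + c / n%:R).
Proof. by move=> n0; rewrite /echo_norm big_nat_recr. Qed.

Lemma echo_norm_gt0 c n : 0 <= c -> 0 < echo_norm c n.
Proof.
move=> c0; rewrite /echo_norm; apply: prodr_gt0 => k _.
by rewrite ltr_pwDl // divr_ge0.
Qed.

Lemma echo_norm_le c n k : 0 <= c -> (n <= k)%N -> echo_norm c n <= echo_norm c k.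
Proof.
move=> c0 /subnKC <-; elim: (k - n)%N => [|j IH]; first by rewrite addn0.
rewrite addnS; apply: (le_trans IH).
have [->|nj] := posnP (n + j)%N; first by rewrite /echo_norm !big_geq.
by rewrite echo_normS // ler_peMr ?(ltW (echo_norm_gt0 _ _)) // lerDl divr_ge0.
Qed.

End EchoNorm.

(** * The Gamma integral and the asymptotics of [echo_norm] *)

Section GammaAsymptotics.
Context {R : realType}.
Notation mu := (@lebesgue_measure R).
Implicit Types (x c p s A : R).

Local Notation gammaf c := (fun x : R => x `^ c * expR (- x)).

Lemma is_derive_expRNM c x : is_derive x 1 (fun y => expR (- (c * y))) (- c * expR (- (c * x))).
Proof.
have h : is_derive x (1:R) (fun y : R => - (c * y)) (- c).
  by apply: is_derive_eq; rewrite /GRing.scale/=; ring.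
by apply: is_derive_eq; rewrite mulrC.
Qed.

(** The recurrence of [Gamma] comes from [y^p * expR (- y)], whose derivative changes sign.
    Subtracting [A * expR (- y / 2)] adds a positive term to the derivative, so that the fundamental
    theorem of calculus for nonnegative integrands becomes applicable. *)
Lemma is_derive_gamma_primitive p A x : 0 < x ->
  is_derive x 1 (fun y => y `^ p * expR (- (1 * y)) - A * expR (- (2^-1 * y)))
    (p * x `^ (p - 1) * expR (- (1 * x)) - x `^ p * expR (- (1 * x))
     + A / 2 * expR (- (2^-1 * x))).
Proof.
move=> x0.
have h1 := is_derive1_powR p x0.
have h2 := is_derive_expRNM 1 x; have h3 := is_derive_expRNM 2^-1 x.
by apply: is_derive_eq; rewrite /GRing.scale/=; ring.
Qed.

Lemma cvgy_expRNM c : 0 < c -> expR (- (c * x)) @[x --> +oo] --> (0 : R).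
Proof.
move=> c0; apply: (@cvg_comp _ _ _ (fun x : R => c * x) (fun z => expR (- z)) _ (pinfty_nbhs R)).
  exact: gt0_cvgMry.
exact: cvgr_expR.
Qed.

Lemma continuous_expRNM c : continuous (fun x : R => expR (- (c * x))).
Proof.
move=> x; apply/differentiable_continuous/derivable1_diffP.
exact: (@ex_derive _ _ _ _ _ _ _ (is_derive_expRNM c x)).
Qed.

Lemma cvg_powR_at_right0 c : 0 <= c -> x `^ c @[x --> 0^'+] --> (0 `^ c : R).
Proof.
rewrite le_eqVlt => /predU1P[<-|c0].
  under eq_fun do rewrite powRr0.
  by rewrite powRr0; exact: cvg_cst.
by rewrite powR0 ?gt_eqF //; exact: powR_cvg0.
Qed.

Lemma continuous_powR c x : 0 < x -> {for x, continuous (fun y : R => y `^ c)}.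
Proof.
move=> x0; apply/differentiable_continuous/derivable1_diffP.
by apply: derivable_powR; rewrite in_itv/= x0.
Qed.

(** With [y = x / (2 * p)], [p * ln y <= p * y = x / 2], so half of the exponential decay is left
    over. *)
Lemma gammaf_bound p x : 0 < p -> 0 < x ->
  x `^ p * expR (- x) <= (2 * p) `^ p * expR (- (2^-1 * x)).
Proof.
move=> p0 x0.
have q0 : 0 < 2 * p by rewrite mulr_gt0.
have -> : x `^ p = (2 * p) `^ p * (x / (2 * p)) `^ p.
  rewrite -powRM; [|exact: ltW|by rewrite divr_ge0 // ltW].
  by rewrite mulrCA divff ?mulr1 // gt_eqF.
rewrite -mulrA ler_pM2l ?powR_gt0 //.
have y0 : 0 < x / (2 * p) by rewrite divr_gt0.
rewrite powRE // -expRD ler_expR.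
have : p * ln (x / (2 * p)) <= p * (x / (2 * p)).
  by rewrite ler_pM2l //; apply/ltW/ln_sublinear.
have -> : p * (x / (2 * p)) = x / 2 by field; rewrite gt_eqF.
lra.
Qed.

(** By [gammaf_bound] the condition on [A] makes the integrand nonnegative; the primitive runs from
    [- A] at 0 to 0 at infinity. The bound [1 <= p] gives continuity at 0, including [p = 1], where
    [0^0 = 1]. *)
Lemma gamma_FTC p A : 1 <= p -> (2 * p) `^ p <= A / 2 ->
  (\int[mu]_(x in `]0%R, +oo[)
     (p * x `^ (p - 1) * expR (- (1 * x)) - x `^ p * expR (- (1 * x))
     + A / 2 * expR (- (2^-1 * x)))%:E = A%:E)%E.
Proof.
move=> p1 hA.
pose f := fun x : R => p * x `^ (p - 1) * expR (- (1 * x)) -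
  x `^ p * expR (- (1 * x)) + A / 2 * expR (- (2^-1 * x)).
rewrite -/(f _).
have cf : {within `[0%R, +oo[, continuous f}.
  apply/continuous_within_itvcyP; split.
    move=> x; rewrite in_itv/= andbT => x0; rewrite /f.
    have h1 := @continuous_powR (p - 1) x x0; have h2 := @continuous_powR p x x0.
    have h3 := @continuous_expRNM 1 x; have h4 := @continuous_expRNM 2^-1 x.
    apply: cvgD; last by apply: cvgM => //; exact: cvg_cst.
    apply: cvgB; last by apply: cvgM.
    by apply: cvgM => //; apply: cvgM => //; exact: cvg_cst.
  rewrite /f.
  have h3 := cvg_at_right_filter (@continuous_expRNM 1 0).
  have h4 := cvg_at_right_filter (@continuous_expRNM 2^-1 0).
  apply: cvgD; last by apply: cvgM => //; exact: cvg_cst.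
  apply: cvgB; last by apply: cvgM => //; apply: cvg_powR_at_right0; lra.
  apply: cvgM => //; apply: cvgM; first exact: cvg_cst.
  by apply: cvg_powR_at_right0; lra.
rewrite integral_itv_obnd_cbnd; last first.
  apply/measurable_EFinP; apply: open_continuous_measurable_fun => //.
  by move: cf => /continuous_within_itvcyP[/in_continuous_mksetP cf _].
have p0 : 0 < p by lra.
rewrite (@ge0_continuous_FTC2y R f
  (fun y => y `^ p * expR (- (1 * y)) - A * expR (- (2^-1 * y))) 0 0) //.
- rewrite powR0 ?gt_eqF // mul0r mulr0 oppr0 expR0 mulr1 !sub0r EFinN oppeK.
  by rewrite add0e.
- move=> x; rewrite le_eqVlt => /predU1P[<-|x0]; rewrite /f.
    rewrite (@powR0 _ p) ?gt_eqF // mul0r subr0 !mulr0 oppr0 expR0 !mulr1.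
    apply: addr_ge0; first by rewrite mulr_ge0 ?powR_ge0 // ltW.
    by apply: le_trans hA; exact: powR_ge0.
  have := gammaf_bound p0 x0; rewrite mul1r => h.
  have h2 : (2 * p) `^ p * expR (- (2^-1 * x)) <= A / 2 * expR (- (2^-1 * x)).
    by apply: ler_wpM2r => //; exact: expR_ge0.
  have h3 : 0 <= p * x `^ (p - 1) * expR (- x).
    by rewrite !mulr_ge0 ?powR_ge0 ?expR_ge0 // ltW.
  lra.
- rewrite -[X in _ --> X]subr0 -[X in _ --> _ - X](mulr0 A).
  apply: cvgB; last first.
    by apply: cvgM; [exact: cvg_cst|apply: cvgy_expRNM].
  apply: (@squeeze_cvgr _ _ _ _ (fun=> 0) (fun x => (2 * p) `^ p * expR (- (2^-1 * x)))).
  + near=> x; have x0 : 0 < x by near: x; exact: nbhs_pinfty_gt.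
    by rewrite mulr_ge0 ?powR_ge0 ?expR_ge0 //= mul1r gammaf_bound.
  + exact: cvg_cst.
  + rewrite -[X in _ --> X](mulr0 ((2 * p) `^ p)).
    by apply: cvgM; [exact: cvg_cst|apply: cvgy_expRNM].
- move=> x x0; exact: (@ex_derive _ _ _ _ _ _ _ (is_derive_gamma_primitive p A x0)).
- have h3 := cvg_at_right_filter (@continuous_expRNM 1 0).
  have h4 := cvg_at_right_filter (@continuous_expRNM 2^-1 0).
  apply: cvgB; last by apply: cvgM => //; exact: cvg_cst.
  by apply: cvgM => //; apply: cvg_powR_at_right0; lra.
- move=> x; rewrite in_itv/= andbT => x0.
  rewrite derive1E; have [_ ->] := is_derive_gamma_primitive p A x0.
  by [].
Unshelve. all: end_near. Qed.

Lemma measurable_expRNM c : measurable_fun setT (fun x : R => expR (- (c * x))).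
Proof. by apply: continuous_measurable_fun; exact: continuous_expRNM. Qed.

Lemma integral_expRNM c : 0 < c ->
  (\int[mu]_(x in `]0%R, +oo[) (expR (- (c * x)))%:E = (c^-1)%:E)%E.
Proof.
move=> c0; rewrite integral_itv_obnd_cbnd; last first.
  by apply/measurable_EFinP/measurable_funTS; exact: measurable_expRNM.
rewrite (@ge0_continuous_FTC2y R _ (fun y => - (c^-1 * expR (- (c * y)))) 0 0) //.
- by rewrite mulr0 oppr0 expR0 mulr1 sub0e -EFinN opprK.
- by apply/continuous_subspaceT; exact: continuous_expRNM.
- rewrite -oppr0 -[X in - X](mulr0 c^-1); apply: cvgN.
  by apply: cvgM; [exact: cvg_cst|exact: cvgy_expRNM].
- apply: cvgN; apply: cvgM; first exact: cvg_cst.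
  exact: cvg_at_right_filter (@continuous_expRNM c 0).
- move=> x; rewrite in_itv/= andbT => x0.
  have h := is_derive_expRNM c x.
  have [_ <-] : is_derive x 1 (fun y => - (c^-1 * expR (- (c * y)))) (expR (- (c * x))).
    by apply: is_derive_eq; rewrite /GRing.scale/=; field; rewrite gt_eqF.
  by rewrite derive1E.
Qed.

Lemma integrable_expRNM c : 0 < c ->
  mu.-integrable `]0%R, +oo[ (EFin \o (fun x => expR (- (c * x)))).
Proof.
move=> c0; apply/integrableP; split.
  by apply/measurable_EFinP/measurable_funTS; exact: measurable_expRNM.
under eq_integral do rewrite /= ger0_norm ?expR_ge0 //.
by rewrite integral_expRNM // ltry.
Qed.

Lemma measurable_gammaf c : measurable_fun setT (gammaf c).
Proof.
apply: measurable_funM; first exact: measurable_powR.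
by have := measurable_expRNM 1; under eq_fun do rewrite mul1r.
Qed.

Lemma integrable_gammaf c : 0 <= c -> mu.-integrable `]0%R, +oo[ (EFin \o gammaf c).
Proof.
(* [gammaf_bound] needs a positive exponent, hence the detour through [x^c <= 1 + x^(c+1)], which
   also covers [c = 0]. *)
move=> c0; set K := 1 + (2 * (c + 1)) `^ (c + 1).
have h : mu.-integrable `]0%R, +oo[ (EFin \o (fun x => K * expR (- (2^-1 * x)))).
  have i := @integrable_expRNM 2^-1 ltac:(by rewrite invr_gt0).
  exact: integrableZl i.
apply: le_integrable h => //.
  by apply/measurable_EFinP/measurable_funTS; exact: measurable_gammaf.
move=> x; rewrite /= in_itv/= andbT => x0; rewrite lee_fin.
rewrite ger0_norm; last by rewrite mulr_ge0 ?powR_ge0 ?expR_ge0.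
have P : 0 <= (2 * (c + 1)) `^ (c + 1) by exact: powR_ge0.
rewrite ger0_norm; last by rewrite mulr_ge0 ?expR_ge0 // /K addr_ge0.
have h1 := @gammaf_bound (c + 1) x ltac:(lra) x0.
have h2 : expR (- x) <= expR (- (2^-1 * x)) by rewrite ler_expR; lra.
have h3 : x `^ c <= 1 + x `^ (c + 1).
  have [x1|x1] := leP x 1.
    apply: ler_wpDr; first exact: powR_ge0.
    by have := @ger_powR _ x ltac:(by rewrite x0) 0 c c0; rewrite powRr0.
  apply: ler_wpDl => //; apply: ler_powR; [exact: ltW|lra].
have := ler_wpM2r (expR_ge0 (- x)) h3; rewrite mulrDl mul1r /K mulrDl mul1r; lra.
Qed.

Lemma Gamma1DE c : Gamma (1 + c) = \int[mu]_(x in `]0%R, +oo[) (x `^ c * expR (- x)).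
Proof. by rewrite /Gamma addrAC subrr add0r. Qed.

Lemma Gamma1 : Gamma (1 + 0) = 1 :> R.
Proof.
rewrite Gamma1DE /Rintegral.
under eq_integral do rewrite powRr0 mul1r -[X in expR (- X)]mul1r.
by rewrite integral_expRNM // invr1.
Qed.

Lemma GammaS c : 0 <= c -> Gamma (1 + (c + 1)) = (c + 1) * Gamma (1 + c).
Proof.
move=> c0; rewrite !Gamma1DE.
set p := c + 1; set A := 2 * (2 * p) `^ p.
have p1 : 1 <= p by rewrite /p; lra.
have h := @gamma_FTC p A p1 ltac:(by rewrite /A; lra).
have E : \int[mu]_(x in `]0%R, +oo[) (p * (x `^ c * expR (- x)) - x `^ p * expR (- x)
     + A / 2 * expR (- (2^-1 * x))) = A.
  rewrite /Rintegral -[RHS]/(fine A%:E) -h; congr fine; apply: eq_integral => x _.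
  by rewrite /p addrK !mul1r mulrA.
have i1 := integrable_gammaf c0.
have i2 := @integrable_gammaf p ltac:(lra).
have i3 := @integrable_expRNM 2^-1 ltac:(by rewrite invr_gt0).
have i1' : mu.-integrable `]0%R, +oo[ (EFin \o (fun x => p * (x `^ c * expR (- x)))).
  exact: integrableZl i1.
have i3' : mu.-integrable `]0%R, +oo[ (EFin \o (fun x => A / 2 * expR (- (2^-1 * x)))).
  exact: integrableZl i3.
have i12 : mu.-integrable `]0%R, +oo[
    (EFin \o (fun x => p * (x `^ c * expR (- x)) - x `^ p * expR (- x))).
  exact: integrableB i1' i2.
(* The auxiliary exponential integrates to [A / 2 * 2 = A] and cancels against the value of the
   whole integral. *)
move: E; rewrite RintegralD // RintegralB // RintegralZl // RintegralZl //.
rewrite [X in _ + _ * X = _](_ : _ = 2); last first.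
  by rewrite /Rintegral integral_expRNM ?invr_gt0 // invrK.
lra.
Qed.

Lemma Gamma1D_natr n : Gamma (1 + n%:R) = n`!%:R :> R.
Proof.
elim: n => [|n IH]; first by rewrite Gamma1.
by rewrite -natr1 GammaS // IH factS natrM natr1.
Qed.

Lemma Gamma_ge0 c : 0 <= Gamma c :> R.
Proof. by apply: Rintegral_ge0 => x _; rewrite mulr_ge0 ?powR_ge0 ?expR_ge0. Qed.

(** The concave map [x^s] lies below its tangent at [N = c + 1], the mean of the density
    proportional to [x^c * expR (- x)]. Integrating the tangent and using [GammaS] gives exactly
    [N^s * Gamma (1 + c)]. *)
Lemma GammaD_le c s : 0 <= c -> 0 <= s <= 1 ->
  Gamma (1 + (c + s)) <= (c + 1) `^ s * Gamma (1 + c).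
Proof.
move=> c0 /andP[s0 s1]; set N := c + 1; have N0 : 0 < N by rewrite /N; lra.
have i1 := @integrable_gammaf (c + s) ltac:(lra).
have i2 := integrable_gammaf c0.
have i3 := @integrable_gammaf (c + 1) ltac:(lra).
have i2' : mu.-integrable `]0%R, +oo[
    (EFin \o (fun x => (1 - s) * N `^ s * (x `^ c * expR (- x)))).
  exact: integrableZl i2.
have i3' : mu.-integrable `]0%R, +oo[
    (EFin \o (fun x => s * N `^ (s - 1) * (x `^ (c + 1) * expR (- x)))).
  exact: integrableZl i3.
have -> : N `^ s * Gamma (1 + c) = \int[mu]_(x in `]0%R, +oo[)
   ((1 - s) * N `^ s * (x `^ c * expR (- x)) + s * N `^ (s - 1) * (x `^ (c + 1) * expR (- x))).
  rewrite RintegralD // RintegralZl // RintegralZl // -!Gamma1DE GammaS //.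
  rewrite -/N -{1 2}(powRD1 s N0); ring.
rewrite Gamma1DE; apply: le_Rintegral => //; first exact: (integrableD _ i2' i3').
move=> x; rewrite /= in_itv/= andbT => x0.
have y0 : 0 < x / N by rewrite divr_gt0.
have key : x `^ s <= (1 - s) * N `^ s + s * N `^ (s - 1) * x.
  have -> : x `^ s = N `^ s * (x / N) `^ s.
    by rewrite -powRM ?ltW // mulrCA divff ?mulr1 // gt_eqF.
  have -> : s * N `^ (s - 1) * x = N `^ s * (s * (x / N)).
    by rewrite -(powRD1 s N0); field; rewrite gt_eqF.
  have -> : (1 - s) * N `^ s + N `^ s * (s * (x / N)) = N `^ s * (1 - s + s * (x / N)).
    by ring.
  rewrite ler_pM2l ?powR_gt0 //; set y := x / N in y0 *.
  move: s0; rewrite le_eqVlt => /predU1P[<-|s0].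
    by rewrite powRr0 mul0r subr0 addr0.
  move: s1; rewrite le_eqVlt => /predU1P[->|s1].
    by rewrite (powRr1 (ltW y0)) subrr add0r mul1r.
  have := @powR_young R s^-1 1 (y `^ s) ltac:(by rewrite invf_gt1) ltac:(by []) (powR_ge0 _ _).
  rewrite -powRrM mulfV ?gt_eqF // (powRr1 (ltW y0)) !powR1 mul1r mulr1 => hy.
  have := ler_wpM2l (ltW s0) hy; rewrite mulrA mulfV ?gt_eqF // mul1r.
  have -> : s * (y + (s^-1 - 1)) = 1 - s + s * y by field; rewrite gt_eqF.
  by [].
have := ler_wpM2l (powR_ge0 x c) key.
rewrite (gt0_powRD c s x0) (gt0_powRD c 1 x0) (powRr1 (ltW x0)) => h.
have := ler_wpM2r (expR_ge0 (- x)) h.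
lra.
Qed.

(** [GammaD_le] from [c] up to the next integer bounds a factorial by a multiple of
    [Gamma (1 + c)]. *)
Lemma Gamma_gt0 c : 0 <= c -> 0 < Gamma (1 + c) :> R.
Proof.
move=> c0; pose j := Num.truncn c; pose s := c - j%:R.
have cj : c = j%:R + s by rewrite /s addrC subrK.
have /andP[j1 j2] := truncn_itv c0.
have s01 : 0 <= s <= 1.
  by rewrite /s subr_ge0 j1 /= lerBlDr addrC natr1 ltW.
have := @GammaD_le (j%:R + s) (1 - s) ltac:(lra) ltac:(lra).
rewrite -addrA subrKC natr1 Gamma1D_natr -cj => h.
have f0 : 0 < (j.+1`!)%:R :> R by rewrite ltr0n fact_gt0.
rewrite lt0r Gamma_ge0 andbT; apply/eqP => G0.
by rewrite G0 mulr0 in h; lra.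
Qed.

Lemma echo_norm_GammaE c n : 0 <= c ->
  Gamma (1 + (n%:R + c)) = Gamma (1 + c) * n`!%:R * echo_norm c n.+1 :> R.
Proof.
move=> c0; elim: n => [|n IH]; first by rewrite add0r echo_norm1 !mulr1.
have -> : n.+1%:R + c = n%:R + c + 1 by rewrite -natr1; ring.
rewrite GammaS ?addr_ge0 // IH factS natrM (@echo_normS _ c n.+1) // -addrA (addrC c).
rewrite addrA natr1; have : n.+1%:R != 0 :> R by rewrite pnatr_eq0.
by move: (n.+1%:R : R) => N N0; field.
Qed.

Lemma cvg_natr_shift_ratio c : (n%:R + c) / n%:R @[n --> \oo] --> (1 : R).
Proof.
have h : 1 + c * n%:R^-1 @[n --> \oo] --> (1 + c * 0 : R).
  apply: cvgD; first exact: cvg_cst.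
  apply: cvgM; first exact: cvg_cst.
  apply/gtr0_cvgV0; last exact: cvgr_idn.
  by near=> n; rewrite ltr0n; near: n; exact: nbhs_infty_gt.
rewrite mulr0 addr0 in h; apply: cvg_trans h; apply: near_eq_cvg; near=> n.
have n0 : 0 < n%:R :> R by rewrite ltr0n; near: n; exact: nbhs_infty_gt.
by rewrite mulrDl divff ?gt_eqF.
Unshelve. all: end_near. Qed.

(** Wendel's two-sided bound: [GammaD_le] from [n] to [n + s] yields the upper estimate, and from
    [n + s] to [n + 1] the lower one. At both integers [Gamma] is a factorial. *)
Lemma Gamma_echo_norm_bounds s n : 0 <= s <= 1 ->
  ((n.+1%:R + s) / n.+1%:R)^-1 <= Gamma (1 + s) * echo_norm s n.+1 / n.+1%:R `^ s <= 1.
Proof.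
move=> /[dup] s01 /andP[s0 s1].
have nf : 0 < n`!%:R :> R by rewrite ltr0n fact_gt0.
set g := Gamma (1 + s) * _.
have gE : g = Gamma (1 + (n%:R + s)) / n`!%:R.
  by rewrite echo_norm_GammaE // /g; field; rewrite gt_eqF.
have N0 : 0 < n.+1%:R :> R by rewrite ltr0n.
have P0 : 0 < n.+1%:R `^ s :> R by exact: powR_gt0.
have up := @GammaD_le n%:R s ltac:(by []) s01.
have lo := @GammaD_le (n%:R + s) (1 - s) ltac:(by rewrite addr_ge0) ltac:(lra).
rewrite Gamma1D_natr natr1 in up; rewrite -addrA subrKC natr1 Gamma1D_natr factS natrM in lo.
apply/andP; split; last by rewrite ler_pdivrMr // mul1r gE ler_pdivrMr // mulrC [X in _ <= X]mulrC.
rewrite ler_pdivlMr // invf_div gE ler_pdivlMr //.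
set W := n%:R + s + 1 in lo; have W1 : n.+1%:R + s = W by rewrite /W -natr1; ring.
have W0 : 0 < W by rewrite -W1; lra.
rewrite W1; have : n.+1%:R `^ s <= W `^ s.
  by apply: ge0_ler_powR; rewrite ?nnegrE // ?(ltW W0) // -W1; lra.
move=> h; have h2 := ler_wpM2l (ltW N0) h.
have h3 := ler_wpM2r (ltW nf) h2.
have -> : n.+1%:R / W * n.+1%:R `^ s * n`!%:R = (n.+1%:R * n.+1%:R `^ s * n`!%:R) / W.
  by field; rewrite gt_eqF.
rewrite ler_pdivrMr //; apply: (le_trans h3).
have := ler_wpM2l (powR_ge0 W s) lo.
rewrite (mulrA _ (W `^ (1 - s))) -(gt0_powRD s (1 - s) W0) subrKC (powRr1 (ltW W0)).
by rewrite mulrA (mulrC W) (mulrC (W `^ s) n.+1%:R).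
Qed.

Lemma cvg_echo_norm_le1 s : 0 <= s <= 1 ->
  Gamma (1 + s) * echo_norm s n / n%:R `^ s @[n --> \oo] --> (1 : R).
Proof.
move=> s01.
have lower : ((n%:R + s) / n%:R)^-1 @[n --> \oo] --> (1 : R).
  by rewrite -[X in _ --> X]invr1; apply: cvgV => //; exact: cvg_natr_shift_ratio.
apply: (squeeze_cvgr _ lower (cvg_cst (1:R))); near=> n.
have n0 : (0 < n)%N by near: n; exact: nbhs_infty_gt.
by rewrite -(prednK n0); exact: Gamma_echo_norm_bounds.
Unshelve. all: end_near. Qed.

(** Raising the parameter by 1 reduces the asymptotics for every [c >= 0] to the fractional part,
    where [Gamma_echo_norm_bounds] applies. *)
Lemma echo_normD1 c n : 0 <= c -> (0 < n)%N ->
  echo_norm (c + 1) n * (1 + c) = echo_norm c n * (n%:R + c).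
Proof.
move=> c0; elim: n => // [[|n]] IH _; first by rewrite !echo_norm1.
rewrite (echo_normS (c + 1)) // (echo_normS c) // mulrAC IH // -(natr1 n.+1).
have : n.+1%:R != 0 :> R by rewrite pnatr_eq0.
by move: (n.+1%:R : R) => N N0; field.
Qed.

Lemma cvg_Gamma_echo_norm c : 0 <= c ->
  Gamma (1 + c) * echo_norm c n / n%:R `^ c @[n --> \oo] --> (1 : R).
Proof.
move=> c0; pose j := Num.truncn c; pose s := c - j%:R.
have cj : c = s + j%:R by rewrite /s subrK.
have /andP[j1 j2] := truncn_itv c0.
have s01 : 0 <= s <= 1.
  by rewrite /s subr_ge0 j1 /= lerBlDr addrC natr1 ltW.
rewrite cj; move: s01 (j); clearbody s => s01 k {cj j1 j2 j c0 c}.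
elim: k => [|k IH]; first by rewrite addr0; exact: cvg_echo_norm_le1.
have s0 : 0 <= s + k%:R by case/andP : s01 => ? _; rewrite addr_ge0.
set e := s + k%:R in IH s0.
rewrite -[X in _ --> X]mulr1.
apply: cvg_trans (cvgM IH (@cvg_natr_shift_ratio e)); apply: near_eq_cvg; near=> n.
have n0 : (0 < n)%N by near: n; exact: nbhs_infty_gt.
have N0 : 0 < n%:R :> R by rewrite ltr0n.
have -> : s + k.+1%:R = e + 1 by rewrite /e -natr1 addrA.
rewrite GammaS // gt0_powRD // powRr1 //.
have h := echo_normD1 s0 n0.
have P0 : 0 < n%:R `^ e :> R by exact: powR_gt0.
transitivity (Gamma (1 + e) * (echo_norm e n * (n%:R + e)) / (n%:R `^ e * n%:R)).
  by rewrite /=; field; rewrite !gt_eqF.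
by rewrite -h; field; rewrite !gt_eqF.
Unshelve. all: end_near. Qed.

Lemma cvg_echo_norm c : 0 <= c ->
  echo_norm c n / n%:R `^ c @[n --> \oo] --> (Gamma (1 + c))^-1.
Proof.
move=> c0; have G0 := Gamma_gt0 c0.
rewrite -[X in _ --> X]mulr1.
apply: cvg_trans (cvgM (cvg_cst (Gamma (1 + c))^-1) (cvg_Gamma_echo_norm c0)).
apply: near_eq_cvg; apply: nearW => n.
by rewrite /= !mulrA mulVf ?mul1r // gt_eqF.
Qed.

End GammaAsymptotics.

(** * Calculus of real expectations *)

Section Integrals.
Context {R : realType} d {T : measurableType d} (P : probability T R).
Local Notation intg f := (P.-integrable setT (EFin \o f)).
Local Notation Ex f := (\int[P]_w f w)%R.
Implicit Types (f g h : T -> R).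

Lemma intg_meas f : intg f -> measurable_fun setT f.
Proof. by move=> /measurable_int /measurable_EFinP. Qed.

Lemma intg_cst (c : R) : intg (fun=> c).
Proof. exact: finite_measure_integrable_cst. Qed.

Lemma Ex_cst (c : R) : Ex (fun=> c) = c.
Proof. transitivity (c * fine (P setT)); first exact: Rintegral_cst.
by rewrite probability_setT mulr1. Qed.

Lemma intgD f g : intg f -> intg g -> intg (fun w => f w + g w).
Proof. exact: integrableD. Qed.

Lemma ExD f g : intg f -> intg g -> Ex (fun w => f w + g w) = Ex f + Ex g.
Proof. exact: RintegralD. Qed.

Lemma intgB f g : intg f -> intg g -> intg (fun w => f w - g w).
Proof. exact: integrableB. Qed.

Lemma ExB f g : intg f -> intg g -> Ex (fun w => f w - g w) = Ex f - Ex g.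
Proof. exact: RintegralB. Qed.

Lemma intgZ (c : R) f : intg f -> intg (fun w => c * f w).
Proof. exact: integrableZl. Qed.

Lemma ExZ (c : R) f : intg f -> Ex (fun w => c * f w) = c * Ex f.
Proof. exact: RintegralZl. Qed.

Lemma intg_sum I (s : seq I) (F : I -> T -> R) :
  (forall i, intg (F i)) -> intg (fun w => \sum_(i <- s) F i w).
Proof.
move=> iF; elim: s => [|i s IH].
  by under eq_fun do rewrite big_nil; exact: intg_cst.
by under eq_fun do rewrite big_cons; exact: intgD.
Qed.

Lemma Ex_sum I (s : seq I) (F : I -> T -> R) : (forall i, intg (F i)) ->
  Ex (fun w => \sum_(i <- s) F i w) = \sum_(i <- s) Ex (F i).
Proof.
move=> iF; elim: s => [|i s IH].
  by under eq_fun do rewrite big_nil; rewrite big_nil Ex_cst.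
under eq_fun do rewrite big_cons.
by rewrite ExD ?big_cons ?IH //; exact: intg_sum.
Qed.

Lemma intg_sum_nat (a b : nat) (F : nat -> T -> R) :
  (forall i, (a <= i < b)%N -> intg (F i)) -> intg (fun w => \sum_(a <= i < b) F i w).
Proof.
move=> iF.
(* [intg_sum] asks for integrability at every index, so the terms out of range are replaced by 0. *)
have := @intg_sum _ (index_iota a b) (fun i w => if (a <= i < b)%N then F i w else 0).
have E : (fun w => \sum_(a <= i < b) (if (a <= i < b)%N then F i w else 0)) =
         (fun w => \sum_(a <= i < b) F i w).
  by apply/funext => w; apply: eq_big_nat => i ->.
rewrite E; apply => i; have [ab|nab] := boolP (a <= i < b)%N; first exact: iF.
exact: intg_cst.
Qed.

Lemma Ex_sum_nat (a b : nat) (F : nat -> T -> R) :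
  (forall i, (a <= i < b)%N -> intg (F i)) ->
  Ex (fun w => \sum_(a <= i < b) F i w) = \sum_(a <= i < b) Ex (F i).
Proof.
move=> iF.
have := @Ex_sum _ (index_iota a b) (fun i w => if (a <= i < b)%N then F i w else 0).
have E : (fun w => \sum_(a <= i < b) (if (a <= i < b)%N then F i w else 0)) =
         (fun w => \sum_(a <= i < b) F i w).
  by apply/funext => w; apply: eq_big_nat => i ->.
rewrite E => ->; last first.
  move=> i; have [ab|nab] := boolP (a <= i < b)%N; first exact: iF.
  exact: intg_cst.
by apply: eq_big_nat => i ->.
Qed.

Lemma Ex_le f g : intg f -> intg g -> (forall w, f w <= g w) -> Ex f <= Ex g.
Proof. by move=> fi gi fg; apply: le_Rintegral. Qed.

Lemma Ex_ge0 f : (forall w, 0 <= f w) -> 0 <= Ex f.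
Proof. by move=> f0; apply: Rintegral_ge0. Qed.

Lemma intg_le f g : measurable_fun setT f -> (forall w, `|f w| <= g w) ->
  intg g -> intg f.
Proof.
move=> mf fg gi; apply: le_integrable gi => //; first exact/measurable_EFinP.
by move=> w _ /=; rewrite lee_fin (le_trans (fg w)) // ler_norm.
Qed.

Lemma ge0_intg_le f g : measurable_fun setT f -> (forall w, 0 <= f w <= g w) ->
  intg g -> intg f.
Proof.
move=> mf fg; apply: intg_le => // w; have /andP[f0 fg'] := fg w.
by rewrite ger0_norm.
Qed.

Lemma EFin_Ex f : intg f -> ((Ex f)%:E = \int[P]_w (f w)%:E)%E.
Proof. by move=> fi; rewrite /Rintegral fineK //; exact: integrable_fin_num. Qed.

Lemma ge0_intg_lty f : measurable_fun setT f -> (forall w, 0 <= f w) ->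
  (\int[P]_w (f w)%:E < +oo)%E -> intg f.
Proof.
move=> mf f0 foo; apply/integrableP; split; first exact/measurable_EFinP.
by under eq_integral do rewrite /= ger0_norm //.
Qed.

Lemma Ex_indic (A : set T) : measurable A -> Ex (fun w => \1_A w) = fine (P A).
Proof. by move=> mA; rewrite /Rintegral integral_indic // setIT. Qed.

End Integrals.

(** * Independence and expectations of products *)

Section ProductRule.
Context {R : realType} d {T : measurableType d} (P : probability T R).
Local Notation intg f := (P.-integrable setT (EFin \o f)).
Local Notation Ex f := (\int[P]_w f w)%R.

Definition indep_rv (X Y : T -> R) := forall A B : set R,
  measurable A -> measurable B ->
  P (X @^-1` A `&` Y @^-1` B) = (P (X @^-1` A) * P (Y @^-1` B))%E.

(** The joint law of [X] and [Y] is the product of their laws, and Tonelli's theorem applies. The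
    maxima with 0 in [g] make the integrand nonnegative on the whole plane and not only on the range
    of [(X, Y)]. *)
Lemma ge0_integral_indepM (X Y : {RV P >-> R}) : indep_rv X Y ->
  (forall w, 0 <= X w) -> (forall w, 0 <= Y w) ->
  (\int[P]_w (X w * Y w)%:E = \int[P]_w (X w)%:E * \int[P]_w (Y w)%:E)%E.
Proof.
move=> XY X0 Y0.
pose XYf w := (X w, Y w).
have mXY : measurable_fun setT XYf by apply/measurable_fun_pairP.
pose g (z : R * R) := (Num.max z.1 0 * Num.max z.2 0)%:E.
have mg : measurable_fun setT g.
  apply/measurable_EFinP; apply: measurable_funM; exact: measurable_maxr.
have g0 z : (0 <= g z)%E by rewrite lee_fin mulr_ge0 // le_max lexx orbT.
transitivity (\int[pushforward P XYf]_z g z)%E.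
  rewrite ge0_integral_pushforward //.
  by apply: eq_integral => w _; rewrite /g/= !max_l.
rewrite (@eq_measure_integral _ _ _ _ (distribution P X \x distribution P Y)%E); last first.
  move=> A mA _; symmetry.
  pose mXYf : {mfun T >-> (R * R)%type} := HB.pack XYf (isMeasurableFun.Build _ _ _ _ XYf mXY).
  apply: (@product_measure_unique _ _ _ _ _ (distribution P X) (distribution P Y) (distribution P mXYf)) => //.
have mm : measurable_fun setT (fun y : R => (Num.max y 0)%:E).
  by apply/measurable_EFinP; exact: measurable_maxr.
have m0 (y : R) : (0 <= (Num.max y 0)%:E)%E by rewrite lee_fin le_max lexx orbT.
rewrite fubini_tonelli1 // /fubini_F /g /=.
transitivity (\int[distribution P X]_x ((Num.max x 0)%:E *
    \int[distribution P Y]_y (Num.max y 0)%:E))%E.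
  apply: eq_integral => x _; rewrite -ge0_integralZl //.
rewrite ge0_integralZr //; last exact: integral_ge0.
by congr (_ * _)%E; rewrite ge0_integral_distribution //;
  apply: eq_integral => w _ /=; rewrite max_l.
Qed.

Lemma indep_rv_comp (X Y : T -> R) (f g : R -> R) : measurable_fun setT f ->
  measurable_fun setT g -> indep_rv X Y -> indep_rv (f \o X) (g \o Y).
Proof.
move=> mf mg XY A B mA mB; apply: (XY (f @^-1` A) (g @^-1` B)).
- by rewrite -[X in measurable X]setTI; exact: mf.
- by rewrite -[X in measurable X]setTI; exact: mg.
Qed.

(** Positive and negative parts stay independent, so the nonnegative case settles each of the four
    products. *)
Lemma indep_intgM (X Y : T -> R) : indep_rv X Y -> intg X -> intg Y ->
  intg (fun w => X w * Y w) /\ Ex (fun w => X w * Y w) = Ex X * Ex Y.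
Proof.
move=> XY iX iY.
have mX := intg_meas iX; have mY := intg_meas iY.
pose p (x : R) := Num.max x 0; pose n (x : R) := Num.max (- x) 0.
have mp : measurable_fun setT p by apply: measurable_maxr.
have mn : measurable_fun setT n.
  by apply: measurable_maxr => //; exact: measurable_oppr.
have p0 x : 0 <= p x by rewrite le_max lexx orbT.
have n0 x : 0 <= n x by rewrite le_max lexx orbT.
have pn x : x = p x - n x.
  by rewrite /p /n !maxEle; have [h|h] := leP x 0; have [h'|h'] := leP (- x) 0; lra.
have pa x : p x <= `|x| by rewrite ge_max ler_norm normr_ge0.
have na x : n x <= `|x| by rewrite ge_max -normrN ler_norm normr_ge0.
have comp_int (f : R -> R) (Z : T -> R) : intg Z -> measurable_fun setT f -> (forall x, 0 <= f x) ->
    (forall x, f x <= `|x|) -> intg (f \o Z).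
  move=> iZ mf f0 fa; apply: (@ge0_intg_le _ _ _ _ _ (fun w => `|Z w|)).
  - by apply: measurableT_comp => //; exact: intg_meas iZ.
  - by move=> w; rewrite f0 fa.
  - exact: integrable_norm.
have key (f g : R -> R) : measurable_fun setT f -> measurable_fun setT g ->
    (forall x, 0 <= f x) -> (forall x, 0 <= g x) ->
    (forall x, f x <= `|x|) -> (forall x, g x <= `|x|) ->
    intg (fun w => f (X w) * g (Y w)) /\
    Ex (fun w => f (X w) * g (Y w)) = Ex (f \o X) * Ex (g \o Y).
  move=> mf mg f0 g0 fa ga.
  have mfX : measurable_fun setT (f \o X) by exact: measurableT_comp.
  have mgY : measurable_fun setT (g \o Y) by exact: measurableT_comp.
  have iF := comp_int f X iX mf f0 fa; have iG := comp_int g Y iY mg g0 ga.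
  pose X' : {RV P >-> R} := HB.pack (f \o X) (isMeasurableFun.Build _ _ _ _ _ mfX).
  pose Y' : {RV P >-> R} := HB.pack (g \o Y) (isMeasurableFun.Build _ _ _ _ _ mgY).
  have E := @ge0_integral_indepM X' Y' (indep_rv_comp mf mg XY)
    (fun w => f0 _) (fun w => g0 _).
  have {}E : (\int[P]_w (f (X w) * g (Y w))%:E = (Ex (f \o X) * Ex (g \o Y))%:E)%E.
    by rewrite EFinM !EFin_Ex //; exact: E.
  have iXY : intg (fun w => f (X w) * g (Y w)).
    apply: ge0_intg_lty; first exact: measurable_funM.
      by move=> w; rewrite mulr_ge0.
    by rewrite E ltry.
  by split=> //; apply/EFin_inj; rewrite EFin_Ex.
have [i1 e1] := key p p mp mp p0 p0 pa pa.
have [i2 e2] := key p n mp mn p0 n0 pa na.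
have [i3 e3] := key n p mn mp n0 p0 na pa.
have [i4 e4] := key n n mn mn n0 n0 na na.
have E : (fun w => X w * Y w) = (fun w => (p (X w) * p (Y w) - p (X w) * n (Y w)) -
    (n (X w) * p (Y w) - n (X w) * n (Y w))).
  by apply/funext => w; rewrite {1}(pn (X w)) {1}(pn (Y w)); ring.
have EX : Ex X = Ex (p \o X) - Ex (n \o X).
  rewrite -ExB; [|exact: comp_int|exact: comp_int].
  by apply: eq_Rintegral => w _; exact: pn.
have EY : Ex Y = Ex (p \o Y) - Ex (n \o Y).
  rewrite -ExB; [|exact: comp_int|exact: comp_int].
  by apply: eq_Rintegral => w _; exact: pn.
rewrite E; split; first by apply: intgB; apply: intgB.
rewrite ExB ?ExB //; [|exact: intgB|exact: intgB].
by rewrite EX EY e1 e2 e3 e4; ring.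
Qed.

(** Sigma-algebras are carried by generating families, so that a pi-system of rectangles can serve
    as the filtration. *)
Definition sigma_fun (C : set (set T)) (f : T -> R) :=
  measurable_fun (setT : set (g_sigma_algebraType C)) (f : g_sigma_algebraType C -> R).

Lemma sigma_fun_measurable (C : set (set T)) f : C `<=` measurable ->
  sigma_fun C f -> measurable_fun setT f.
Proof.
move=> CT Cf _ B mB; have := Cf measurableT B mB.
by apply: smallest_sub => //; exact: sigma_algebra_measurable.
Qed.

Lemma sigma_fun_sub (C C' : set (set T)) f : C `<=` <<s C' >> ->
  sigma_fun C f -> sigma_fun C' f.
Proof.
move=> CC' Cf _ B mB; have := Cf measurableT B mB.
by apply: smallest_sub => //; exact: smallest_sigma_algebra.
Qed.

(** [P] restricted to [V] and [P V] times [P] are finite measures that agree on the pi-system [C],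
    hence on the sigma-algebra it generates. [C setT] supplies the exhausting sequence of the
    uniqueness theorem. *)
Lemma indep_sigma (C : set (set T)) (V : set T) : C `<=` measurable ->
  setI_closed C -> C setT -> measurable V ->
  (forall E, C E -> P (E `&` V) = (P E * P V)%E) ->
  forall E, <<s C >> E -> P (E `&` V) = (P E * P V)%E.
Proof.
move=> Cm CI CT mV CV E sE.
have pV : (P V \is a fin_num) by exact: fin_num_measure.
pose r : {nonneg R} := NngNum (fine_ge0 (measure_ge0 P V)).
have cover : \bigcup_(k : nat) (setT : set T) = setT.
  by apply/seteqP; split => // t _; exists 0%N.
transitivity (mscale r P E); last by rewrite /mscale /= fineK // muleC.
apply: (@g_sigma_algebra_measure_unique _ R T C Cm (fun=> setT) (fun=> CT)
  cover (mrestr P mV) (mscale r P) CI _ _ E sE).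
- move=> A CA; transitivity (P (A `&` V)) => //; rewrite CV //.
  by transitivity ((r%:num)%:E * P A)%E => //; rewrite /= fineK // muleC.
- by move=> _; rewrite -[X in (X < _)%E]/(P (setT `&` V)) setTI ltey_eq pV.
Qed.

Lemma sigma_fun_indep_rv (C : set (set T)) (H Y : T -> R) :
  sigma_fun C H ->
  (forall E B, <<s C >> E -> measurable B ->
     P (E `&` Y @^-1` B) = (P E * P (Y @^-1` B))%E) ->
  indep_rv H Y.
Proof.
move=> CH EY A B mA mB; apply: EY => //.
by have := CH measurableT A mA; rewrite setTI.
Qed.

End ProductRule.

(** * The filtration of the walk and its product rule *)

Section Filtration.
Context {R : realType} d {T : measurableType d} (P : probability T R).
Variables (x : nat -> {RV P >-> R}) (u : nat -> {RV P >-> nat}).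
Local Notation D := [set n : nat | (2 <= n)%N].
Hypothesis x_indep : mutually_independent P D (fun n => x n : T -> R).
Hypothesis u_indep : mutually_independent P D (fun n => u n : T -> nat).
Hypothesis xu_indep : independent_systems P
  (family_sigma D (fun n => x n : T -> R)) (family_sigma D (fun n => u n : T -> nat)).

Definition xrect n (A : nat -> set R) : set T :=
  \big[setI/setT]_(2 <= i < n.+1) (x i @^-1` A i).
Definition urect n (B : nat -> set nat) : set T :=
  \big[setI/setT]_(2 <= i < n.+1) (u i @^-1` B i).

(** Two indices are kept because one step of the walk first reveals [u n.+1] and then [x n.+1]; the
    product rule needs the stage [rects n n.+1] in between. *)
Definition rects n m : set (set T) := [set E | exists A B,
  (forall i, measurable (A i)) /\ E = xrect n A `&` urect m B].

Lemma measurable_xpreim i (A : set R) : measurable A -> measurable (x i @^-1` A).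
Proof. by move=> mA; rewrite -[X in measurable X]setTI; exact: measurable_funP. Qed.

Lemma measurable_upreim i (B : set nat) : measurable (u i @^-1` B).
Proof. by rewrite -[X in measurable X]setTI; exact: measurable_funP. Qed.

Lemma measurable_xrect n A : (forall i, measurable (A i)) -> measurable (xrect n A).
Proof.
move=> mA; rewrite /xrect; elim/big_ind : _ => // [? ? ? ?|i _].
  exact: measurableI.
exact: measurable_xpreim.
Qed.

Lemma measurable_urect n B : measurable (urect n B).
Proof.
rewrite /urect; elim/big_ind : _ => // [? ? ? ?|i _].
  exact: measurableI.
exact: measurable_upreim.
Qed.

Lemma rects_measurable n m : rects n m `<=` measurable.
Proof.
move=> _ [A [B [mA ->]]]; apply: measurableI; first exact: measurable_xrect.
exact: measurable_urect.
Qed.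

Lemma xrectI n A A' : xrect n A `&` xrect n A' = xrect n (fun i => A i `&` A' i).
Proof. by rewrite /xrect -big_split. Qed.

Lemma urectI n B B' : urect n B `&` urect n B' = urect n (fun i => B i `&` B' i).
Proof. by rewrite /urect -big_split. Qed.

Lemma xrectT n : xrect n (fun=> setT) = setT.
Proof. by rewrite /xrect big1. Qed.

Lemma urectT n : urect n (fun=> setT) = setT.
Proof. by rewrite /urect big1. Qed.

Lemma rects_setI n m : setI_closed (rects n m).
Proof.
move=> _ _ [A [B [mA ->]]] [A' [B' [mA' ->]]].
exists (fun i => A i `&` A' i), (fun i => B i `&` B' i); split.
  by move=> i; exact: measurableI.
by rewrite -xrectI -urectI setIACA.
Qed.

Lemma rectsT n m : rects n m setT.
Proof.
by exists (fun=> setT), (fun=> setT); split => //; rewrite xrectT urectT setIT.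
Qed.

Lemma xrect_family n A : (forall i, measurable (A i)) ->
  family_sigma D (fun n => x n : T -> R) (xrect n A).
Proof.
move=> mA; set C := \bigcup_(i in D) preimage_set_system setT (x i) measurable.
suff : (measurable : set (set (g_sigma_algebraType C))) (xrect n A) by [].
rewrite /xrect big_nat_cond; elim/big_ind : _ => // [? ? ? ?|i].
  exact: measurableI.
rewrite andbT => /andP[i2 _]; apply: sub_sigma_algebra; exists i => //.
by exists (A i) => //; rewrite setTI.
Qed.

Lemma urect_family n B : family_sigma D (fun n => u n : T -> nat) (urect n B).
Proof.
set C := \bigcup_(i in D) preimage_set_system setT (u i) measurable.
suff : (measurable : set (set (g_sigma_algebraType C))) (urect n B) by [].
rewrite /urect big_nat_cond; elim/big_ind : _ => // [? ? ? ?|i].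
  exact: measurableI.
rewrite andbT => /andP[i2 _]; apply: sub_sigma_algebra; exists i => //.
by exists (B i) => //; rewrite setTI.
Qed.

Lemma prob_rect n m A B : (forall i, measurable (A i)) ->
  P (xrect n A `&` urect m B) = (P (xrect n A) * P (urect m B))%E.
Proof. by move=> mA; apply: xu_indep; [exact: xrect_family|exact: urect_family]. Qed.

Lemma xrectS n A (V : set R) : (1 <= n)%N ->
  xrect n A `&` x n.+1 @^-1` V = xrect n.+1 (fun i => if i == n.+1 then V else A i).
Proof.
move=> n1; rewrite /xrect [in RHS]big_nat_recr //= eqxx; congr (_ `&` _).
by apply: eq_big_nat => i /andP[_ ilt]; rewrite ltn_eqF.
Qed.

Lemma urectS n B (V : set nat) : (1 <= n)%N ->
  urect n B `&` u n.+1 @^-1` V = urect n.+1 (fun i => if i == n.+1 then V else B i).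
Proof.
move=> n1; rewrite /urect [in RHS]big_nat_recr //= eqxx; congr (_ `&` _).
by apply: eq_big_nat => i /andP[_ ilt]; rewrite ltn_eqF.
Qed.

Lemma prob_xrect n A : (forall i, measurable (A i)) ->
  P (xrect n A) = (\prod_(2 <= i < n.+1) P (x i @^-1` A i))%E.
Proof.
move=> mA; apply: x_indep => //; first exact: iota_uniq.
by move=> i; rewrite mem_index_iota => /andP[].
Qed.

Lemma prob_urect n B : P (urect n B) = (\prod_(2 <= i < n.+1) P (u i @^-1` B i))%E.
Proof.
apply: u_indep => //; first exact: iota_uniq.
by move=> i; rewrite mem_index_iota => /andP[].
Qed.

(** By [indep_sigma] only rectangles matter, and intersecting a rectangle with an event on the next
    variable just adds one more side to it. *)
Lemma indep_x n m E V : (1 <= n)%N -> <<s rects n m >> E -> measurable V ->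
  P (E `&` x n.+1 @^-1` V) = (P E * P (x n.+1 @^-1` V))%E.
Proof.
move=> n1 sE mV.
apply: (indep_sigma (@rects_measurable n m) (@rects_setI n m) (@rectsT n m) _ _ sE).
  exact: measurable_xpreim.
move=> _ [A [B [mA ->]]].
have mA' i : measurable (if i == n.+1 then V else A i) by case: ifP.
rewrite setIAC xrectS // !prob_rect // muleAC; congr (_ * _)%E.
rewrite !prob_xrect // big_nat_recr //= eqxx; congr (_ * _)%E.
by apply: eq_big_nat => i /andP[_ ilt]; rewrite ltn_eqF.
Qed.

Lemma indep_u n m E V : (1 <= m)%N -> <<s rects n m >> E ->
  P (E `&` u m.+1 @^-1` V) = (P E * P (u m.+1 @^-1` V))%E.
Proof.
move=> m1 sE.
apply: (indep_sigma (@rects_measurable n m) (@rects_setI n m) (@rectsT n m) _ _ sE).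
  exact: measurable_upreim.
move=> _ [A [B [mA ->]]].
rewrite -setIA urectS // !prob_rect // -muleA; congr (_ * _)%E.
rewrite !prob_urect // big_nat_recr //= eqxx; congr (_ * _)%E.
by apply: eq_big_nat => i /andP[_ ilt]; rewrite ltn_eqF.
Qed.

Lemma xrect_pick k n (V : set R) : (2 <= k <= n)%N ->
  xrect n (fun i => if i == k then V else setT) = x k @^-1` V.
Proof.
move=> kn; rewrite /xrect (bigD1_seq k) /= ?iota_uniq ?mem_index_iota // eqxx.
by rewrite big1 ?setIT // => i /negbTE ->.
Qed.

Lemma urect_pick k n (V : set nat) : (2 <= k <= n)%N ->
  urect n (fun i => if i == k then V else setT) = u k @^-1` V.
Proof.
move=> kn; rewrite /urect (bigD1_seq k) /= ?iota_uniq ?mem_index_iota // eqxx.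
by rewrite big1 ?setIT // => i /negbTE ->.
Qed.

Lemma sigma_fun_x k n m : (2 <= k <= n)%N -> sigma_fun (rects n m) (x k).
Proof.
move=> kn _ V mV; rewrite setTI; apply: sub_sigma_algebra.
exists (fun i => if i == k then V else setT), (fun=> setT); split.
  by move=> i; case: ifP.
by rewrite urectT setIT xrect_pick.
Qed.

Lemma sigma_u k n m V : (2 <= k <= m)%N -> <<s rects n m >> (u k @^-1` V).
Proof.
move=> kn; apply: sub_sigma_algebra.
exists (fun=> setT), (fun i => if i == k then V else setT); split => //.
by rewrite xrectT setTI urect_pick.
Qed.

Lemma sigma_fun_indic (C : set (set T)) E : <<s C >> E -> sigma_fun C (\1_E : T -> R).
Proof. by move=> CE; apply: measurable_indic. Qed.

Lemma rects_sub n n' m m' : (n <= n')%N -> (m <= m')%N ->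
  rects n m `<=` <<s rects n' m' >>.
Proof.
move=> nn' mm' _ [A [B [mA ->]]].
suff : (measurable : set (set (g_sigma_algebraType (rects n' m'))))
         (xrect n A `&` urect m B) by [].
apply: measurableI.
- rewrite /xrect big_nat_cond; elim/big_ind : _ => // [? ? ? ?|i].
    exact: measurableI.
  rewrite andbT ltnS => /andP[i2 i_n].
  have := @sigma_fun_x i n' m' _ measurableT (A i) (mA i); rewrite setTI; apply.
  by rewrite i2 (leq_trans i_n).
- rewrite /urect big_nat_cond; elim/big_ind : _ => // [? ? ? ?|i].
    exact: measurableI.
  rewrite andbT ltnS => /andP[i2 i_n].
  by apply: sigma_u; rewrite i2 (leq_trans i_n).
Qed.

Variable xi : {RV P >-> R}.
Hypothesis x_law : forall n, (2 <= n)%N -> same_law P (x n) xi.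
Hypothesis u_law : forall n, (2 <= n)%N -> uniform_on_lt P n (u n).
Local Notation intg f := (P.-integrable setT (EFin \o f)).
Local Notation Ex f := (\int[P]_w f w)%R.

Lemma intg_law n (g : R -> R) : (2 <= n)%N -> measurable_fun setT g ->
  intg (g \o xi) -> intg (g \o x n) /\ Ex (g \o x n) = Ex (g \o xi).
Proof.
move=> n2 mg ig.
have E (h : R -> \bar R) : (\int[distribution P (x n)]_y h y = \int[distribution P xi]_y h y)%E.
  by apply: eq_measure_integral => A mA _; exact: x_law.
have mgn : measurable_fun setT (g \o x n) by exact: measurableT_comp.
have mge : measurable_fun setT (EFin \o g) by exact/measurable_EFinP.
have ign : intg (g \o x n).
  apply/integrableP; split; first exact/measurable_EFinP.
  have /integrableP[_] := ig.
  have -> : (\int[P]_w `|(EFin \o (g \o xi)) w| = \int[distribution P xi]_y `|(g y)%:E|)%E.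
    by rewrite ge0_integral_distribution //; exact: measurableT_comp.
  rewrite -E ge0_integral_distribution //; exact: measurableT_comp.
split => //; rewrite /Rintegral.
have := @integral_distribution _ _ _ _ _ P (x n) (EFin \o g) mge ign.
have := @integral_distribution _ _ _ _ _ P xi (EFin \o g) mge ig.
by rewrite E /= => -> ->.
Qed.

(** Independence is used twice: [u n.+1] from the past, then [x n.+1] from the past enlarged by
    [u n.+1]. All later expectations over the random tree are sums of instances of this rule. *)
Lemma product_rule n k (H : T -> R) (g : R -> R) : (1 <= k <= n)%N ->
  sigma_fun (rects n n) H -> intg H -> measurable_fun setT g -> intg (g \o xi) ->
  intg (fun w => H w * (u n.+1 w == k)%:R * g (x n.+1 w)) /\
  Ex (fun w => H w * (u n.+1 w == k)%:R * g (x n.+1 w)) =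
    Ex H * Ex (g \o xi) / n%:R.
Proof.
move=> /andP[k1 kn] sH iH mg ig.
have n1 : (1 <= n)%N by exact: leq_trans kn.
have [igx Egx] := @intg_law n.+1 g n1 mg ig.
pose Y : T -> R := \1_(u n.+1 @^-1` [set k]).
have YE w : Y w = (u n.+1 w == k)%:R.
  rewrite /Y indicE; congr (nat_of_bool _)%:R.
  by apply/idP/eqP => [/set_mem//|h]; exact/mem_set.
have mU : measurable (u n.+1 @^-1` [set k]) by exact: measurable_upreim.
have iY : intg Y by exact: integrable_indic.
have EY : Ex Y = n%:R^-1.
  by rewrite Ex_indic // (u_law (n := n.+1)) // ltnS kn andbT.
have HY : indep_rv P H Y.
  apply: (sigma_fun_indep_rv sH) => E B sE mB.
  pose V : set nat := [set j | B (j == k)%:R].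
  have -> : Y @^-1` B = u n.+1 @^-1` V.
    by apply/seteqP; split => w /=; rewrite /V/= YE.
  by apply: (@indep_u n n).
have [iHY EHY] := indep_intgM HY iH iY.
have sHY : sigma_fun (rects n n.+1) (fun w => H w * Y w).
  apply: measurable_funM.
    by apply: sigma_fun_sub sH; exact: rects_sub.
  by apply: sigma_fun_indic; apply: sigma_u; rewrite ltnS n1 leqnn.
have HYg : indep_rv P (fun w => H w * Y w) (g \o x n.+1).
  apply: (sigma_fun_indep_rv sHY) => E B sE mB.
  rewrite comp_preimage; apply: (@indep_x n n.+1) => //.
  by rewrite -[X in measurable X]setTI; exact: mg.
have [iHYg EHYg] := indep_intgM HYg iHY igx.
have FE : (fun w => H w * (u n.+1 w == k)%:R * g (x n.+1 w)) =
          (fun w => H w * Y w * (g \o x n.+1) w).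
  by apply/funext => w; rewrite YE.
by rewrite FE; split => //; rewrite EHYg EHY EY Egx mulrAC.
Qed.

End Filtration.

(** * Upcrossings and running maxima of a single path *)

Section Paths.
Context {R : realType}.
Implicit Types (v : nat -> R) (a b p : R).

(* The strategy buys when the path is at most [a] and sells when it is at least [b];
   [holding] is the position, and [upcross] the number of sales. *)
Fixpoint holding a b v n : bool :=
  if n is k.+1 then (if holding a b v k then v k.+1 < b else v k.+1 <= a)
  else v 0%N <= a.

Fixpoint upcross a b v n : nat :=
  if n is k.+1 then (upcross a b v k + (holding a b v k && (b <= v k.+1)%R))%N
  else 0%N.

(** The second term makes the induction work: an open position was bought at [a] or less, so valuing
    it as if bought at [a] never overstates the gain. Each sale locks in at least [b - a]. *)
Lemma upcross_gain a b v n : a < b ->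
  (b - a) * (upcross a b v n)%:R + (if holding a b v n then v n - a else 0) <=
  \sum_(0 <= k < n) (holding a b v k)%:R * (v k.+1 - v k).
Proof.
move=> ab; elim: n => [|n IH].
  by rewrite big_geq //= mulr0 add0r; case: ifP => // h; rewrite subr_le0.
rewrite big_nat_recr //=; case: (holding a b v n) IH => IH /=.
- have [vb|vb] := ltP (v n.+1) b.
    by rewrite addn0 mul1r; lra.
  by rewrite natrD mulrDr mulr1 mul1r; lra.
- rewrite addn0 mul0r addr0; case: ifP => [va|_]; first lra.
  lra.
Qed.

Lemma upcross_le a b v n k : (n <= k)%N -> (upcross a b v n <= upcross a b v k)%N.
Proof.
move=> /subnKC <-; elim: (k - n)%N => [|j IH]; first by rewrite addn0.
by rewrite addnS /=; apply: (leq_trans IH); exact: leq_addr.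
Qed.

Lemma upcross_sale a b v j k : holding a b v j -> (j < k)%N -> b <= v k ->
  (upcross a b v j < upcross a b v k)%N.
Proof.
move=> hj jk; rewrite -(subnKC jk).
move: (k - j.+1)%N => i {k jk}; elim: i j hj => [|i IH] j hj.
  by rewrite addn0 => bv; rewrite /= hj bv addn1.
move=> bv; have [vb|vb] := ltP (v j.+1) b.
  apply: (leq_ltn_trans (upcross_le a b v (leqnSn j))).
  by rewrite -addSnnS in bv *; apply: IH => //=; rewrite hj.
have : (upcross a b v j < upcross a b v j.+1)%N by rewrite /= hj vb addn1.
by move=> /leq_trans; apply; apply: upcross_le; exact: leq_addr.
Qed.

Lemma upcross_unbounded a b v : a < b ->
  (forall N, exists2 n, (N <= n)%N & v n <= a) ->
  (forall N, exists2 n, (N <= n)%N & b <= v n) ->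
  forall K, exists n, (K <= upcross a b v n)%N.
Proof.
move=> ab lo hi; elim=> [|K [n Kn]]; first by exists 0%N.
have [j nj vj] := lo n; have [k jk vk] := hi j.+1.
exists k; apply: leq_ltn_trans Kn _.
apply: leq_ltn_trans (upcross_le a b v nj) _; apply: upcross_sale => //.
by case: j vj {nj jk} => //= j vj; case: ifP => // _; exact: le_lt_trans ab.
Qed.

(** If the path exceeded its lower limit by [e] infinitely often, it would cross infinitely often
    between two rationals just above that limit. Rational levels leave only countably many
    exceptional events, and nonnegative ones suffice because the lower limit is nonnegative. *)
Lemma cvg_of_upcross v : (forall n, 0 <= v n) ->
  (limn_einf (fun n => (v n)%:E) < +oo)%E ->
  (forall a b : rat, 0 <= a -> a < b -> exists N, forall n, (upcross (ratr a) (ratr b) v n <= N)%N) ->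
  exists l : R, v n @[n --> \oo] --> l.
Proof.
move=> v0 vlt vup.
set u := fun n => (v n)%:E; set l := limn_einf u.
have lE : l = ereal_sup (range (einfs u)).
  rewrite /l limn_einf_lim; apply/cvg_lim => //.
  by apply: ereal_nondecreasing_cvgn; exact: nondecreasing_einfs.
have l0 : (0 <= l)%E.
  rewrite lE; apply: (@le_trans _ _ (einfs u 0%N)); last first.
    by apply: ereal_sup_ubound; exists 0%N.
  by apply: le_ereal_inf_tmp => _ [k _ <-]; rewrite lee_fin.
have lfin : l \is a fin_num by rewrite ge0_fin_numE.
exists (fine l); apply/cvgrPdist_lt => e e0.
have low : exists N, forall n, (N <= n)%N -> fine l - e < v n.
  have : ((fine l - e)%:E < ereal_sup (range (einfs u)))%E.
    by rewrite -lE -[X in (_ < X)%E](fineK lfin) lte_fin ltrBlDr ltrDl.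
  move=> /ereal_sup_gt [_ [N _ <-] hN]; exists N => n Nn.
  rewrite -lte_fin; apply: lt_le_trans hN _.
  by apply: ereal_inf_lbound; exists n.
have often (c : R) : fine l < c -> forall N, exists2 n, (N <= n)%N & v n <= c.
  move=> lc N.
  have : (einfs u N < c%:E)%E.
    apply: (@le_lt_trans _ _ l); last by rewrite -(fineK lfin) lte_fin.
    by rewrite lE; apply: ereal_sup_ubound; exists N.
  by move=> /ereal_inf_lt [_ [n Nn <-]]; rewrite lte_fin => /ltW ?; exists n.
have [a la ae] : exists2 a : rat, fine l < ratr a & ratr a < fine l + e.
  by have [q /andP[]] := @rat_in_itvoo R (fine l) (fine l + e) ltac:(by rewrite ltrDl);
    exists q.
have [b ab be] : exists2 b : rat, ratr a < ratr b :> R & ratr b < fine l + e.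
  by have [q /andP[]] := @rat_in_itvoo R (ratr a) (fine l + e) ae; exists q.
have up : exists N, forall n, (N <= n)%N -> v n < fine l + e.
  apply: contrapT => /forallNP hN.
  have abq : a < b by rewrite -(ltr_rat R).
  have a0 : 0 <= a.
    by rewrite -(ler0q R); apply/ltW/(le_lt_trans _ la); rewrite fine_ge0.
  have [K hK] := vup a b a0 abq.
  have [|n] := @upcross_unbounded (ratr a) (ratr b) v ab (often _ la) _ K.+1.
    move=> N; have /existsNP[n /not_implyP[Nn /negP]] := hN N.
    by rewrite -leNgt => ?; exists n => //; apply: ltW; exact: lt_le_trans be _.
  by move=> h; have := leq_trans h (hK n); rewrite ltnn.
have [N1 h1] := low; have [N2 h2] := up.
near=> n; rewrite ltr_distlC; apply/andP; split.
  by apply: h1; near: n; exact: nbhs_infty_ge.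
by apply: h2; near: n; exact: nbhs_infty_ge.
Unshelve. all: end_near. Qed.

Fixpoint runmax v n : R := if n is k.+1 then Num.max (runmax v k) (v k.+1) else v 0%N.

Lemma runmax_ge v n k : (k <= n)%N -> v k <= runmax v n.
Proof.
elim: n => [|n IH]; first by rewrite leqn0 => /eqP ->.
rewrite leq_eqVlt => /predU1P[->|]; first by rewrite /= le_max lexx orbT.
by rewrite ltnS => /IH; rewrite /= le_max => ->.
Qed.

Lemma runmax_ge0 v n : (forall n, 0 <= v n) -> 0 <= runmax v n.
Proof. by move=> v0; apply: le_trans (v0 0%N) _; exact: runmax_ge. Qed.

Lemma runmax_le v n k : (n <= k)%N -> runmax v n <= runmax v k.
Proof.
move=> /subnKC <-; elim: (k - n)%N => [|j IH]; first by rewrite addn0.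
by rewrite addnS /= le_max IH.
Qed.

Lemma runmax_powR_le v n p : 0 <= p -> (forall n, 0 <= v n) ->
  runmax v n `^ p <= \sum_(0 <= k < n.+1) v k `^ p.
Proof.
move=> p0 v0; elim: n => [|n IH]; first by rewrite big_nat1.
rewrite big_nat_recr //= maxEle; case: ifP => _.
  by rewrite lerDr; apply: sumr_ge0 => k _; exact: powR_ge0.
by apply: (le_trans IH); rewrite lerDl powR_ge0.
Qed.

(* Integrating against a martingale kills the sum, which is Doob's L^p inequality. *)
Lemma doob_pathwise v n p : 1 < p -> (forall n, 0 <= v n) ->
  (p - 1) / p * runmax v n `^ p <= runmax v n `^ (p - 1) * v n -
    \sum_(0 <= k < n) runmax v k `^ (p - 1) * (v k.+1 - v k).
Proof.
move=> p1 v0; have p0 : 0 < p by lra.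
elim: n => [|n IH].
  rewrite big_geq //= subr0.
  have -> : v 0%N `^ (p - 1) * v 0%N = v 0%N `^ p.
    have := v0 0%N; rewrite le_eqVlt => /predU1P[<-|]; last exact: powRD1.
    by rewrite mulr0 powR0 // gt_eqF.
  by rewrite ler_piMl ?powR_ge0 // ler_pdivrMr // mul1r; lra.
rewrite big_nat_recr //=; set r := runmax v n in IH *; set s := v n.+1.
have r0 : 0 <= r by exact: runmax_ge0.
(* Without a new maximum the claim is the induction hypothesis. At a new maximum [s] the two sides
   differ by Young's inequality between [r^(p-1)] and [s]. *)
have [rs|sr] := leP r s; last lra.
have s0 : 0 <= s by exact: v0.
have -> : s `^ (p - 1) * s = s `^ p.
  move: s0; rewrite le_eqVlt => /predU1P[<-|]; last exact: powRD1.
  by rewrite mulr0 powR0 // gt_eqF.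
have := powR_young p1 r0 s0 => h.
have h2 : r `^ (p - 1) * s <= (s `^ p + (p - 1) * r `^ p) / p.
  by rewrite ler_pdivlMr // mulrC.
have E : (s `^ p + (p - 1) * r `^ p) / p = s `^ p - (p - 1) / p * s `^ p + (p - 1) / p * r `^ p.
  by field; rewrite gt_eqF.
rewrite E in h2; rewrite mulrBr; lra.
Qed.

End Paths.

Lemma measurable_natr_bool {R : realType} d (T : measurableType d) (f : T -> bool) :
  measurable_fun setT f -> measurable_fun setT (fun w => (f w)%:R : R).
Proof. by move=> mf _ B mB; exact: (mf measurableT [set c | B c%:R]). Qed.

(** * Nonnegative martingales: almost sure convergence and Doob's inequality *)

Section Martingale.
Context {R : realType} d {T : measurableType d} (P : probability T R).
Local Notation intg f := (P.-integrable setT (EFin \o f)).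
Local Notation Ex f := (\int[P]_w f w)%R.
Variables (F : nat -> set (set T)) (M : nat -> T -> R).
Hypothesis F_meas : forall n, F n `<=` measurable.
Hypothesis M_adapted : forall n k, (k <= n)%N -> sigma_fun (F n) (M k).
Hypothesis M_ge0 : forall n w, 0 <= M n w.
Hypothesis M_intg : intg (M 0%N).
(* The martingale property, tested against [F n]-measurable functions instead of
   stated with conditional expectations. *)
Hypothesis M_step : forall n H, sigma_fun (F n) H -> intg (fun w => H w * M n w) ->
  intg (fun w => H w * M n.+1 w) /\ Ex (fun w => H w * M n.+1 w) = Ex (fun w => H w * M n w).

Lemma martingale_meas n : measurable_fun setT (M n).
Proof. by apply: (sigma_fun_measurable (@F_meas n)); exact: M_adapted. Qed.

Lemma martingale_intg n : intg (M n) /\ Ex (M n) = Ex (M 0%N).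
Proof.
elim: n => // n [i1 e1].
have h := @M_step n (fun=> 1) ltac:(exact: measurable_cst).
have E k : (fun w => 1 * M k w) = M k by apply/funext => w; rewrite mul1r.
by rewrite !E in h; have [i2 e2] := h i1; rewrite e2.
Qed.

Lemma sigma_holding a b k n : (k <= n)%N ->
  measurable_fun (setT : set (g_sigma_algebraType (F n)))
    ((fun w => holding a b (M^~ w) k) : g_sigma_algebraType (F n) -> bool).
Proof.
move=> kn; elim: k kn => [|k IH] kn /=.
  by apply: measurable_fun_ler => //; exact: M_adapted.
have -> : (fun w => if holding a b (M^~ w) k then M k.+1 w < b else M k.+1 w <= a) =
  (fun w => (holding a b (M^~ w) k && (M k.+1 w < b)) ||
            (~~ holding a b (M^~ w) k && (M k.+1 w <= a))).
  by apply/funext => w; case: holding; rewrite ?orbF.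
have mh := IH (ltnW kn).
apply: measurable_or; apply: measurable_and => //.
- by apply: measurable_fun_ltr => //; exact: M_adapted.
- exact: measurable_neg.
- by apply: measurable_fun_ler => //; exact: M_adapted.
Qed.

Lemma holding_mart a b n :
  let H w : R := (holding a b (M^~ w) n)%:R in
  intg (fun w => H w * (M n.+1 w - M n w)) /\ Ex (fun w => H w * (M n.+1 w - M n w)) = 0.
Proof.
move=> H.
have sH : sigma_fun (F n) H by apply: measurable_natr_bool; exact: sigma_holding.
have iH : intg (fun w => H w * M n w).
  apply: (@ge0_intg_le _ _ _ _ _ (M n)); last by have [] := martingale_intg n.
    apply: measurable_funM; last exact: martingale_meas.
    exact: sigma_fun_measurable sH.
  by move=> w; rewrite /H; case: holding; rewrite ?mul1r ?mul0r M_ge0 lexx.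
have [i1 e1] := M_step sH iH.
have E : (fun w => H w * (M n.+1 w - M n w)) = (fun w => H w * M n.+1 w - H w * M n w).
  by apply/funext => w; rewrite mulrBr.
by rewrite E; split; [exact: intgB|rewrite ExB // e1 subrr].
Qed.

Lemma measurable_upcross a b n :
  measurable_fun setT (fun w => (upcross a b (M^~ w) n)%:R : R).
Proof.
elim: n => [|n IH] /=; first exact: measurable_cst.
under eq_fun do rewrite natrD.
apply: measurable_funD => //; apply: measurable_natr_bool; apply: measurable_and.
  have h := @sigma_holding a b n n (leqnn n).
  move=> _ B mB; have := h measurableT B mB.
  by apply: smallest_sub => //; exact: sigma_algebra_measurable.
by apply: measurable_fun_ler => //; exact: martingale_meas.
Qed.

(** Expectation of [upcross_gain]: trading in a martingale gains 0 on average, and [M >= 0] limits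
    the loss of an open position to [a]. *)
Lemma Ex_upcross a b n : 0 <= a < b ->
  (\int[P]_w ((upcross a b (M^~ w) n)%:R)%:E <= (a / (b - a))%:E)%E.
Proof.
move=> /andP[a0 ab]; have ba : 0 < b - a by lra.
pose G w := \sum_(0 <= k < n) (holding a b (M^~ w) k)%:R * (M k.+1 w - M k w).
have hm k := @holding_mart a b k.
have iG : intg G by apply: intg_sum => k; have [] := hm k.
have eG : Ex G = 0.
  by rewrite Ex_sum => [|k]; [apply: big1 => k _; have [] := hm k|have [] := hm k].
have pw w : (upcross a b (M^~ w) n)%:R <= (b - a)^-1 * (G w + a).
  rewrite mulrC ler_pdivlMr // mulrC.
  have := @upcross_gain R a b (M^~ w) n ab; rewrite -/(G w).
  by case: ifP => _; have := M_ge0 n w; lra.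
have iGa : intg (fun w => (b - a)^-1 * (G w + a)).
  by apply: intgZ; apply: intgD => //; exact: intg_cst.
have iU : intg (fun w => (upcross a b (M^~ w) n)%:R).
  by apply: ge0_intg_le iGa; [exact: measurable_upcross|move=> w; rewrite pw ler0n].
rewrite -EFin_Ex // lee_fin.
apply: (le_trans (Ex_le iU iGa pw)).
rewrite ExZ; last by apply: intgD => //; exact: intg_cst.
by rewrite ExD // ?Ex_cst ?eG ?add0r 1?mulrC //; exact: intg_cst.
Qed.

(** The bound of [Ex_upcross] does not depend on [n], so by monotone convergence the total number of
    upcrossings has a finite mean. *)
Lemma ae_upcross_bounded a b : 0 <= a < b ->
  {ae P, forall w, exists N, forall n, (upcross a b (M^~ w) n <= N)%N}.
Proof.
move=> ab; pose U n w : \bar R := ((upcross a b (M^~ w) n)%:R)%:E.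
have mU n : measurable_fun setT (U n) by apply/measurable_EFinP; exact: measurable_upcross.
have U0 n w : setT w -> (0 <= U n w)%E by rewrite lee_fin.
have ndU w : setT w -> {homo U^~ w : n k / (n <= k)%N >-> (n <= k)%E}.
  by move=> _ n k nk; rewrite lee_fin ler_nat upcross_le.
have cU := @cvg_monotone_convergence _ _ _ P _ measurableT _ mU U0 ndU.
have lU : (\int[P]_w limn (U^~ w) <= (a / (b - a))%:E)%E.
  rewrite -(cvg_lim _ cU) //; apply: lime_le; first by apply/cvg_ex; eexists; exact: cU.
  by apply: nearW => n; exact: Ex_upcross.
have cUw w : U^~ w @ \oo --> ereal_sup (range (U^~ w)).
  by apply: ereal_nondecreasing_cvgn => n k; exact: ndU.
have Ulim w : limn (U^~ w) = ereal_sup (range (U^~ w)) by exact/cvg_lim/cUw.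
have mlim : measurable_fun setT (fun w => limn (U^~ w)).
  by apply: (emeasurable_fun_cvg _ _ mU) => w _; rewrite Ulim; exact: cUw.
have lim0 w : (0 <= limn (U^~ w))%E.
  rewrite Ulim; apply: le_trans (U0 0%N w I) _.
  by apply: ereal_sup_ubound; exists 0%N.
have ilim : P.-integrable setT (fun w => limn (U^~ w)).
  apply/integrableP; split => //; apply: le_lt_trans (ltry (a / (b - a))).
  by under eq_integral do rewrite gee0_abs //.
have := integrable_ae measurableT ilim; apply: filterS => w /(_ I).
rewrite Ulim => fU; pose N := Num.truncn (fine (ereal_sup (range (U^~ w)))).
exists N.+1 => n; rewrite -(ler_nat R) -lee_fin.
apply: (@le_trans _ _ (ereal_sup (range (U^~ w)))).
  by apply: ereal_sup_ubound; exists n.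
rewrite -[X in (X <= _)%E](fineK fU) lee_fin ltW //; exact: truncnS_gt.
Qed.

(** Finitely many upcrossings do not exclude divergence to infinity; Fatou's lemma and the constant
    mean do. *)
Lemma ae_liminf_fin : {ae P, forall w, (limn_einf (fun n => (M n w)%:E) < +oo)%E}.
Proof.
have mM n : measurable_fun setT (fun w => (M n w)%:E).
  by apply/measurable_EFinP; exact: martingale_meas.
have M0' n w : setT w -> (0 <= (M n w)%:E)%E by rewrite lee_fin M_ge0.
have fat := fatou P measurableT mM M0'.
have E : (fun n => \int[P]_w (M n w)%:E)%E = (fun=> (Ex (M 0%N))%:E).
  by apply/funext => n; have [i e] := martingale_intg n; rewrite -EFin_Ex // e.
have {}fat : (\int[P]_w limn_einf (fun n => (M n w)%:E) <= (Ex (M 0%N))%:E)%E.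
  apply: (le_trans fat); rewrite E.
  by rewrite is_cvg_limn_einfE; [rewrite lim_cst|exact: is_cvg_cst].
have l0 w : (0 <= limn_einf (fun n => (M n w)%:E))%E.
  rewrite limn_einf_lim; apply: lime_ge; first exact: is_cvg_einfs.
  apply: nearW => n; apply: le_ereal_inf_tmp => _ [k _ <-].
  by rewrite lee_fin.
have ml : measurable_fun setT (fun w => limn_einf (fun n => (M n w)%:E)).
  rewrite /limn_einf; apply: measurableT_comp => //.
  by apply: measurable_fun_limn_esup => n; exact: measurableT_comp.
have il : P.-integrable setT (fun w => limn_einf (fun n => (M n w)%:E)).
  apply/integrableP; split => //; apply: le_lt_trans (ltry (Ex (M 0%N))).
  by under eq_integral do rewrite gee0_abs //.
have := integrable_ae measurableT il; apply: filterS => w /(_ I).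
by rewrite ge0_fin_numE.
Qed.

Theorem martingale_cvg : {ae P, forall w, exists l : R, M n w @[n --> \oo] --> l}.
Proof.
(* Pairs of rational levels are enumerated by [unpickle], so that the almost sure events can be
   intersected over a countable index. *)
pose Q n w := if (unpickle n : option (rat * rat)) is Some (a, b) then
  0 <= a -> a < b -> exists N, forall n, (upcross (ratr a) (ratr b) (M^~ w) n <= N)%N
  else True.
have aeQ : {ae P, forall w, forall n, Q n w}.
  apply/ae_foralln => n; rewrite /Q; case: unpickle => [[a b]|]; last exact/nearW.
  have [a0|a0] := boolP (0 <= a); last by apply/nearW.
  have [ab|ab] := boolP (a < b); last by apply/nearW.
  have := @ae_upcross_bounded (ratr a) (ratr b).
  rewrite ler0q a0 ltr_rat ab => /(_ isT); apply: filterS => w h _ _.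
  exact: h.
apply: filterS2 aeQ ae_liminf_fin => w Qw lw.
apply: cvg_of_upcross => // a b a0 ab.
by have := Qw (pickle (a, b)); rewrite /Q pickleK; apply.
Qed.

Variables (p K : R).
Hypothesis p_gt1 : 1 < p.
Hypothesis Mp_intg : forall n, intg (fun w => M n w `^ p).
Hypothesis Mp_bound : forall n, Ex (fun w => M n w `^ p) <= K.

Let rM n w := runmax (M^~ w) n.

Lemma sigma_runmax n k : (k <= n)%N -> sigma_fun (F n) (rM k).
Proof.
move=> kn; elim: k kn => [|k IH] kn; first exact: M_adapted.
by apply: measurable_maxr; [apply: IH; exact: ltnW|exact: M_adapted].
Qed.

Lemma runmax_meas n : measurable_fun setT (rM n).
Proof. by apply: (sigma_fun_measurable (@F_meas n)); exact: sigma_runmax. Qed.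

Lemma martingale_runmax_ge0 n w : 0 <= rM n w.
Proof. exact: runmax_ge0. Qed.

Lemma runmaxp_intg n : intg (fun w => rM n w `^ p).
Proof.
apply: (@ge0_intg_le _ _ _ _ _ (fun w => \sum_(0 <= k < n.+1) M k w `^ p)).
- exact: (measurableT_comp (measurable_powR p) (runmax_meas n)).
- by move=> w; rewrite powR_ge0 runmax_powR_le //; have := p_gt1; lra.
- exact: intg_sum.
Qed.

Lemma runmaxM_intg n k : intg (fun w => rM n w `^ (p - 1) * M k w).
Proof.
apply: (@ge0_intg_le _ _ _ _ _ (fun w => 1 * rM n w `^ p + 1^-1 `^ (p - 1) * M k w `^ p)).
- apply: measurable_funM; last exact: martingale_meas.
  exact: (measurableT_comp (measurable_powR (p - 1)) (runmax_meas n)).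
- move=> w; rewrite mulr_ge0 ?powR_ge0 //=.
  by apply: powR_young_eps => //; exact: martingale_runmax_ge0.
- by apply: intgD; apply: intgZ => //; exact: runmaxp_intg.
Qed.

(** With [e = (p - 1) / p / 2], this is [e^-1] times the term in [K] that remains after Young's
    inequality with parameter [e]. It is not Doob's sharp constant. *)
Definition doob_cst : R :=
  ((p - 1) / p / 2)^-1 * (((p - 1) / p / 2)^-1 `^ (p - 1) * K).

(** In the expectation of [doob_pathwise] the sum vanishes, leaving the factor [(p - 1) / p = e + e]
    on the left; one [e] absorbs the running maximum produced by Young's inequality. The subtraction
    is legitimate by [runmaxp_intg]. *)
Lemma Ex_runmax_le n : Ex (fun w => rM n w `^ p) <= doob_cst.
Proof.
have p1 := p_gt1; set e := (p - 1) / p / 2; have e0 : 0 < e by rewrite /e !divr_gt0 //; lra.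
pose G w := \sum_(0 <= k < n) rM k w `^ (p - 1) * (M k.+1 w - M k w).
have step k : intg (fun w => rM k w `^ (p - 1) * (M k.+1 w - M k w)) /\
    Ex (fun w => rM k w `^ (p - 1) * (M k.+1 w - M k w)) = 0.
  have sH : sigma_fun (F k) (fun w => rM k w `^ (p - 1)).
    exact: (measurableT_comp (measurable_powR (p - 1)) (sigma_runmax (leqnn k))).
  have [i1 e1] := M_step sH (runmaxM_intg k k).
  have E : (fun w => rM k w `^ (p - 1) * (M k.+1 w - M k w)) =
     (fun w => rM k w `^ (p - 1) * M k.+1 w - rM k w `^ (p - 1) * M k w).
    by apply/funext => w; rewrite mulrBr.
  have i2 := runmaxM_intg k k.
  by rewrite E; split; [exact: intgB|rewrite ExB // e1 subrr].
have iG : intg G by apply: intg_sum => k; have [] := step k.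
have eG : Ex G = 0.
  by rewrite Ex_sum => [|k]; [apply: big1 => k _; have [] := step k|have [] := step k].
have i1 := runmaxp_intg n; have i2 := runmaxM_intg n n.
have h1 : (e + e) * Ex (fun w => rM n w `^ p) <= Ex (fun w => rM n w `^ (p - 1) * M n w).
  rewrite -ExZ //; apply: (@le_trans _ _ (Ex (fun w => rM n w `^ (p - 1) * M n w - G w))).
    apply: Ex_le; [exact: intgZ|exact: intgB|move=> w].
    have := @doob_pathwise R (M^~ w) n p p_gt1 (M_ge0^~ w).
    by rewrite (_ : (p - 1) / p = e + e) //; rewrite /e; lra.
  by rewrite ExB // eG subr0.
have h2 : Ex (fun w => rM n w `^ (p - 1) * M n w) <=
    e * Ex (fun w => rM n w `^ p) + e^-1 `^ (p - 1) * Ex (fun w => M n w `^ p).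
  rewrite -ExZ // -(ExZ (e^-1 `^ (p - 1))) // -ExD; [|exact: intgZ|exact: intgZ].
  apply: Ex_le => //; first by apply: intgD; exact: intgZ.
  by move=> w; apply: powR_young_eps => //; exact: martingale_runmax_ge0.
have h3 : e^-1 `^ (p - 1) * Ex (fun w => M n w `^ p) <= e^-1 `^ (p - 1) * K.
  by apply: ler_wpM2l => //; exact: powR_ge0.
rewrite /doob_cst -/e mulrC ler_pdivlMr // mulrC.
have := le_trans h1 (le_trans h2 (lerD (lexx _) h3)).
by rewrite mulrDl lerD2l.
Qed.

(** The [p]-th power of [sup_n M n], extended-real because it is finite only almost surely. It
    dominates all the limits taken below. *)
Let g w : \bar R := limn (fun n => (rM n w `^ p)%:E).

Lemma runmax_powR_mono n k w : (n <= k)%N -> rM n w `^ p <= rM k w `^ p.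
Proof.
have p1 := p_gt1; move=> nk; apply: ge0_ler_powR; rewrite ?nnegrE ?martingale_runmax_ge0 //; first lra.
exact: runmax_le.
Qed.

Lemma runmax_powR_le_sup n w : ((rM n w `^ p)%:E <= g w)%E.
Proof.
have nd : {homo (fun n => (rM n w `^ p)%:E) : n k / (n <= k)%N >-> (n <= k)%E}.
  by move=> i j ij; rewrite lee_fin runmax_powR_mono.
rewrite /g (cvg_lim _ (ereal_nondecreasing_cvgn nd)) //.
by apply: ereal_sup_ubound; exists n.
Qed.

Lemma sup_powR_intg : P.-integrable setT g.
Proof.
have mr n : measurable_fun setT (fun w => (rM n w `^ p)%:E).
  apply/measurable_EFinP.
  exact: (measurableT_comp (measurable_powR p) (runmax_meas n)).
have r0 n w : setT w -> (0 <= (rM n w `^ p)%:E)%E by rewrite lee_fin powR_ge0.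
have nd w : setT w -> {homo (fun n => (rM n w `^ p)%:E) : n k / (n <= k)%N >-> (n <= k)%E}.
  by move=> _ i j ij; rewrite lee_fin runmax_powR_mono.
have cU := @cvg_monotone_convergence _ _ _ P _ measurableT _ mr r0 nd.
have lU : (\int[P]_w g w <= doob_cst%:E)%E.
  rewrite -(cvg_lim _ cU) //; apply: lime_le; first by apply/cvg_ex; eexists; exact: cU.
  apply: nearW => n; have i := runmaxp_intg n.
  by rewrite -EFin_Ex // lee_fin; exact: Ex_runmax_le.
apply/integrableP; split.
  apply: (emeasurable_fun_cvg _ _ mr) => // w _.
  exact: ereal_nondecreasing_is_cvgn (nd w I).
apply: le_lt_trans (ltry doob_cst); under eq_integral => w _.
  rewrite gee0_abs; last by apply: le_trans (runmax_powR_le_sup 0 w); rewrite lee_fin powR_ge0.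
  over.
exact: lU.
Qed.

Variable L : T -> R.
Hypothesis L_meas : measurable_fun setT L.
Hypothesis M_cvg : {ae P, forall w, M n w @[n --> \oo] --> L w}.

Lemma powR_le_sup n w : ((M n w `^ p)%:E <= g w)%E.
Proof.
apply: le_trans (runmax_powR_le_sup n w); rewrite lee_fin; apply: ge0_ler_powR; rewrite ?nnegrE ?martingale_runmax_ge0 //.
  by have := p_gt1; lra.
exact: runmax_ge.
Qed.

Lemma limit_bounds w : (g w < +oo)%E -> M n w @[n --> \oo] --> L w ->
  0 <= L w /\ (forall n, `|M n w - L w| <= (fine (g w)) `^ p^-1).
Proof.
move=> gw cM.
have g0 : (0 <= g w)%E by apply: le_trans (powR_le_sup 0 w); rewrite lee_fin powR_ge0.
have gfin : g w \is a fin_num by rewrite ge0_fin_numE.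
set G := fine (g w) `^ p^-1.
have p1 := p_gt1; have pi : 0 < p^-1 by rewrite invr_gt0; lra.
have MG n : M n w <= G.
  have h : M n w `^ p <= fine (g w) by rewrite -lee_fin fineK // powR_le_sup.
  have -> : M n w = (M n w `^ p) `^ p^-1.
    by rewrite -powRrM mulfV ?powRr1 // gt_eqF //; lra.
  by apply: ge0_ler_powR; rewrite ?nnegrE ?powR_ge0 ?fine_ge0 // ltW.
have L0 : 0 <= L w.
  by apply: (cvgr_to_ge cM); apply: nearW => n; exact: M_ge0.
have LG : L w <= G by apply: (cvgr_to_le cM); apply: nearW => n; exact: MG.
split => // n; rewrite ler_norml; have := M_ge0 n w; have := MG n; lra.
Qed.

Lemma ae_limit_bounds : {ae P, forall w, [/\ M n w @[n --> \oo] --> L w,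
  g w \is a fin_num, 0 <= L w & forall n, ((`|M n w - L w| `^ p)%:E <= g w)%E]}.
Proof.
have p1 := p_gt1.
apply: filterS2 M_cvg (integrable_ae measurableT sup_powR_intg) => w cM /(_ I) gfin.
have g0 : (0 <= g w)%E by apply: le_trans (powR_le_sup 0 w); rewrite lee_fin powR_ge0.
have [|L0 hb] := limit_bounds _ cM; first by rewrite -ge0_fin_numE.
split => // n; rewrite -(fineK gfin) lee_fin.
have -> : fine (g w) = (fine (g w) `^ p^-1) `^ p.
  by rewrite -powRrM mulVf ?powRr1 ?fine_ge0 // gt_eqF //; lra.
by apply: ge0_ler_powR; rewrite ?nnegrE ?powR_ge0 //; lra.
Qed.

(** Dominated convergence with the bound [c * (1 + g)], since [M <= 1 + M^p]. It carries the
    martingale identity over to the limit. *)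
Lemma limit_bounded_cvg (H : T -> R) (c : R) : measurable_fun setT H ->
  (forall w, `|H w| <= c) -> intg (fun w => H w * L w) /\
  Ex (fun w => H w * M n w) @[n --> \oo] --> Ex (fun w => H w * L w).
Proof.
move=> mH Hc; have p1 := p_gt1.
pose h w : \bar R := (c%:E * (1 + g w))%E.
have ih : P.-integrable setT h.
  apply: integrableZl => //; apply: integrableD => //; last exact: sup_powR_intg.
  exact: intg_cst.
have Mg n w : ((M n w)%:E <= 1 + g w)%E.
  apply: (@le_trans _ _ (1 + (M n w `^ p)%:E)%E); last by rewrite leeD2l // powR_le_sup.
  rewrite -EFinD lee_fin; have [M1|M1] := leP (M n w) 1.
    by rewrite -[X in X <= _]addr0 lerD // powR_ge0.
  by apply: ler_wpDl => //; apply: le1r_powR; exact: ltW.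
have mHM n : measurable_fun setT (fun w => (H w * M n w)%:E).
  by apply/measurable_EFinP/measurable_funM => //; exact: martingale_meas.
have mHL : measurable_fun setT (fun w => (H w * L w)%:E).
  exact/measurable_EFinP/measurable_funM.
have cv : {ae P, forall w, setT w -> (H w * M n w)%:E @[n --> \oo] --> (H w * L w)%:E}.
  apply: filterS M_cvg => w cM _; apply: cvg_EFin; first exact: nearW.
  by apply: cvgM => //; exact: cvg_cst.
have dom : {ae P, forall w n, setT w -> (`|(H w * M n w)%:E| <= h w)%E}.
  apply: nearW => w n _; rewrite /h EFinM abseM lee_pmul //.
  - by rewrite lee_fin.
  - by rewrite gee0_abs // lee_fin.
have [iL _ cI] := dominated_convergence measurableT mHM mHL cv ih dom.
split => //.
have -> : (fun n => Ex (fun w => H w * M n w)) =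
    fine \o (fun n => \int[P]_w (H w * M n w)%:E)%E by [].
by apply: fine_cvg; rewrite EFin_Ex.
Qed.

Lemma limit_powR_intg : intg (fun w => `|L w| `^ p).
Proof.
have p1 := p_gt1.
have mL : measurable_fun setT (fun w => `|L w| `^ p).
  by apply: (measurableT_comp (measurable_powR p)); exact: measurableT_comp.
apply: ge0_intg_lty => //.
have /integrableP[mg] := sup_powR_intg; apply: le_lt_trans.
apply: ae_ge0_le_integral => //.
- exact/measurable_EFinP.
- exact: measurableT_comp.
apply: filterS ae_limit_bounds => w [cM gfin L0 _] _.
have g0 : (0 <= g w)%E by apply: le_trans (powR_le_sup 0 w); rewrite lee_fin powR_ge0.
rewrite gee0_abs // -(fineK gfin) lee_fin (ger0_norm L0).
have -> : fine (g w) = (fine (g w) `^ p^-1) `^ p.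
  by rewrite -powRrM mulVf ?powRr1 ?fine_ge0 // gt_eqF //; lra.
have MG n : M n w <= fine (g w) `^ p^-1.
  have h : M n w `^ p <= fine (g w) by rewrite -lee_fin fineK // powR_le_sup.
  have -> : M n w = (M n w `^ p) `^ p^-1.
    by rewrite -powRrM mulfV ?powRr1 // gt_eqF //; lra.
  apply: ge0_ler_powR; rewrite ?nnegrE ?powR_ge0 ?fine_ge0 // invr_ge0; lra.
apply: ge0_ler_powR; rewrite ?nnegrE ?powR_ge0 //; first lra.
by apply: (cvgr_to_le cM); apply: nearW.
Qed.

Lemma limit_Lp_cvg : (\int[P]_w (`|M n w - L w| `^ p)%:E @[n --> \oo] --> 0)%E.
Proof.
have p1 := p_gt1.
have mf n : measurable_fun setT (fun w => (`|M n w - L w| `^ p)%:E).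
  apply/measurable_EFinP; apply: (measurableT_comp (measurable_powR p)).
  by apply: measurableT_comp => //; apply: measurable_funB => //; exact: martingale_meas.
have cv : {ae P, forall w, setT w -> (`|M n w - L w| `^ p)%:E @[n --> \oo] --> cst 0%E w}.
  apply: filterS M_cvg => w cM _; apply: cvg_EFin; first exact: nearW.
  apply/cvgrPdist_lt => e e0.
  have e1 : 0 < e `^ p^-1 by exact: powR_gt0.
  have /cvgrPdist_lt/(_ _ e1) := cM.
  apply: filterS => n h /=; rewrite sub0r normrN ger0_norm ?powR_ge0 //; rewrite distrC in h.
  have -> : e = (e `^ p^-1) `^ p by rewrite -powRrM mulVf ?powRr1 ?ltW // gt_eqF //; lra.
  by apply: gt0_ltr_powR; rewrite ?nnegrE ?powR_ge0 //; lra.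
have dom : {ae P, forall w n, setT w -> (`|(`|M n w - L w| `^ p)%:E| <= g w)%E}.
  apply: filterS ae_limit_bounds => w [_ _ _ h] n _.
  by rewrite gee0_abs // lee_fin powR_ge0.
have [_ _] := dominated_convergence measurableT mf (measurable_cst _) cv sup_powR_intg dom.
by rewrite integral0.
Qed.

End Martingale.

(** * The echo recursion with a filter applied to each new step *)

Section GeneralizedEcho.
Context {R : realType}.
Implicit Types (f : nat -> R -> R) (x : nat -> R) (u : nat -> nat).

(* The echoing walk with every new step passed through [f]: [f] is the identity
   for the walk itself and a truncation for the critical case. *)
Fixpoint filtered_history f x u n : seq R :=
  match n with
  | 0 => [:: 0]
  | 1 => [:: 0; 1]
  | m.+1 => let s := filtered_history f x u m in
            rcons s (f m.+1 (x m.+1 * nth 0 s (u m.+1)))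
  end.

Definition filtered_step f x u n : R := nth 0 (filtered_history f x u n) n.

Lemma filtered_historySS f x u n : filtered_history f x u n.+2 =
  rcons (filtered_history f x u n.+1)
    (f n.+2 (x n.+2 * nth 0 (filtered_history f x u n.+1) (u n.+2))).
Proof. by []. Qed.

Lemma size_filtered_history f x u n : size (filtered_history f x u n) = n.+1.
Proof. by elim: n => [|[|n] IHn] //; rewrite filtered_historySS size_rcons IHn. Qed.

Lemma nth_filtered_history f x u n k : (k <= n)%N ->
  nth 0 (filtered_history f x u n) k = filtered_step f x u k.
Proof.
elim: n => [|n IHn]; first by rewrite leqn0 => /eqP->.
rewrite leq_eqVlt => /predU1P[->//|kn]; rewrite -(IHn kn).
case: n IHn kn => [|n] _ kn; first by case: k kn.
by rewrite filtered_historySS nth_rcons size_filtered_history kn.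
Qed.

Lemma sum_pick (n j : nat) (G : nat -> R) :
  \sum_(1 <= k < n.+1) (j == k)%:R * G k = if (1 <= j <= n)%N then G j else 0.
Proof.
case: ifPn => [jn|jn].
  rewrite (bigD1_seq j) /= ?iota_uniq ?mem_index_iota // eqxx mul1r big1 ?addr0 // => k.
  by rewrite eq_sym => /negbTE ->; rewrite mul0r.
rewrite big_nat_cond big1 // => k; rewrite andbT => /andP[k1 kn].
case: eqP => [jk|_]; last by rewrite mul0r.
by rewrite jk k1 -ltnS kn in jn.
Qed.

(** A sum over all possible parents is ready for linearity of expectation. A parent out of range
    contributes 0 on both sides: index 0 holds the dummy value, and [nth] defaults to 0 past the
    end. *)
Lemma filtered_stepS f x u n : (0 < n)%N -> filtered_step f x u n.+1 =
  f n.+1 (\sum_(1 <= k < n.+1) (u n.+1 == k)%:R * (x n.+1 * filtered_step f x u k)).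
Proof.
case: n => // n _; rewrite sum_pick.
rewrite /filtered_step filtered_historySS nth_rcons size_filtered_history ltnn eqxx.
congr (f _ _); case: ifPn => [/andP[_ un]|un].
  by rewrite (nth_filtered_history f x u un).
have [u0|u0] := posnP (u n.+2); first by rewrite u0 nth_filtered_history // mulr0.
rewrite nth_default ?mulr0 // size_filtered_history ltnNge.
by move: un; rewrite u0.
Qed.

(** The measurable type is arbitrary, so that the lemma serves both for the sample space and for the
    sigma-algebras of the filtration. *)
Lemma measurable_filtered_step d (T : measurableType d) f (x : nat -> T -> R)
    (u : nat -> T -> nat) k n : (forall i, measurable_fun setT (f i)) ->
  (forall i, (2 <= i <= n)%N -> measurable_fun setT (x i)) ->
  (forall i j, (2 <= i <= n)%N -> measurable_fun setT (fun w => (u i w == j)%:R : R)) ->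
  (k <= n)%N -> measurable_fun setT (fun w => filtered_step f (x^~ w) (u^~ w) k).
Proof.
move=> mf mx mu; elim/ltn_ind : k => k IH kn.
case: k IH kn => [|[|k]] IH kn; [exact: measurable_cst|exact: measurable_cst|].
have -> : (fun w => filtered_step f (x^~ w) (u^~ w) k.+2) = (fun w => f k.+2
    (\sum_(1 <= i < k.+2) (u k.+2 w == i)%:R * (x k.+2 w * filtered_step f (x^~ w) (u^~ w) i))).
  by apply/funext => w; rewrite filtered_stepS.
apply: (measurableT_comp (mf k.+2)).
pose h i w := if (i < k.+2)%N
  then (u k.+2 w == i)%:R * (x k.+2 w * filtered_step f (x^~ w) (u^~ w) i) else 0.
rewrite [X in measurable_fun _ X](_ : _ = (fun w => \sum_(1 <= i < k.+2) h i w)); last first.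
  by apply/funext => w; apply: eq_big_nat => i /andP[_ ik]; rewrite /h ik.
apply: (@measurable_sum _ T R setT _ _ h) => i.
have [ik|/negbTE ik] := boolP (i < k.+2)%N; rewrite /h ik; last exact: measurable_cst.
apply: measurable_funM; first exact: mu.
apply: measurable_funM; first exact: mx.
by apply: IH => //; exact: leq_trans (ltnW ik) kn.
Qed.

Lemma eq_echo_step (x y : nat -> R) u n : (forall k, (2 <= k)%N -> x k = y k) ->
  echo_step x u n = echo_step y u n.
Proof.
move=> xy; rewrite /echo_step; congr nth.
by elim: n => [|[|n] IH] //; rewrite !echo_historySS IH xy.
Qed.

Lemma echo_history_filtered x u n :
  echo_history x u n = filtered_history (fun=> id) x u n.
Proof. by elim: n => [|[|n] IH] //; rewrite echo_historySS IH. Qed.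

Lemma echo_step_filtered x u n : echo_step x u n = filtered_step (fun=> id) x u n.
Proof. by rewrite /echo_step echo_history_filtered. Qed.

End GeneralizedEcho.

(** * The echo model and its martingale *)

Section EchoModel.
Context {R : realType} d {T : measurableType d} (P : probability T R).
Local Notation intg f := (P.-integrable setT (EFin \o f)).
Local Notation Ex f := (\int[P]_w f w)%R.

(** The interface between probability and analysis. Nonnegativity is required at every point, not
    just almost surely; this is arranged at the end by passing to positive parts. *)
Record echo_model (xi : T -> R) (x : nat -> T -> R) (u : nat -> T -> nat)
    (F : nat -> set (set T)) : Prop := EchoModel {
  em_F_meas : forall n, F n `<=` measurable ;
  em_F_mono : forall n k, (n <= k)%N -> F n `<=` <<s F k >> ;
  em_xi_meas : measurable_fun setT xi ;
  em_xi_ge0 : forall w, 0 <= xi w ;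
  em_x_ge0 : forall n w, 0 <= x n w ;
  em_x_F : forall k n, (2 <= k <= n)%N -> sigma_fun (F n) (x k) ;
  em_u_F : forall k n j, (2 <= k <= n)%N -> sigma_fun (F n) (fun w => (u k w == j)%:R : R) ;
  em_rule : forall n k (H : T -> R) (g : R -> R), (1 <= k <= n)%N ->
    sigma_fun (F n) H -> intg H -> measurable_fun setT g -> intg (g \o xi) ->
    intg (fun w => H w * (u n.+1 w == k)%:R * g (x n.+1 w)) /\
    Ex (fun w => H w * (u n.+1 w == k)%:R * g (x n.+1 w)) =
      Ex H * Ex (g \o xi) / n%:R }.

Variables (xi : T -> R) (x : nat -> T -> R) (u : nat -> T -> nat) (F : nat -> set (set T)).
Hypothesis EM : echo_model xi x u F.
Hypothesis xi_intg : intg xi.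
Hypothesis xi_mean_gt0 : 0 < Ex xi.

Local Notation m := (Ex xi).

Lemma sigma_fun_le n k (H : T -> R) : (n <= k)%N -> sigma_fun (F n) H -> sigma_fun (F k) H.
Proof. by move=> nk; apply: sigma_fun_sub; exact: (em_F_mono EM). Qed.

Definition fstep f n w := filtered_step f (x^~ w) (u^~ w) n.

(* [G] at the parent [u n.+1] of the vertex [n.+1], and 0 if that is out of range. *)
Definition parent (G : nat -> T -> R) n w : R :=
  \sum_(1 <= k < n.+1) (u n.+1 w == k)%:R * G k w.

Lemma sigma_fstep f k n : (forall i, measurable_fun setT (f i)) -> (k <= n)%N ->
  sigma_fun (F n) (fstep f k).
Proof.
move=> mf kn; apply: (@measurable_filtered_step _ _ (g_sigma_algebraType (F n)) f x u k n) => //.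
- by move=> i ik; exact: (em_x_F EM).
- by move=> i l ik; exact: (em_u_F EM).
Qed.

Lemma fstep_meas f k : (forall i, measurable_fun setT (f i)) -> measurable_fun setT (fstep f k).
Proof.
by move=> mf; apply: (sigma_fun_measurable (em_F_meas EM (n:=k))); exact: sigma_fstep.
Qed.

Lemma fstep0 f w : fstep f 0 w = 0. Proof. by []. Qed.
Lemma fstep1 f w : fstep f 1 w = 1. Proof. by []. Qed.

Lemma fstepS f n w : (0 < n)%N ->
  fstep f n.+1 w = f n.+1 (parent (fun k w => x n.+1 w * fstep f k w) n w).
Proof. by move=> n0; rewrite /fstep filtered_stepS. Qed.

Lemma parentE G n w : parent G n w = if (1 <= u n.+1 w <= n)%N then G (u n.+1 w) w else 0.
Proof. by rewrite /parent (sum_pick n (u n.+1 w) (G^~ w)). Qed.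

Lemma parent_comp (h : R -> R) G n w : h 0 = 0 ->
  h (parent G n w) = parent (fun k w => h (G k w)) n w.
Proof. by move=> h0; rewrite !parentE; case: ifP. Qed.

Lemma fstep_ge0 f n w : (forall i y, 0 <= y -> 0 <= f i y) -> 0 <= fstep f n w.
Proof.
move=> f0; elim/ltn_ind : n => n IH; case: n IH => [|[|n]] IH //.
rewrite fstepS // f0 // parentE; case: ifP => // /andP[_ un].
by rewrite mulr_ge0 ?(em_x_ge0 EM) ?IH.
Qed.

(** The product rule summed over the parents: each has probability [1 / n], hence the average of the
    [Ex (G k)]. *)
Lemma Ex_parent n (G : nat -> T -> R) (g : R -> R) : (0 < n)%N ->
  (forall k, (1 <= k <= n)%N -> sigma_fun (F n) (G k)) ->
  (forall k, (1 <= k <= n)%N -> intg (G k)) ->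
  measurable_fun setT g -> intg (g \o xi) ->
  intg (parent (fun k w => g (x n.+1 w) * G k w) n) /\
  Ex (parent (fun k w => g (x n.+1 w) * G k w) n) =
    Ex (g \o xi) / n%:R * \sum_(1 <= k < n.+1) Ex (G k).
Proof.
move=> n0 sG iG mg ig.
have E : parent (fun k w => g (x n.+1 w) * G k w) n =
   (fun w => \sum_(1 <= k < n.+1) G k w * (u n.+1 w == k)%:R * g (x n.+1 w)).
  by apply/funext => w; apply: eq_bigr => k _; ring.
have rule k : (1 <= k < n.+1)%N ->
    intg (fun w => G k w * (u n.+1 w == k)%:R * g (x n.+1 w)) /\
    Ex (fun w => G k w * (u n.+1 w == k)%:R * g (x n.+1 w)) =
      Ex (G k) * Ex (g \o xi) / n%:R.
  by rewrite ltnS => kn; apply: (em_rule EM) => //; [exact: sG|exact: iG].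
rewrite E; split; first by apply: intg_sum_nat => k /rule[].
rewrite Ex_sum_nat; last by move=> k /rule[].
rewrite mulr_sumr; apply: eq_big_nat => k /rule[_ ->]; ring.
Qed.

Definition echoX := fstep (fun=> id).
Definition echoS n w : R := \sum_(1 <= k < n.+1) echoX k w.

Lemma echoX_meas k : measurable_fun setT (echoX k).
Proof. by apply: fstep_meas => i; exact: measurable_id. Qed.

Lemma sigma_echoX k n : (k <= n)%N -> sigma_fun (F n) (echoX k).
Proof. by apply: sigma_fstep => i; exact: measurable_id. Qed.

Lemma echoX_ge0 n w : 0 <= echoX n w.
Proof. exact: fstep_ge0. Qed.

Lemma echoXS n w : (0 < n)%N -> echoX n.+1 w = parent (fun k w => x n.+1 w * echoX k w) n w.
Proof. by move=> n0; rewrite /echoX fstepS. Qed.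

Lemma echoSS n w : echoS n.+1 w = echoS n w + echoX n.+1 w.
Proof. by rewrite /echoS big_nat_recr. Qed.

Lemma echoS1 w : echoS 1 w = 1.
Proof. by rewrite /echoS big_nat1. Qed.

Lemma echoS_ge0 n w : 0 <= echoS n w.
Proof. by rewrite /echoS; apply: sumr_ge0 => k _; exact: echoX_ge0. Qed.

Lemma echoS_ge1 n w : (0 < n)%N -> 1 <= echoS n w.
Proof.
case: n => // n _; elim: n => [|n IH]; first by rewrite echoS1.
by rewrite echoSS; apply: ler_wpDr => //; exact: echoX_ge0.
Qed.

Lemma echoX_le_echoS k n w : (1 <= k <= n)%N -> echoX k w <= echoS n w.
Proof.
move=> kn; rewrite /echoS (bigD1_seq k) /= ?iota_uniq ?mem_index_iota //.
by rewrite lerDl sumr_ge0 // => i _; exact: echoX_ge0.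
Qed.

Lemma sigma_echoS k n : (k <= n)%N -> sigma_fun (F n) (echoS k).
Proof.
move=> kn; elim: k kn => [|k IH] kn.
  rewrite (_ : echoS 0 = fun=> 0); first exact: measurable_cst.
  by apply/funext => w; rewrite /echoS big_geq.
rewrite (_ : echoS k.+1 = fun w => echoS k w + echoX k.+1 w); last by apply/funext => w; rewrite echoSS.
by apply: measurable_funD; [apply: IH; exact: ltnW|exact: sigma_echoX].
Qed.

Lemma echoS_meas k : measurable_fun setT (echoS k).
Proof.
by apply: (sigma_fun_measurable (em_F_meas EM (n:=k))); exact: sigma_echoS.
Qed.

(** This is [E(X_{n+1} | F_n) = (m / n) S_n] tested against [H], obtained from [Ex_parent] with
    [G k] equal to [H] times the step [k]. Each such product is integrable because a step is at most
    the sum. *)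
Lemma Ex_echoXS n (H : T -> R) : (0 < n)%N -> sigma_fun (F n) H ->
  intg (fun w => H w * echoS n w) ->
  intg (fun w => H w * echoX n.+1 w) /\
  Ex (fun w => H w * echoX n.+1 w) = m / n%:R * Ex (fun w => H w * echoS n w).
Proof.
move=> n0 sH iHS.
have mH : measurable_fun setT H by exact: (sigma_fun_measurable (em_F_meas EM (n:=n))).
have sHX k : (1 <= k <= n)%N -> sigma_fun (F n) (fun w => H w * echoX k w).
  by move=> /andP[_ kn]; apply: measurable_funM => //; exact: sigma_echoX.
have iHX k : (1 <= k <= n)%N -> intg (fun w => H w * echoX k w).
  move=> kn; apply: (@intg_le _ _ _ _ _ (fun w => `|H w * echoS n w|)).
  - by apply: measurable_funM => //; exact: echoX_meas.
  - move=> w; rewrite !normrM ler_wpM2l // !ger0_norm ?echoX_ge0 ?echoS_ge0 //.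
    exact: echoX_le_echoS.
  - exact: integrable_norm.
have [i e] := @Ex_parent n (fun k w => H w * echoX k w) id n0 sHX iHX (@measurable_id _ _ _) xi_intg.
have E : parent (fun k w => id (x n.+1 w) * (H w * echoX k w)) n = (fun w => H w * echoX n.+1 w).
  apply/funext => w; rewrite echoXS // !parentE; case: ifP => _; first by rewrite mulrCA.
  by rewrite mulr0.
rewrite E in i e; split => //; rewrite e; congr (_ * _).
rewrite -Ex_sum_nat //; apply: eq_Rintegral => w _.
by rewrite /echoS mulr_sumr.
Qed.

Local Notation a := (echo_norm m).

(** Shifted by one, so that the martingale starts at index 0 with value 1; it is therefore adapted
    to [F n.+1]. *)
Definition echoM n w : R := echoS n.+1 w / a n.+1.

Lemma echo_norm_mean_gt0 n : 0 < a n.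
Proof. by apply: echo_norm_gt0; exact: ltW. Qed.

Lemma echoM_ge0 n w : 0 <= echoM n w.
Proof. by rewrite divr_ge0 ?echoS_ge0 // ltW // echo_norm_mean_gt0. Qed.

Lemma echoM0 w : echoM 0 w = 1.
Proof. by rewrite /echoM echoS1 echo_norm1 divr1. Qed.

Lemma echoM_adapted n k : (k <= n)%N -> sigma_fun (F n.+1) (echoM k).
Proof. by move=> kn; apply: measurable_funM => //; exact: sigma_echoS. Qed.

Lemma echoM0_intg : intg (echoM 0).
Proof. by rewrite (_ : echoM 0 = fun=> 1); [exact: intg_cst|apply/funext => w; exact: echoM0]. Qed.

Lemma echoM_step n H : sigma_fun (F n.+1) H -> intg (fun w => H w * echoM n w) ->
  intg (fun w => H w * echoM n.+1 w) /\ Ex (fun w => H w * echoM n.+1 w) = Ex (fun w => H w * echoM n w).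
Proof.
move=> sH iHM.
have an := echo_norm_mean_gt0 n.+1; have an' := echo_norm_mean_gt0 n.+2.
have iHS : intg (fun w => H w * echoS n.+1 w).
  rewrite (_ : (fun w => H w * echoS n.+1 w) = (fun w => a n.+1 * (H w * echoM n w))).
    exact: intgZ.
  by apply/funext => w; rewrite /echoM; field; rewrite gt_eqF.
have [iX eX] := Ex_echoXS (ltn0Sn n) sH iHS.
have E : (fun w => H w * echoM n.+1 w) =
    (fun w => (a n.+2)^-1 * (H w * echoS n.+1 w + H w * echoX n.+2 w)).
  by apply/funext => w; rewrite /echoM echoSS; field; rewrite gt_eqF.
have E' : (fun w => H w * echoM n w) = (fun w => (a n.+1)^-1 * (H w * echoS n.+1 w)).
  by apply/funext => w; rewrite /echoM; ring.
rewrite E; split; first by apply: intgZ; exact: intgD.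
rewrite E' !ExZ ?ExD //; last exact: intgD.
rewrite eX echo_normS //.
have k0 : 0 < 1 + m / n.+1%:R by rewrite addr_gt0 // divr_gt0.
move: (Ex (fun w => H w * echoS n.+1 w)) => A.
move: (m / n.+1%:R) k0 => q k0; move: (a n.+1) an => b an.
by field; rewrite !gt_eqF.
Qed.

Lemma echoM_meas n : measurable_fun setT (echoM n).
Proof. by apply: measurable_funM => //; exact: echoS_meas. Qed.

Lemma echoM_cvg_ae : {ae P, forall w, exists l : R, echoM n w @[n --> \oo] --> l}.
Proof.
apply: (@martingale_cvg _ _ _ P (fun n => F n.+1)) => //.
- by move=> n; exact: (em_F_meas EM).
- by move=> n k kn; exact: echoM_adapted.
- exact: echoM_ge0.
- exact: echoM0_intg.
- exact: echoM_step.
Qed.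

End EchoModel.

(** * Growth of sequences given by recursive inequalities *)

Section Gronwall.
Context {R : realType}.

(** [y + 1] grows at most by the factor [1 + K * n^(-1-e)]. By [powRN_telescope] these factors stay
    below the increments of the explicit exponential in the strengthened claim. *)
Lemma gronwall_bound (y : nat -> R) (K e : R) : 0 <= K -> 0 < e ->
  (forall n, (0 < n)%N -> 0 <= y n) ->
  (forall n, (0 < n)%N ->
     y n.+1 <= y n * (1 + K * n%:R `^ (- 1 - e)) + K * n%:R `^ (- 1 - e)) ->
  exists B, forall n, (0 < n)%N -> y n <= B.
Proof.
move=> K0 e0 y0 yS; pose c : R := K * (2 `^ (1 + e) / e).
have c0 : 0 <= c by rewrite mulr_ge0 // divr_ge0 ?powR_ge0 // ltW.
exists ((y 1%N + 1) * expR c) => n n0.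
have y1 : 0 <= y 1%N + 1 by rewrite addr_ge0 // y0.
suff h : y n + 1 <= (y 1%N + 1) * expR (c * (1 - n%:R `^ (- e))).
  apply: (@le_trans _ _ (y n + 1)); first by rewrite lerDl.
  apply: (le_trans h); apply: ler_wpM2l => //; rewrite ler_expR ler_piMr //.
elim: n n0 => // n IH _; have [->|n0] := posnP n.
  by rewrite powR1 subrr mulr0 expR0 mulr1.
have {}IH := IH n0.
set q := K * n%:R `^ (- 1 - e); have q0 : 0 <= q by rewrite mulr_ge0 ?powR_ge0.
have h1 : y n.+1 + 1 <= (y n + 1) * (1 + q).
  by apply: (@le_trans _ _ (y n * (1 + q) + q + 1)); [rewrite lerD2r yS|lra].
have qc : q <= c * (n%:R `^ (- e) - n.+1%:R `^ (- e)).
  by rewrite /c -mulrA ler_wpM2l // powRN_telescope.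
apply: (le_trans h1).
have -> : c * (1 - n.+1%:R `^ (- e)) = c * (1 - n%:R `^ (- e)) +
    c * (n%:R `^ (- e) - n.+1%:R `^ (- e)) by ring.
rewrite expRD mulrA; apply: ler_pM => //.
- by rewrite addr_ge0 // y0.
- by rewrite addr_ge0.
- by apply: le_trans (expR_ge1Dx _); rewrite lerD2l.
Qed.

Lemma echo_norm_upper (c : R) : 0 <= c ->
  exists2 C, 0 < C & forall n, (0 < n)%N -> echo_norm c n <= C * n%:R `^ c.
Proof.
move=> c0; have := cvg_seq_bounded (cvgP _ (cvg_echo_norm c0)).
move=> [C [_ hC]].
have D0 : 0 <= Num.max C 0 by rewrite le_max lexx orbT.
have CD : C < Num.max C 0 + 1.
  by apply: (@le_lt_trans _ _ (Num.max C 0)); rewrite ?le_max ?lexx ?ltrDl.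
exists (Num.max C 0 + 1); first by rewrite ltr_wpDl.
move=> n n0; have N0 : 0 < n%:R `^ c :> R by apply: powR_gt0; rewrite ltr0n.
rewrite -ler_pdivrMr //; apply: le_trans (hC _ CD n I); exact: ler_norm.
Qed.

Lemma echo_norm_lower (c : R) : 0 <= c ->
  exists2 C, 0 < C & forall n, (0 < n)%N -> n%:R `^ c <= C * echo_norm c n.
Proof.
move=> c0; have G0 := Gamma_gt0 c0.
have h : (echo_norm c n / n%:R `^ c)^-1 @[n --> \oo] --> ((Gamma (1 + c))^-1)^-1.
  by apply: cvgV; [rewrite invr_neq0 // gt_eqF|exact: cvg_echo_norm].
have := cvg_seq_bounded (cvgP _ h).
move=> [C [_ hC]].
have D0 : 0 <= Num.max C 0 by rewrite le_max lexx orbT.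
have CD : C < Num.max C 0 + 1.
  by apply: (@le_lt_trans _ _ (Num.max C 0)); rewrite ?le_max ?lexx ?ltrDl.
exists (Num.max C 0 + 1); first by rewrite ltr_wpDl.
move=> n n0; have A0 : 0 < echo_norm c n by exact: echo_norm_gt0.
rewrite -ler_pdivrMr // -invf_div; apply: le_trans (hC _ CD n I); exact: ler_norm.
Qed.

Lemma powRD_le (g a b : R) : 0 <= g -> 0 <= a -> 0 <= b ->
  (a + b) `^ g <= 2 `^ g * (a `^ g + b `^ g).
Proof.
move=> g0 a0 b0; wlog ab : a b a0 b0 / a <= b.
  by move=> h; have [/h|/ltW/h] := leP a b; [exact|rewrite (addrC b) (addrC (b `^ g)); exact].
apply: (@le_trans _ _ ((2 * b) `^ g)).
  by apply: ge0_ler_powR; rewrite ?nnegrE ?addr_ge0 ?mulr_ge0 //; lra.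
by rewrite powRM // ler_wpM2l ?powR_ge0 // lerDr powR_ge0.
Qed.

(** [E n] stands for the moment of order [g] of the sum. After division by [a n^g] the main growth
    cancels and only summable errors remain. *)
Lemma moment_recursion_bound (g m mg C : R) (E : nat -> R) :
  1 < g -> 0 < m -> 0 <= mg -> mg < g * m -> 0 < C ->
  (forall n, (0 < n)%N -> 0 <= E n) ->
  (forall n eta, (0 < n)%N -> 0 < eta <= 1 ->
    E n.+1 <= E n * (1 + (g + C * eta) * (m / n%:R))
      + C * eta `^ (- g) * (mg / n%:R * echo_norm mg n)) ->
  exists B, forall n, (0 < n)%N -> E n / echo_norm m n `^ g <= B.
Proof.
move=> g1 hm mg0 hlt C0 E0 step; set a := echo_norm m.
have an0 n : 0 < a n by apply: echo_norm_gt0; exact: ltW.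
have [C1 C10 up] := echo_norm_upper mg0.
have [C2 C20 lo] := echo_norm_lower (ltW hm).
(* With [eta = n^(-e)] the first-order error is of order [n^(-1-e)]. The remainder is
   [n^(e g + mg - 1)] against [a n^g], of order [n^(g m)]; it has the same order exactly when
   [e (g + 1) = g m - mg]. *)
pose e := (g * m - mg) / (g + 1).
have e0 : 0 < e by rewrite divr_gt0; lra.
have eE : e * (g + 1) = g * m - mg by rewrite /e divfK // gt_eqF; lra.
clearbody e.
pose y n := E n / a n `^ g.
pose K := C * m + C * mg * C1 * C2 `^ g.
have K0 : 0 <= K.
  by rewrite addr_ge0 // !mulr_ge0 ?powR_ge0 // ltW.
have ypos n : (0 < n)%N -> 0 <= y n.
  by move=> n0; rewrite divr_ge0 ?powR_ge0 // E0.
have ystep n : (0 < n)%N ->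
    y n.+1 <= y n * (1 + K * n%:R `^ (- 1 - e)) + K * n%:R `^ (- 1 - e).
  move=> n0; have N0 : 0 < n%:R :> R by rewrite ltr0n.
  have eta01 : 0 < (n%:R `^ (- e) : R) <= 1.
    rewrite powR_gt0 //= powRN invf_le1 ?powR_gt0 //.
    by have := @ler_powR _ n%:R ltac:(by rewrite ler1n) 0 e (ltW e0); rewrite powRr0.
  have := step n _ n0 eta01; have [eta0 eta1] := andP eta01.
  move: eta0 eta1; set eta := n%:R `^ (- e) => eta0 eta1 h.
  have an := an0 n; have an1 := an0 n.+1.
  have P0 : 0 < a n `^ g by exact: powR_gt0.
  have P1 : 0 < a n.+1 `^ g by exact: powR_gt0.
  have k0 : 0 < 1 + m / n%:R by rewrite addr_gt0 // divr_gt0.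
  have aS : a n.+1 `^ g = a n `^ g * (1 + m / n%:R) `^ g.
    by rewrite /a echo_normS // powRM // ltW // -/(a n).
  (* The main factor [1 + g * m / n] is at most the growth factor [(1 + m / n)^g] of [a n^g], so
     normalization removes it. *)
  have bern := @powR_bernoulli R g (m / n%:R) g1 ltac:(by rewrite divr_ge0 // ltW).
  have q0 : 0 <= m / n%:R by rewrite divr_ge0 // ltW.
  have En : n%:R `^ (- 1 - e) = eta / n%:R :> R.
    by rewrite gt0_powRD // powR_inv1 ?(ltW N0) // mulrC.
  rewrite En.
  have y0 := E0 n n0.
  rewrite /y ler_pdivrMr //.
  apply: (le_trans h).
  rewrite [X in _ <= X]mulrDl; apply: lerD.
  + rewrite aS; set L := 1 + (g + C * eta) * _.
    have hL : L <= (1 + K * (eta / n%:R)) * (1 + m / n%:R) `^ g.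
      have h1 : L <= (1 + C * m * (eta / n%:R)) * (1 + g * (m / n%:R)).
        rewrite /L; have := mulr_ge0 (mulr_ge0 (ltW C0) (ltW eta0)) q0.
        have : 0 <= C * m * (eta / n%:R) * (g * (m / n%:R)).
          by rewrite !mulr_ge0 ?invr_ge0 // ?ltW //; lra.
        have -> : C * m * (eta / n%:R) = C * eta * (m / n%:R) by ring.
        lra.
      apply: (le_trans h1); apply: ler_pM => //.
      * by rewrite addr_ge0 // !mulr_ge0 ?invr_ge0 // ltW.
      * by rewrite addr_ge0 // mulr_ge0 //; lra.
      * rewrite lerD2l; apply: ler_wpM2r; first by rewrite divr_ge0 // ltW.
        by rewrite /K lerDl !mulr_ge0 ?powR_ge0 // ltW.
    have := ler_wpM2l y0 hL.
    have -> : E n / a n `^ g * (1 + K * (eta / n%:R)) * (a n `^ g * (1 + m / n%:R) `^ g) =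
      E n * ((1 + K * (eta / n%:R)) * (1 + m / n%:R) `^ g).
      by move: (1 + K * (eta / n%:R)) ((1 + m / n%:R) `^ g) => t r; field; rewrite gt_eqF.
    by [].
  + have h2 : n%:R `^ (m * g) <= C2 `^ g * a n.+1 `^ g.
      rewrite powRrM -(powRM _ (ltW C20) (ltW an1)).
      apply: ge0_ler_powR; rewrite ?nnegrE ?powR_ge0 //.
      * lra.
      * by rewrite mulr_ge0 // ltW.
      * apply: (le_trans (lo n n0)); apply: ler_wpM2l; first exact: ltW.
        by apply: echo_norm_le => //; exact: ltW.
    have h3 := up n n0.
    have h4 : eta `^ (- g) * n%:R `^ mg = eta * n%:R `^ (m * g).
      rewrite /eta -powRrM -!gt0_powRD //; congr (_ `^ _).
      by have := eE; lra.
    have h5 : C * eta `^ (- g) * (mg / n%:R * echo_norm mg n) <=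
       C * mg * C1 / n%:R * (eta `^ (- g) * n%:R `^ mg).
      have -> : C * mg * C1 / n%:R * (eta `^ (- g) * n%:R `^ mg) =
        C * eta `^ (- g) * (mg / n%:R * (C1 * n%:R `^ mg)) by ring.
      apply: ler_wpM2l; first by rewrite mulr_ge0 ?powR_ge0 // ltW.
      by apply: ler_wpM2l => //; rewrite divr_ge0 // ltW.
    apply: (le_trans h5); rewrite h4.
    have h6 : C * mg * C1 / n%:R * (eta * n%:R `^ (m * g)) <=
        C * mg * C1 / n%:R * (eta * (C2 `^ g * a n.+1 `^ g)).
      apply: ler_wpM2l; first by rewrite !mulr_ge0 ?invr_ge0 // ltW.
      by apply: ler_wpM2l => //; exact: ltW.
    apply: (le_trans h6).
    have -> : C * mg * C1 / n%:R * (eta * (C2 `^ g * a n.+1 `^ g)) =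
        C * mg * C1 * C2 `^ g * (eta / n%:R) * a n.+1 `^ g by ring.
    apply: ler_wpM2r; first exact: ltW.
    apply: ler_wpM2r; first by rewrite divr_ge0 // ltW.
    by rewrite /K lerDr mulr_ge0 // ltW.
by have [B hB] := gronwall_bound K0 e0 ypos ystep; exists B.
Qed.

End Gronwall.

(** * Boundedness of the martingale in [L^g] *)

Section Moments.
Context {R : realType} d {T : measurableType d} (P : probability T R).
Local Notation intg f := (P.-integrable setT (EFin \o f)).
Local Notation Ex f := (\int[P]_w f w)%R.
Variables (xi : T -> R) (x : nat -> T -> R) (u : nat -> T -> nat) (F : nat -> set (set T)).
Hypothesis EM : echo_model P xi x u F.
Hypothesis xi_intg : intg xi.
Hypothesis xi_mean_gt0 : 0 < Ex xi.
Local Notation m := (Ex xi).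
Local Notation a := (echo_norm m).
Local Notation X := (echoX x u).
Local Notation S := (echoS x u).
Local Notation M := (echoM P xi x u).

Variable g : R.
Hypothesis g_gt1 : 1 < g.
Hypothesis xig_intg : intg (fun w => xi w `^ g).
Local Notation mg := (Ex (fun w => xi w `^ g)).

Lemma moment_ge0 : 0 <= mg.
Proof. by apply: Ex_ge0 => w; exact: powR_ge0. Qed.

Lemma measurable_powRc d' (T' : measurableType d') (f : T' -> R) (c : R) :
  measurable_fun setT f -> measurable_fun setT (fun w => f w `^ c).
Proof. by move=> mf; exact: (measurableT_comp (measurable_powR c) mf). Qed.

(** Powers commute with products, so the [g]-th powers of the steps form an echo sequence on the
    same tree with echo law [xi^g]. This is why their total mean is [echo_norm mg n]. *)
Lemma echoX_powR_step n : (0 < n)%N -> (forall k, (1 <= k <= n)%N -> intg (fun w => X k w `^ g)) ->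
  intg (fun w => X n.+1 w `^ g) /\
  Ex (fun w => X n.+1 w `^ g) = mg / n%:R * \sum_(1 <= k < n.+1) Ex (fun w => X k w `^ g).
Proof.
move=> n0 iX; have g1 := g_gt1.
have sX k : (1 <= k <= n)%N -> sigma_fun (F n) (fun w => X k w `^ g).
  by move=> /andP[_ kn]; apply: measurable_powRc; exact: (sigma_echoX EM).
have [i e] := @Ex_parent _ _ _ P xi x u F EM n (fun k w => X k w `^ g) (fun y => y `^ g)
  n0 sX iX (measurable_powR g) xig_intg.
have E : parent u (fun k w => x n.+1 w `^ g * X k w `^ g) n = (fun w => X n.+1 w `^ g).
  apply/funext => w; rewrite echoXS // (@parent_comp _ _ _ _ (fun y => y `^ g)).
    rewrite !parentE; case: ifP => // _.
    by rewrite powRM // ?(em_x_ge0 EM) // (echoX_ge0 EM).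
  by rewrite powR0 // gt_eqF; lra.
by rewrite E in i e.
Qed.

Lemma echoX_powR_intg k : intg (fun w => X k w `^ g).
Proof.
have g1 := g_gt1; elim/ltn_ind : k => k IH.
case: k IH => [|[|k]] IH.
- rewrite (_ : (fun w => _) = fun=> 0); first exact: intg_cst.
  by apply/funext => w; rewrite /echoX fstep0 powR0 // gt_eqF; lra.
- rewrite (_ : (fun w => _) = fun=> 1); first exact: intg_cst.
  by apply/funext => w; rewrite /echoX fstep1 powR1.
- by have [] := @echoX_powR_step k.+1 isT (fun j jk => IH j ltac:(by case/andP : jk; rewrite ltnS)).
Qed.

Lemma sum_Ex_echoX_powR n : (0 < n)%N ->
  \sum_(1 <= k < n.+1) Ex (fun w => X k w `^ g) = echo_norm mg n.
Proof.
elim: n => // n IH _; have [->|n0] := posnP n.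
  rewrite big_nat1 echo_norm1 (_ : (fun w => _) = fun=> 1) ?Ex_cst //.
  by apply/funext => w; rewrite /echoX fstep1 powR1.
have [_ e] := echoX_powR_step n0 (fun k _ => echoX_powR_intg k).
by rewrite big_nat_recr //= IH // e IH // echo_normS //; ring.
Qed.

Lemma echoS_powR_intg n : intg (fun w => S n w `^ g).
Proof.
have g1 := g_gt1; elim: n => [|n IH].
  rewrite (_ : (fun w => _) = fun=> 0); first exact: intg_cst.
  by apply/funext => w; rewrite /echoS big_geq // powR0 // gt_eqF; lra.
apply: (@ge0_intg_le _ _ _ _ _ (fun w => 2 `^ g * (S n w `^ g + X n.+1 w `^ g))).
- by apply: measurable_powRc; exact: (echoS_meas EM).
- move=> w; rewrite powR_ge0 echoSS powRD_le ?(echoS_ge0 EM) ?(echoX_ge0 EM) //; lra.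
- by apply: intgZ; apply: intgD => //; exact: echoX_powR_intg.
Qed.

(** Expectation of [powR_add_le] at the sum and the next step. The cross term is [Ex_echoXS] with
    [H] the power [g - 1] of the sum. *)
Lemma echoS_powR_step : exists2 C, 0 < C & forall n eta, (0 < n)%N -> 0 < eta <= 1 ->
  Ex (fun w => S n.+1 w `^ g) <= Ex (fun w => S n w `^ g) * (1 + (g + C * eta) * (m / n%:R))
    + C * eta `^ (- g) * (mg / n%:R * echo_norm mg n).
Proof.
have g1 := g_gt1; have [C C0 hC] := powR_add_le g1.
exists C => // n eta n0 eta01.
have sH : sigma_fun (F n) (fun w => S n w `^ (g - 1)).
  by apply: measurable_powRc; exact: (sigma_echoS EM).
have E w : S n w `^ (g - 1) * S n w = S n w `^ g.
  by apply: powRD1; apply: lt_le_trans (echoS_ge1 EM w n0).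
have iH : intg (fun w => S n w `^ (g - 1) * S n w).
  by rewrite (_ : (fun w => _) = (fun w => S n w `^ g)); [exact: echoS_powR_intg|apply/funext].
have [i1 e1] := Ex_echoXS EM xi_intg n0 sH iH.
have {}e1 : Ex (fun w => S n w `^ (g - 1) * X n.+1 w) = m / n%:R * Ex (fun w => S n w `^ g).
  by rewrite e1; congr (_ * _); apply: eq_Rintegral => w _; exact: E.
have [i2 e2] := echoX_powR_step n0 (fun k _ => echoX_powR_intg k).
rewrite sum_Ex_echoX_powR // in e2.
have i0 := echoS_powR_intg n.
apply: (@le_trans _ _ (Ex (fun w => S n w `^ g +
    (g + C * eta) * (S n w `^ (g - 1) * X n.+1 w) + C * eta `^ (- g) * X n.+1 w `^ g))).
  apply: Ex_le; first exact: echoS_powR_intg.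
    by apply: intgD; [apply: intgD => //|]; exact: intgZ.
  move=> w; rewrite echoSS; apply: hC => //; last exact: (echoX_ge0 EM).
  exact: lt_le_trans (echoS_ge1 EM w n0).
rewrite ExD ?ExD ?ExZ //; [|exact: intgZ|apply: intgD => //; exact: intgZ|exact: intgZ].
rewrite e1 e2; move: (Ex (fun w => S n w `^ g)) (m / n%:R) (mg / n%:R * _) => A q r.
by rewrite le_eqVlt; apply/orP; left; apply/eqP; ring.
Qed.

Hypothesis mg_lt : mg < g * m.

Lemma echoM_powR_intg n : intg (fun w => M n w `^ g).
Proof.
have an := echo_norm_mean_gt0 xi_mean_gt0 n.+1.
rewrite (_ : (fun w => _) = (fun w => (a n.+1)^-1 `^ g * S n.+1 w `^ g)).
  by apply: intgZ; exact: echoS_powR_intg.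
apply/funext => w; rewrite /echoM powRM ?(echoS_ge0 EM) ?invr_ge0 1?mulrC //.
exact: ltW.
Qed.

Lemma echoM_powR_bounded : exists K, forall n, Ex (fun w => M n w `^ g) <= K.
Proof.
have hm := xi_mean_gt0; have [C C0 step] := echoS_powR_step.
have [|B hB] := moment_recursion_bound g_gt1 hm moment_ge0 mg_lt C0 _ step.
  by move=> n _; apply: Ex_ge0 => w; exact: powR_ge0.
exists B => n; apply: le_trans (hB n.+1 isT).
have an := echo_norm_mean_gt0 hm n.+1.
rewrite (_ : (fun w => M n w `^ g) = (fun w => (a n.+1 `^ g)^-1 * S n.+1 w `^ g)).
  by rewrite ExZ; [rewrite mulrC|exact: echoS_powR_intg].
apply/funext => w; rewrite /echoM powRM ?(echoS_ge0 EM) ?invr_ge0 ?(ltW an) //.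
by rewrite -(powR_inv1 (ltW an)) -powRrM mulN1r powRN mulrC.
Qed.

End Moments.

(** * The deterministic recursion behind the critical case *)

Section CriticalRecursion.
Context {R : realType}.
(* [Q], [Y] and [L] stand for the sums of E[Z_k], E[Z_k^(1+s)] and
   E[Z_k ln(K a_n / Z_k)] over the truncated steps Z_1, ..., Z_n. *)
Variables (m s K B mB m1s lam : R) (Q Y L : nat -> R).
Local Notation a := (echo_norm m).
Hypotheses (m_gt0 : 0 < m) (s_gt0 : 0 < s) (K_gt0 : 0 < K) (B_gt0 : 0 < B).
(** For the echo law, [m1s] is the moment of order [1 + s], [mB] the same moment with the values
    above [B] discarded, and [lam] the mean of [xi * ln xi]. *)
Hypotheses (mB_gt : (1 + s) * m < mB) (m1s_ge0 : 0 <= m1s) (lam_ge : m <= lam).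
Hypothesis Q_ge0 : forall n, (0 < n)%N -> 0 <= Q n.
Hypothesis Y_ge0 : forall n, (0 < n)%N -> 0 <= Y n.
Hypothesis Q_step : forall n, (0 < n)%N -> Q n.+1 <= Q n * (1 + m / n%:R).
Hypothesis Q1 : Q 1 <= 1.
Hypothesis Y_step : forall n, (0 < n)%N ->
  Y n * (1 + mB / n%:R) <=
  Y n.+1 + (B * (K * a n.+1)) `^ s * (Q n * (1 + m / n%:R) - Q n.+1).
Hypothesis Y_le : forall n, (0 < n)%N -> Y n <= (K * a n) `^ s * Q n.
Hypothesis L_step : forall n, (0 < n)%N ->
  L n.+1 <= (1 + m / n%:R) * (L n + Q n * ln (1 + m / n%:R)) - lam / n%:R * Q n
    + m1s / n%:R * (s^-1 * ((K * a n.+1) `^ s)^-1 * Y n).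
Hypothesis Y_ge : forall n A, (0 < n)%N -> 0 < A ->
  (K * a n) `^ s * (expR (- (s * A)) * (Q n - L n / A)) <= Y n.

(** For a vertex chosen with weight proportional to its untruncated step, and
    [D = ln (K a_n / Z_k)]: [q] is the probability of survival, [y] is [K^s] times the mean of
    [expR (- s D)] on survival, and [l] the mean of [D] on survival. *)
Let q n := Q n / a n.
Let y n := Y n / a n `^ (1 + s).
Let l n := L n / a n.

Let an n : 0 < a n. Proof. by apply: echo_norm_gt0; exact: ltW. Qed.
Let kn n : 0 < 1 + m / n%:R.
Proof. by rewrite ltr_pwDl // divr_ge0 // ltW. Qed.

Let pK : 0 < K `^ s. Proof. exact: powR_gt0. Qed.

Lemma critical_q_step n : (0 < n)%N -> q n.+1 <= q n.
Proof.
move=> n0; rewrite /q ler_pdivrMr // echo_normS //.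
apply: (le_trans (Q_step n0)); rewrite mulrA divfK ?gt_eqF //.
Qed.

Lemma critical_q_le1 n : (0 < n)%N -> q n <= 1.
Proof.
case: n => // n _; elim: n => [|n IH]; first by rewrite /q echo_norm1 divr1.
by apply: le_trans IH; exact: critical_q_step.
Qed.

Lemma critical_q_ge0 n : (0 < n)%N -> 0 <= q n.
Proof. by move=> n0; rewrite divr_ge0 ?Q_ge0 // ltW. Qed.

Let aDs n : a n `^ (1 + s) = a n * a n `^ s.
Proof. by rewrite powRDS // ltW. Qed.

Lemma critical_y_le n : (0 < n)%N -> y n <= K `^ s.
Proof.
move=> n0; have ps : 0 < a n `^ s by exact: powR_gt0.
rewrite /y aDs ler_pdivrMr ?mulr_gt0 //; apply: (le_trans (Y_le n0)).
rewrite (powRM _ (ltW K_gt0) (ltW (an n))) -mulrA ler_pM2l // mulrC ler_pM2r //.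
by have := critical_q_le1 n0; rewrite /q ler_pdivrMr // mul1r.
Qed.

(** Since [mB > (1 + s) * m], without killing [y] would grow by a factor [1 + c / n]. Hence
    [c * y / n] is at most the actual increase of [y] plus a multiple of the mass killed in this
    step, which is the decrease of [q]. *)
Lemma critical_y_step : exists2 c, 0 < c & exists n0 : nat, forall n, (n0 <= n)%N ->
  (0 < n)%N -> c * (y n / n%:R) <= y n.+1 - y n + (B * K) `^ s * (q n - q n.+1).
Proof.
have g1 : 1 < 1 + s by have := s_gt0; lra.
have [c c0 [n0 hn]] := powR_ratio_ge g1 m_gt0 mB_gt.
exists c => //; exists n0 => n n0n n1.
have h := hn n n0n n1; have ps := powR_gt0 (1 + s) (an n).
have ps1 := powR_gt0 (1 + s) (an n.+1).
have y0 := Y_ge0 n1.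
have h1 : Y n * ((1 + c / n%:R) * (1 + m / n%:R) `^ (1 + s)) <=
   Y n.+1 + (B * (K * a n.+1)) `^ s * (Q n * (1 + m / n%:R) - Q n.+1).
  by apply: le_trans (Y_step n1); exact: ler_wpM2l.
have aS : a n.+1 `^ (1 + s) = a n `^ (1 + s) * (1 + m / n%:R) `^ (1 + s).
  by rewrite echo_normS // powRM // ltW.
have e1 : y n * (1 + c / n%:R) * a n.+1 `^ (1 + s) =
    Y n * ((1 + c / n%:R) * (1 + m / n%:R) `^ (1 + s)).
  rewrite aS /y; move: ((1 + m / n%:R) `^ (1 + s)) (1 + c / n%:R) => z t.
  by field; rewrite gt_eqF.
have e0 : (q n - q n.+1) * a n.+1 = Q n * (1 + m / n%:R) - Q n.+1.
  by rewrite mulrBl /q divfK ?gt_eqF // echo_normS // mulrA divfK ?gt_eqF.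
have e2 : (B * K) `^ s * (q n - q n.+1) * a n.+1 `^ (1 + s) =
    (B * (K * a n.+1)) `^ s * (Q n * (1 + m / n%:R) - Q n.+1).
  rewrite aDs -e0 (mulrA B K) (powRM _ (mulr_ge0 (ltW B_gt0) (ltW K_gt0)) (ltW (an n.+1))).
  by move: (q n - q n.+1) (_ `^ s) (_ `^ s) => t1 t2 t3; ring.
have h2 : y n * (1 + c / n%:R) <= y n.+1 + (B * K) `^ s * (q n - q n.+1).
  rewrite -(ler_pM2r ps1) e1 [X in _ <= X]mulrDl e2 /y divfK ?gt_eqF //.
by rewrite mulrA mulrAC; move: h2; rewrite mulrDr mulr1 (mulrC c) mulrA => h2; lra.
Qed.

(** The killing level rises by [ln (1 + m / n) <= m / n] while the steps gain [lam / n]; as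
    [m <= lam], only an error [m^2 / n^2] survives. The last term is the overshoot of killed
    steps. *)
Lemma critical_l_step n : (0 < n)%N ->
  l n.+1 <= l n + m ^+ 2 * n%:R^-1 ^+ 2 + m1s / s / K `^ s * (y n / n%:R).
Proof.
move=> n0; rewrite {1}/l ler_pdivrMr //; apply: (le_trans (L_step n0)).
have N0 : 0 < n%:R :> R by rewrite ltr0n.
set v := n%:R^-1 : R; have v0 : 0 < v by rewrite invr_gt0.
have a1 := an n; have a2 := an n.+1; have kk := kn n; have m0 := m_gt0.
have aS : a n.+1 = a n * (1 + m * v) by rewrite echo_normS.
have aa : a n <= a n.+1 by apply: echo_norm_le => //; exact: ltW.
have p1 : l n * a n.+1 = (1 + m * v) * L n.
  by rewrite aS /l mulrA divfK ?gt_eqF // mulrC.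
have Qa : Q n <= a n.+1.
  by apply: le_trans aa; have := critical_q_le1 n0; rewrite /q ler_pdivrMr // mul1r.
have p2 : (1 + m * v) * (Q n * ln (1 + m * v)) - lam * v * Q n <=
    m ^+ 2 * v ^+ 2 * a n.+1.
  have hln : ln (1 + m * v) <= m * v.
    by apply: le_ln1Dx; have : 0 < m * v by [rewrite mulr_gt0]; lra.
  have h1 : (1 + m * v) * ln (1 + m * v) <= (1 + m * v) * (m * v).
    by rewrite ler_pM2l.
  have h2 : m * v <= lam * v by rewrite ler_pM2r.
  have h3 : (1 + m * v) * ln (1 + m * v) - lam * v <= m ^+ 2 * v ^+ 2 by lra.
  apply: (@le_trans _ _ (m ^+ 2 * v ^+ 2 * Q n)).
    by have := ler_wpM2r (Q_ge0 n0) h3; lra.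
  by apply: ler_wpM2l => //; rewrite mulr_ge0 // sqr_ge0.
have p3 : m1s * v * (s^-1 * ((K * a n.+1) `^ s)^-1 * Y n) <=
    m1s / s / K `^ s * (y n * v) * a n.+1.
  rewrite (powRM _ (ltW K_gt0) (ltW a2)) /y aDs.
  have P1 : 0 < a n `^ s by exact: powR_gt0.
  have P2 : 0 < a n.+1 `^ s by exact: powR_gt0.
  have h1 : (a n.+1 `^ s)^-1 <= a n.+1 / (a n * a n `^ s).
    have h2 : a n `^ s <= a n.+1 `^ s.
      by apply: ge0_ler_powR; rewrite ?nnegrE ?(ltW s_gt0) ?(ltW a1) ?(ltW a2).
    rewrite ler_pdivlMr ?mulr_gt0 // mulrC ler_pdivrMr //.
    by apply: ler_pM => //; exact: ltW.
  have h3 : 0 <= m1s * v * s^-1 * (K `^ s)^-1 * Y n.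
    by rewrite !mulr_ge0 ?invr_ge0 ?powR_ge0 ?Y_ge0 ?(ltW v0) ?(ltW s_gt0).
  have := ler_wpM2l h3 h1; rewrite (invfM (K `^ s)).
  move: (a n.+1 `^ s)^-1 (K `^ s)^-1 (a n * a n `^ s)^-1 => t1 t2 t3.
  lra.
rewrite [X in _ <= X]mulrDl [X in _ <= X + _]mulrDl p1; lra.
Qed.

(** By contradiction: if [q] stays above [e], then [y] stays above a constant [c3], and [Phi] falls
    below every bound because it loses at least [c * c3] times the increment of [ln n]. *)
Lemma critical_q_cvg0 e : 0 < e -> exists n, (0 < n)%N /\ q n <= e.
Proof.
move=> e0; apply: contrapT => /forallNP hN.
have qe n : (0 < n)%N -> e < q n.
  by move=> n0; have := hN n => /not_andP[//|/negP]; rewrite -ltNge.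
have [c c0 [N hNc]] := critical_y_step.
pose n0 := maxn N 1%N.
have n0N : (N <= n0)%N by exact: leq_maxl.
have n01 : (0 < n0)%N by exact: leq_maxr.
(* [Phi] is bounded below and decreases by at least [c * y n / n]. *)
pose Phi n := (B * K) `^ s * q n - y n.
have PhiS n : (n0 <= n)%N -> c * (y n / n%:R) <= Phi n - Phi n.+1.
  move=> nn; have := hNc n (leq_trans n0N nn) (leq_trans n01 nn); rewrite /Phi; lra.
have PhiK n : (0 < n)%N -> - K `^ s <= Phi n.
  move=> np; have := critical_y_le np.
  have : 0 <= (B * K) `^ s * q n by rewrite mulr_ge0 ?powR_ge0 ?critical_q_ge0.
  rewrite /Phi; lra.
pose c2 := m1s / s / K `^ s.
have c20 : 0 <= c2 by rewrite !mulr_ge0 ?invr_ge0 ?powR_ge0 // ltW.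
(* Made to be nonincreasing: the decrease of [Phi] absorbs the overshoot term of [critical_l_step],
   and that of [2 * m^2 / n] absorbs [m^2 / n^2], because [1 / n^2 <= 2 / (n (n+1))]. *)
pose Psi n := l n + c2 / c * Phi n + 2 * m ^+ 2 / n%:R.
have PsiS n : (n0 <= n)%N -> Psi n.+1 <= Psi n.
  move=> nn; have np : (0 < n)%N by exact: leq_trans nn.
  have N0 : 0 < n%:R :> R by rewrite ltr0n.
  have h1 := critical_l_step np; rewrite -/c2 in h1.
  have h2 := PhiS n nn.
  have h3 : c2 * (y n / n%:R) <= c2 / c * (Phi n - Phi n.+1).
    have -> : c2 * (y n / n%:R) = c2 / c * (c * (y n / n%:R)).
      by move: (y n / n%:R) => t; field; rewrite gt_eqF.
    by apply: ler_wpM2l => //; rewrite divr_ge0 // ltW.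
  have h4 : m ^+ 2 * n%:R^-1 ^+ 2 <= 2 * m ^+ 2 / n%:R - 2 * m ^+ 2 / n.+1%:R.
    have -> : 2 * m ^+ 2 / n%:R - 2 * m ^+ 2 / n.+1%:R =
        m ^+ 2 * (n%:R^-1 * (2 / n.+1%:R)).
      by rewrite -natr1; field; rewrite !gt_eqF // ltr_wpDl.
    apply: ler_wpM2l; first exact: sqr_ge0.
    rewrite expr2 ler_pM2l ?invr_gt0 // ler_pdivlMr ?ltr0n // mulrC ler_pdivrMr //.
    by rewrite -natrM ler_nat mul2n -addnn -addn1 leq_add2l.
  rewrite /Psi; move: h1 h3 h4; move: (2 * m ^+ 2 / n.+1%:R) => z1.
  move: (2 * m ^+ 2 / n%:R) (m ^+ 2 * _) (y n / n%:R) => z2 z3 z4.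
  move: (c2 / c) => z5; rewrite mulrBr; lra.
have Psile n : (n0 <= n)%N -> Psi n <= Psi n0.
  move=> /subnKC <-; elim: (n - n0)%N => [|j IH]; first by rewrite addn0.
  by rewrite addnS; apply: le_trans IH; apply: PsiS; exact: leq_addr.
pose C3 := Num.max (Psi n0 + c2 / c * K `^ s) 1.
have C30 : 0 < C3 by rewrite lt_max ltr01 orbT.
have lC n : (n0 <= n)%N -> l n <= C3.
  move=> nn; have np : (0 < n)%N by exact: leq_trans nn.
  rewrite le_max; apply/orP; left.
  have := Psile n nn; rewrite /Psi -/(Psi n0).
  have h1 : 0 <= 2 * m ^+ 2 / n%:R by rewrite divr_ge0 // mulr_ge0 // sqr_ge0.
  have h2 : c2 / c * - K `^ s <= c2 / c * Phi n.
    by apply: ler_wpM2l; [rewrite divr_ge0 // ltW|exact: PhiK].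
  move: h1 h2; rewrite mulrN; move: (2 * m ^+ 2 / n%:R) (c2 / c * _) (c2 / c * _) => z1 z2 z3.
  lra.
(* Markov's inequality at distance [A] from the level: [l n / A <= e / 2], so at least [e / 2] of
   the surviving mass lies within [A], where it contributes to [y]. *)
pose A := 2 * C3 / e.
have A0 : 0 < A by rewrite divr_gt0 // mulr_gt0.
pose c3 := K `^ s * (expR (- (s * A)) * (e / 2)).
have c30 : 0 < c3 by rewrite !mulr_gt0 ?expR_gt0 // divr_gt0.
have yc n : (n0 <= n)%N -> c3 <= y n.
  move=> nn; have np : (0 < n)%N by exact: leq_trans nn.
  have P2 : 0 < a n `^ s by exact: powR_gt0.
  have h := Y_ge np A0.
  rewrite /y aDs ler_pdivlMr ?mulr_gt0 //; apply: le_trans h.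
  rewrite (powRM _ (ltW K_gt0) (ltW (an n))).
  have h1 : e / 2 <= q n - l n / A.
    have h2 : l n / A <= e / 2.
      rewrite ler_pdivrMr // /A; have -> : e / 2 * (2 * C3 / e) = C3.
        by field; rewrite gt_eqF.
      exact: lC.
    by have := qe n np; lra.
  have -> : Q n - L n / A = (q n - l n / A) * a n.
    rewrite /q /l mulrBl divfK ?gt_eqF //; congr (_ - _).
    by rewrite mulrAC divfK ?gt_eqF.
  have h2 := ler_wpM2l (ltW (mulr_gt0 (mulr_gt0 pK P2) (mulr_gt0 (expR_gt0 (- (s * A))) (an n)))) h1.
  rewrite /c3; move: h2; move: (q n - l n / A) (expR _) (a n `^ s) (K `^ s) => z1 z2 z3 z4; lra.
have Philn n : (n0 <= n)%N -> Phi n <= Phi n0 - c * c3 * (ln n%:R - ln n0%:R).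
  move=> /subnKC <-; elim: (n - n0)%N => [|j IH]; first by rewrite addn0 subrr mulr0 subr0.
  rewrite addnS; set i := (n0 + j)%N in IH *.
  have ii : (n0 <= i)%N by exact: leq_addr.
  have ip : (0 < i)%N by exact: leq_trans ii.
  have I0 : 0 < i%:R :> R by rewrite ltr0n.
  have h1 := PhiS i ii; have h2 := yc i ii.
  have h3 : ln i.+1%:R - ln i%:R <= i%:R^-1 :> R.
    have -> : i.+1%:R = i%:R * (1 + i%:R^-1) :> R.
      by rewrite mulrDr mulr1 divff ?gt_eqF // natr1.
    have J0 : 0 < 1 + i%:R^-1 :> R by rewrite addr_gt0 // invr_gt0.
    rewrite lnM ?posrE // addrAC subrr add0r; apply: le_ln1Dx.
    by apply: lt_trans (_ : 0 < _); rewrite ?oppr_lt0 ?invr_gt0.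
  have h4 : c * c3 * (ln i.+1%:R - ln i%:R) <= c * (y i / i%:R).
    rewrite -mulrA ler_pM2l //; apply: ler_pM => //.
    - exact: ltW.
    - by rewrite subr_ge0 ler_ln ?posrE // ?ltr0n // ler_nat.
  move: h1 h4 IH; move: (c * (y i / i%:R)) (ln i.+1%:R) (ln i%:R) (ln n0%:R) (c * c3) => z1 z2 z3 z4 z5.
  lra.
have [k hk] : exists k : nat, (Phi n0 + K `^ s) / (c * c3) + ln n0%:R < ln k%:R /\ (n0 <= k)%N.
  pose z := (Phi n0 + K `^ s) / (c * c3) + ln n0%:R.
  exists (maxn n0 (Num.truncn (expR z)).+1); split; last exact: leq_maxl.
  rewrite -/z -ltr_expR lnK ?posrE; last by rewrite ltr0n; exact: leq_trans (leq_maxl _ _).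
  apply: lt_le_trans (truncnS_gt (expR z)) _; rewrite ler_nat; exact: leq_maxr.
have [hk1 hk2] := hk.
have h1 := Philn k hk2; have h2 := PhiK k (leq_trans n01 hk2).
have cc : 0 < c * c3 by rewrite mulr_gt0.
have : (Phi n0 + K `^ s) / (c * c3) < ln k%:R - ln n0%:R by lra.
rewrite ltr_pdivrMr // mulrC; lra.
Qed.

Lemma critical_cvg0 : Q n / a n @[n --> \oo] --> 0.
Proof.
have q_le n k : (0 < n)%N -> (n <= k)%N -> q k <= q n.
  move=> n0 /subnKC <-; elim: (k - n)%N => [|j IH]; first by rewrite addn0.
  rewrite addnS; apply: le_trans IH; apply: critical_q_step.
  exact: leq_trans (leq_addr _ _).
apply/cvgrPdist_le => e e0; have [N [N0 hN]] := critical_q_cvg0 e0.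
near=> n; have Nn : (N <= n)%N by near: n; exact: nbhs_infty_ge.
rewrite sub0r normrN -/(q n) ger0_norm; first exact: le_trans (q_le N n N0 Nn) hN.
by apply: critical_q_ge0; exact: leq_trans Nn.
Unshelve. all: end_near. Qed.

End CriticalRecursion.

(** * Pointwise inequalities for one truncated step: parent [z], echo [x], level [b] *)

Section TruncationInequalities.
Context {R : realType}.
Implicit Types (x z b s A B : R).

(** A product below the level is kept. A killed one with [x <= B] is at most [B * b], so its power
    of order [1 + s] is at most [(B * b)^s] times the killed mass; the cut at [B] serves to bound
    the overshoot. *)
Lemma trunc_power_ge x z b s B : 0 <= x -> 0 <= z <= b -> 0 < s -> 0 < B ->
  (x * ((x <= B)%R)%:R) `^ (1 + s) * z `^ (1 + s) <=
  (x * z * ((x * z <= b)%R)%:R) `^ (1 + s) + (B * b) `^ s * (x * z - x * z * ((x * z <= b)%R)%:R).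
Proof.
move=> x0 /andP[z0 zb] s0 B0.
have b0 : 0 <= b by exact: le_trans zb.
have xz0 : 0 <= x * z by rewrite mulr_ge0.
have [xzb|xzb] := leP (x * z) b.
  rewrite mulr1 subrr mulr0 addr0 -powRM //; last by rewrite mulr_ge0.
  have [xB|xB] := leP x B; first by rewrite mulr1.
  by rewrite mulr0 mul0r powR0 ?powR_ge0 // gt_eqF //; lra.
rewrite mulr0 subr0 powR0 ?add0r ?gt_eqF //; last by lra.
have [xB|xB] := leP x B; last first.
  rewrite mulr0 powR0 ?mul0r; first by rewrite mulr_ge0 ?powR_ge0.
  by rewrite gt_eqF //; lra.
rewrite mulr1 -powRM // (powRDS xz0 (ltW s0)) mulrC ler_wpM2r //.
apply: ge0_ler_powR; rewrite ?nnegrE ?mulr_ge0 ?(ltW s0) ?(ltW B0) //.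
by apply: ler_pM.
Qed.

(** Without truncation the first two terms on the right are exact. A killed product counts 0 instead
    of a negative value, and the last term makes up for this through [ln y <= y^s / s] at
    [y = x * z / b]. *)
Lemma trunc_log_le x z b s : 0 <= x -> 0 <= z <= b -> 0 < b -> 0 < s ->
  x * z * ((x * z <= b)%R)%:R * (ln b - ln (x * z * ((x * z <= b)%R)%:R)) <=
  x * (z * (ln b - ln z)) - x * ln x * z +
  s^-1 * (b `^ s)^-1 * (x `^ (1 + s) * z `^ (1 + s)).
Proof.
move=> x0 /andP[z0 zb] b0 s0.
have bs : 0 < b `^ s by exact: powR_gt0.
move: x0; rewrite le_eqVlt => /predU1P[<-|x0].
  by rewrite !mul0r subrr add0r mulr_ge0 // ?mulr_ge0 ?invr_ge0 ?powR_ge0 // ltW.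
move: z0; rewrite le_eqVlt => /predU1P[<-|z0].
  by rewrite !(mulr0,mul0r) subrr add0r mulr_ge0 // ?mulr_ge0 ?invr_ge0 ?powR_ge0 // ltW.
have xz0 : 0 < x * z by rewrite mulr_gt0.
have E : x * (z * (ln b - ln z)) - x * ln x * z = x * z * (ln b - ln (x * z)).
  by rewrite (@lnM _ x z) ?posrE //; ring.
rewrite E -(powRM _ (ltW x0) (ltW z0)).
have [xzb|xzb] := leP (x * z) b.
  by rewrite mulr1 lerDl mulr_ge0 ?powR_ge0 // mulr_ge0 ?invr_ge0 ?powR_ge0 // ltW.
rewrite mulr0 mul0r (powRDS (ltW xz0) (ltW s0)).
have y0 : 0 < x * z / b by rewrite divr_gt0.
have h := ln_le_powR s0 y0.
have bi : 0 <= b^-1 by rewrite invr_ge0 ltW.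
rewrite (@ln_div _ (x * z) b) ?posrE // (powRM _ (ltW xz0) bi) in h.
rewrite -(powR_inv1 (ltW b0)) -powRrM mulN1r powRN in h.
have := ler_wpM2l (ltW xz0) h; lra.
Qed.

(** With [D = ln b - ln z] this reads [expR (- s A) * (1 - D / A) <= expR (- s D)]: the left side is
    negative for [D > A], and for [D <= A] the second factor is at most 1. *)
Lemma trunc_power_lower z b s A : 0 <= z <= b -> 0 < b -> 0 < s -> 0 < A ->
  b `^ s * (expR (- (s * A)) * (z - z * (ln b - ln z) / A)) <= z `^ (1 + s).
Proof.
move=> /andP[z0 zb] b0 s0 A0.
move: z0; rewrite le_eqVlt => /predU1P[<-|z0].
  by rewrite !mul0r subr0 !mulr0 powR_ge0.
set D := ln b - ln z.
have D0 : 0 <= D by rewrite subr_ge0 ler_ln.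
have zs : z `^ s = b `^ s * expR (- (s * D)).
  rewrite !powRE // -expRD; congr expR; rewrite /D; ring.
rewrite (powRDS (ltW z0) (ltW s0)) zs.
have -> : z - z * D / A = z * (1 - D / A) by ring.
have key : expR (- (s * A)) * (1 - D / A) <= expR (- (s * D)).
  have e0 := expR_gt0 (- (s * A)).
  have [DA|DA] := leP D A.
    apply: (@le_trans _ _ (expR (- (s * A)))).
      by apply: ler_piMr; [exact: ltW|rewrite lerBlDr lerDl divr_ge0 // ltW].
    by rewrite ler_expR lerN2 ler_pM2l.
  apply: (@le_trans _ _ 0); last exact: expR_ge0.
  rewrite mulr_ge0_le0 ?(ltW e0) // subr_le0 ler_pdivlMr // mul1r; exact: ltW.
have h := ler_wpM2l (mulr_ge0 (powR_ge0 b s) (ltW z0)) key.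
by move: h; move: (expR _) (expR _) (1 - _) => t1 t2 t3; lra.
Qed.

Lemma xlnc_bounds z c : 0 <= z <= c -> 0 <= z * (ln c - ln z) <= c.
Proof.
move=> /andP[]; rewrite le_eqVlt => /predU1P[<-|z0] zc; first by rewrite mul0r lexx.
have c0 : 0 < c by exact: lt_le_trans zc.
apply/andP; split; first by rewrite mulr_ge0 ?(ltW z0) // subr_ge0 ler_ln.
rewrite -ln_div ?posrE //.
have := ltW (ln_sublinear (divr_gt0 c0 z0)) => h.
have := ler_wpM2l (ltW z0) h; rewrite mulrCA divff ?mulr1 // gt_eqF //.
Qed.

End TruncationInequalities.

(** * The truncated walk *)

Section Critical.
Context {R : realType} d {T : measurableType d} (P : probability T R).
Local Notation intg f := (P.-integrable setT (EFin \o f)).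
Local Notation Ex f := (\int[P]_w f w)%R.
Variables (xi : T -> R) (x : nat -> T -> R) (u : nat -> T -> nat) (F : nat -> set (set T)).
Hypothesis EM : echo_model P xi x u F.
Hypothesis xi_intg : intg xi.
Hypothesis xi_mean_gt0 : 0 < Ex xi.
Local Notation m := (Ex xi).
Local Notation a := (echo_norm m).
Local Notation X := (echoX x u).
Local Notation S := (echoS x u).
Local Notation M := (echoM P xi x u).

Variables s K : R.
Hypothesis s_gt0 : 0 < s.
Hypothesis K_ge1 : 1 <= K.
Hypothesis xis_intg : intg (fun w => xi w `^ (1 + s)).
Local Notation m1s := (Ex (fun w => xi w `^ (1 + s))).

(** A step above the level is replaced by 0 and not capped, so all its descendants vanish with
    it. *)
Definition trunc n (y : R) : R := y * ((y <= K * a n)%R)%:R.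

Definition truncX := fstep x u trunc.

Let b n := K * a n.

Let K0 : 0 < K. Proof. exact: lt_le_trans K_ge1. Qed.
Let an n : 0 < a n. Proof. exact: echo_norm_mean_gt0. Qed.
Let b0 n : 0 < b n. Proof. exact: mulr_gt0. Qed.

Lemma trunc_meas i : measurable_fun setT (trunc i).
Proof.
apply: measurable_funM => //; apply: measurable_natr_bool.
exact: measurable_fun_ler.
Qed.

Lemma trunc0 i : trunc i 0 = 0.
Proof. by rewrite /trunc mul0r. Qed.

Lemma trunc_ge0 i (y : R) : 0 <= y -> 0 <= trunc i y.
Proof. by move=> y0; rewrite mulr_ge0. Qed.

Lemma trunc_le i (y : R) : trunc i y <= b i.
Proof. by rewrite /trunc; have [h|h] := leP y; rewrite ?mulr1 // mulr0 ltW. Qed.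

Lemma truncX_ge0 n w : 0 <= truncX n w.
Proof. by apply: (fstep_ge0 EM) => i y; exact: trunc_ge0. Qed.

Lemma threshold_le n k : (n <= k)%N -> b n <= b k.
Proof.
by move=> nk; rewrite ler_pM2l //; apply: echo_norm_le => //; exact: ltW.
Qed.

Lemma truncX_le n k w : (n <= k)%N -> truncX n w <= b k.
Proof.
move=> nk; apply: le_trans (threshold_le nk).
(* The initial step 1 is not filtered; it lies under the level because [a 1 = 1] and [K >= 1]. *)
case: n {nk} => [|[|n]]; [exact: ltW|by rewrite /truncX fstep1 /b echo_norm1 mulr1|].
by rewrite /truncX fstepS // trunc_le.
Qed.

Lemma truncX_meas k : measurable_fun setT (truncX k).
Proof. by apply: (fstep_meas EM) => i; exact: trunc_meas. Qed.

Lemma sigma_truncX k n : (k <= n)%N -> sigma_fun (F n) (truncX k).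
Proof. by apply: (sigma_fstep EM) => i; exact: trunc_meas. Qed.

Lemma intg_bounded (f : T -> R) (c : R) : measurable_fun setT f ->
  (forall w, 0 <= f w <= c) -> intg f.
Proof. by move=> mf fc; apply: (ge0_intg_le mf fc); exact: intg_cst. Qed.

Lemma truncX_intg k : intg (truncX k).
Proof. by apply: (@intg_bounded _ (b k)) => [|w]; [exact: truncX_meas|rewrite truncX_ge0 truncX_le]. Qed.

Lemma truncX_powR_intg k : intg (fun w => truncX k w `^ (1 + s)).
Proof.
apply: (@intg_bounded _ (b k `^ (1 + s))); first by apply: measurable_powRc; exact: truncX_meas.
move=> w; rewrite powR_ge0 /=; have := s_gt0 => s0.
by apply: ge0_ler_powR; rewrite ?nnegrE ?truncX_ge0 ?truncX_le ?(ltW (b0 _)) //; lra.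
Qed.

Lemma measurable_zlnc d' (T' : measurableType d') (c : R) (f : T' -> R) :
  measurable_fun setT f -> measurable_fun setT (fun w => f w * (ln c - ln (f w))).
Proof.
move=> mf; apply: measurable_funM => //; apply: measurable_funB => //.
exact: (measurableT_comp (@measurable_ln R)).
Qed.

Lemma truncX_log_intg k n : (k <= n)%N -> intg (fun w => truncX k w * (ln (b n) - ln (truncX k w))).
Proof.
move=> kn; apply: (@intg_bounded _ (b n)).
  by apply: measurable_zlnc; exact: truncX_meas.
by move=> w; apply: xlnc_bounds; rewrite truncX_ge0 truncX_le.
Qed.

Let Q n := \sum_(1 <= k < n.+1) Ex (truncX k).
Let Y n := \sum_(1 <= k < n.+1) Ex (fun w => truncX k w `^ (1 + s)).
Let L n := \sum_(1 <= k < n.+1) Ex (fun w => truncX k w * (ln (b n) - ln (truncX k w))).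
Let W n := parent u (fun k w => x n.+1 w * truncX k w) n.

Lemma truncX_mass_ge0 n : 0 <= Q n.
Proof. by apply: sumr_ge0 => k _; apply: Ex_ge0 => w; exact: truncX_ge0. Qed.

Lemma truncX_power_ge0 n : 0 <= Y n.
Proof. by apply: sumr_ge0 => k _; apply: Ex_ge0 => w; exact: powR_ge0. Qed.

Lemma truncXS n w : (0 < n)%N -> truncX n.+1 w = trunc n.+1 (W n w).
Proof. by move=> n0; rewrite /truncX fstepS. Qed.

Lemma trunc_parent_intg n : (0 < n)%N -> intg (W n) /\ Ex (W n) = m / n%:R * Q n.
Proof.
move=> n0; have sZ k : (1 <= k <= n)%N -> sigma_fun (F n) (truncX k).
  by move=> /andP[_ kn]; exact: sigma_truncX.
exact: (@Ex_parent _ _ _ P xi x u F EM n truncX id n0 sZ (fun k _ => truncX_intg k)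
  (@measurable_id _ _ _) xi_intg).
Qed.

Lemma truncX_le_parent n w : (0 < n)%N -> truncX n.+1 w <= W n w.
Proof.
move=> n0; rewrite truncXS // /trunc; have W0 : 0 <= W n w.
  by rewrite /W parentE; case: ifP => // _; rewrite mulr_ge0 ?truncX_ge0 ?(em_x_ge0 EM).
by apply: ler_piMr => //; rewrite lern1 leq_b1.
Qed.

Lemma truncX_mass_step n : (0 < n)%N -> Q n.+1 <= Q n * (1 + m / n%:R).
Proof.
move=> n0; rewrite /Q big_nat_recr //= -/(Q n) mulrDr mulr1 lerD2l.
have [iW eW] := trunc_parent_intg n0; rewrite mulrC -eW; apply: Ex_le => //; first exact: truncX_intg.
by move=> w; exact: truncX_le_parent.
Qed.

Lemma truncX_mass1 : Q 1 <= 1.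
Proof.
rewrite /Q big_nat1 (_ : truncX 1 = fun=> 1) ?Ex_cst //.
Qed.

Section WithB.
Variable B : R.
Hypothesis B_gt0 : 0 < B.
Let gB (y : R) := (y * ((y <= B)%R)%:R) `^ (1 + s).
Local Notation mB := (Ex (fun w => (xi w * ((xi w <= B)%R)%:R) `^ (1 + s))).

Lemma trunc_powR_meas : measurable_fun setT gB.
Proof.
apply: measurable_powRc; apply: measurable_funM => //; apply: measurable_natr_bool.
exact: measurable_fun_ler.
Qed.

Lemma trunc_powR_intg : intg (gB \o xi).
Proof.
apply: (@ge0_intg_le _ _ _ _ _ (fun w => xi w `^ (1 + s))) => //.
  by apply: measurableT_comp; [exact: trunc_powR_meas|exact: (em_xi_meas EM)].
move=> w; rewrite powR_ge0 /=; have s0 := s_gt0; have x0 := em_xi_ge0 EM w.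
apply: ge0_ler_powR; rewrite ?nnegrE ?mulr_ge0 //; first lra.
by apply: ler_piMr => //; rewrite lern1 leq_b1.
Qed.

Lemma truncX_power_step n : (0 < n)%N ->
  Y n * (1 + mB / n%:R) <=
  Y n.+1 + (B * (K * a n.+1)) `^ s * (Q n * (1 + m / n%:R) - Q n.+1).
Proof.
move=> n0; have s0 := s_gt0.
have sZ k : (1 <= k <= n)%N -> sigma_fun (F n) (fun w => truncX k w `^ (1 + s)).
  by move=> /andP[_ kn]; apply: measurable_powRc; exact: sigma_truncX.
have [i e] := @Ex_parent _ _ _ P xi x u F EM n (fun k w => truncX k w `^ (1 + s)) gB
  n0 sZ (fun k _ => truncX_powR_intg k) trunc_powR_meas trunc_powR_intg.
have [iW eW] := trunc_parent_intg n0.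
have iZ := truncX_intg n.+1; have iZs := truncX_powR_intg n.+1.
pose c := (B * (K * a n.+1)) `^ s.
have pw w : parent u (fun k w => gB (x n.+1 w) * truncX k w `^ (1 + s)) n w <=
    truncX n.+1 w `^ (1 + s) + c * (W n w - truncX n.+1 w).
  rewrite truncXS // /W !parentE; case: ifP => [/andP[_ un]|_].
    apply: trunc_power_ge => //; first exact: (em_x_ge0 EM).
    by rewrite truncX_ge0 truncX_le //; exact: leqW.
  by rewrite trunc0 subrr mulr0 addr0 powR_ge0.
have h := Ex_le i (intgD iZs (intgZ c (intgB iW iZ))) pw.
rewrite e ExD // ?ExZ ?ExB // in h; [|exact: intgB|apply: intgZ; exact: intgB].
rewrite eW in h.
rewrite /Y /Q [in X in _ <= X]big_nat_recr //= [\sum_(1 <= i < n.+2) Ex (truncX i)]big_nat_recr //=.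
rewrite -/(Y n) -/(Q n) -/c.
move: h; rewrite -/(Y n) -[gB \o xi]/(fun w => gB (xi w)) /gB.
move: (Ex (fun w => (xi w * _) `^ _)) (Ex (truncX n.+1)) (Ex (fun w => truncX n.+1 w `^ _)) => t1 t2 t3.
clear pw; clearbody c; move: (Q n) (Y n) (Ex xi / n%:R) => q y mm; rewrite -(mulrC n%:R^-1); lra.
Qed.

End WithB.

Lemma truncX_power_le n : (0 < n)%N -> Y n <= (K * a n) `^ s * Q n.
Proof.
move=> n0; rewrite /Y /Q mulr_sumr big_nat_cond [X in _ <= X]big_nat_cond.
apply: ler_sum => k; rewrite andbT ltnS => /andP[_ kn].
have iZ := truncX_intg k; rewrite -ExZ //; apply: Ex_le; [exact: truncX_powR_intg|exact: intgZ|move=> w].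
have s0 := s_gt0; rewrite powRDS ?truncX_ge0 ?(ltW s0) // mulrC ler_wpM2r ?truncX_ge0 //.
by apply: ge0_ler_powR; rewrite ?nnegrE ?truncX_ge0 ?truncX_le ?(ltW (b0 _)) ?(ltW s0).
Qed.

Lemma truncX_power_ge n A : (0 < n)%N -> 0 < A ->
  (K * a n) `^ s * (expR (- (s * A)) * (Q n - L n / A)) <= Y n.
Proof.
move=> n0 A0; rewrite -/(b n) /Q /L mulr_suml -sumrB !mulr_sumr /Y.
rewrite big_nat_cond [X in _ <= X]big_nat_cond.
apply: ler_sum => k; rewrite andbT ltnS => /andP[_ kn].
have iZ := truncX_intg k; have iZl := truncX_log_intg kn.
set c := b n `^ s; set c' := expR _.
have iB : intg (fun w => truncX k w - A^-1 * (truncX k w * (ln (b n) - ln (truncX k w)))).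
  by apply: intgB => //; exact: intgZ.
apply: (@le_trans _ _ (Ex (fun w => c * (c' * (truncX k w - A^-1 * (truncX k w * (ln (b n) - ln (truncX k w)))))))).
  rewrite ExZ; last exact: intgZ.
  rewrite ExZ // ExB //; last exact: intgZ.
  by rewrite ExZ // mulrC (mulrC A^-1) mulrC.
apply: Ex_le; [by do 2 apply: intgZ|exact: truncX_powR_intg|move=> w].
by rewrite (mulrC A^-1); apply: trunc_power_lower => //; rewrite truncX_ge0 truncX_le.
Qed.

Local Notation lam := (Ex (fun w => xi w * ln (xi w))).
Hypothesis lam_intg : intg (fun w => xi w * ln (xi w)).

(** [trunc_log_le] averaged over the parent. Measuring all steps against [b n.+1] instead of [b n]
    adds [ln (1 + m / n)] to each logarithm, which is the origin of the term in [Q n]. *)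
Lemma truncX_log_step n : (0 < n)%N ->
  L n.+1 <= (1 + m / n%:R) * (L n + Q n * ln (1 + m / n%:R)) - lam / n%:R * Q n
    + m1s / n%:R * (s^-1 * ((K * a n.+1) `^ s)^-1 * Y n).
Proof.
move=> n0; have s0 := s_gt0; have N0 : 0 < n%:R :> R by rewrite ltr0n.
have kk : 0 < 1 + m / n%:R by rewrite addr_gt0 // divr_gt0.
pose Zl k w := truncX k w * (ln (b n.+1) - ln (truncX k w)).
have sZl k : (1 <= k <= n)%N -> sigma_fun (F n) (Zl k).
  by move=> /andP[_ kn]; apply: measurable_zlnc; exact: sigma_truncX.
have iZl k : (1 <= k <= n)%N -> intg (Zl k).
  by move=> /andP[_ kn]; apply: truncX_log_intg; exact: leqW.
have sZ k : (1 <= k <= n)%N -> sigma_fun (F n) (truncX k).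
  by move=> /andP[_ kn]; exact: sigma_truncX.
have sZs k : (1 <= k <= n)%N -> sigma_fun (F n) (fun w => truncX k w `^ (1 + s)).
  by move=> /andP[_ kn]; apply: measurable_powRc; exact: sigma_truncX.
have [i1 e1] := @Ex_parent _ _ _ P xi x u F EM n Zl id n0 sZl iZl
  (@measurable_id _ _ _) xi_intg.
have mlx : measurable_fun setT (fun y : R => y * ln y).
  by apply: measurable_funM => //; exact: measurable_ln.
have [i2 e2] := @Ex_parent _ _ _ P xi x u F EM n truncX (fun y => y * ln y) n0 sZ
  (fun k _ => truncX_intg k) mlx lam_intg.
have [i3 e3] := @Ex_parent _ _ _ P xi x u F EM n (fun k w => truncX k w `^ (1 + s))
  (fun y => y `^ (1 + s)) n0 sZs (fun k _ => truncX_powR_intg k) (measurable_powR (1 + s)) xis_intg.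
set c := s^-1 * ((K * a n.+1) `^ s)^-1.
have pw w : Zl n.+1 w <= parent u (fun k w => id (x n.+1 w) * Zl k w) n w -
    parent u (fun k w => (x n.+1 w * ln (x n.+1 w)) * truncX k w) n w +
    c * parent u (fun k w => x n.+1 w `^ (1 + s) * truncX k w `^ (1 + s)) n w.
  rewrite /Zl truncXS // /W !parentE; case: ifP => [/andP[_ un]|_].
    apply: trunc_log_le => //; [exact: (em_x_ge0 EM)| |exact: b0].
    by rewrite truncX_ge0 truncX_le //; exact: leqW.
  by rewrite trunc0 mul0r subrr mulr0 addr0.
have iZn : intg (Zl n.+1) by exact: truncX_log_intg.
have h := Ex_le iZn (intgD (intgB i1 i2) (intgZ c i3)) pw.
rewrite ExD ?ExB ?ExZ // in h; [|exact: intgB|exact: intgZ].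
rewrite e1 e2 e3 in h.
have sumZl : \sum_(1 <= k < n.+1) Ex (Zl k) = L n + Q n * ln (1 + m / n%:R).
  rewrite /L /Q mulr_suml -big_split /=; apply: eq_big_nat => k.
  rewrite ltnS => /andP[_ kn].
  have iZ := truncX_intg k; have iZk := truncX_log_intg kn.
  rewrite mulrC -ExZ // -ExD //; last exact: intgZ.
  apply: eq_Rintegral => w _; rewrite /Zl.
  have := truncX_ge0 k w; rewrite le_eqVlt => /predU1P[<-|z0].
    by rewrite !mul0r mulr0 addr0.
  rewrite (mulrC (ln _)) -mulrDr; congr (_ * _).
  rewrite /b echo_normS // mulrA (@lnM _ (K * a n)) ?posrE //; last exact: b0.
  by ring.
rewrite /L big_nat_recr //= -/(L n) sumZl.
have h' : Ex (Zl n.+1) <= m / n%:R * (L n + Q n * ln (1 + m / n%:R)) -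
    lam / n%:R * Q n + c * (m1s / n%:R * Y n) by rewrite -sumZl; exact: h.
rewrite -[X in _ + X <= _]/(Ex (Zl n.+1)) -/(b n.+1) -/c.
clear pw h; clearbody c; move: h'; set A2 := Ex (Zl n.+1); clearbody A2.
set A4 := lam / n%:R; clearbody A4; set A5 := m1s / n%:R; clearbody A5.
set A1 := L n + _; clearbody A1; set A3 := m / n%:R; clearbody A3.
move: (Q n) (Y n) => q' y'; lra.
Qed.

Variable B : R.
Hypothesis B_gt0 : 0 < B.
Hypothesis mB_gt :
  (1 + s) * m < Ex (fun w => (xi w * ((xi w <= B)%R)%:R) `^ (1 + s)).
Hypothesis lam_ge : m <= lam.

Lemma truncX_mean_cvg0 : Q n / a n @[n --> \oo] --> 0.
Proof.
have m1s0 : 0 <= m1s by apply: Ex_ge0 => w; exact: powR_ge0.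
exact: (@critical_cvg0 _ _ s K B _ m1s lam Q Y L xi_mean_gt0 s_gt0 K0 B_gt0 mB_gt m1s0 lam_ge
  (fun n _ => truncX_mass_ge0 n) (fun n _ => truncX_power_ge0 n) truncX_mass_step truncX_mass1
  (truncX_power_step B_gt0) truncX_power_le truncX_log_step truncX_power_ge).
Qed.

Lemma truncX_eq w : (forall j, X j w <= b j) -> forall n, truncX n w = X n w.
Proof.
move=> Xb; elim/ltn_ind => n IH; case: n IH => [|[|n]] IH //.
rewrite truncXS //; have -> : W n.+1 w = X n.+2 w.
  rewrite echoXS // /W !parentE; case: ifP => // /andP[_ un].
  by rewrite IH.
by rewrite /trunc Xb mulr1.
Qed.

Let h n w := (\sum_(1 <= k < n.+2) truncX k w) / a n.+1.

(** Fatou's lemma applied to means that tend to 0. A lower limit is enough: on a path where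
    truncation never acts and [echoM] converges, it is the limit of [echoM]. *)
Lemma truncX_liminf0 : {ae P, forall w, limn_einf (fun n => (h n w)%:E) = 0%E}.
Proof.
have mh n : measurable_fun setT (fun w => (h n w)%:E).
  apply/measurable_EFinP; apply: measurable_funM => //.
  by apply: measurable_sum => k; exact: truncX_meas.
have h0 n w : setT w -> (0 <= (h n w)%:E)%E.
  move=> _; rewrite lee_fin divr_ge0 ?(ltW (an _)) //.
  by apply: sumr_ge0 => k _; exact: truncX_ge0.
have fat := fatou P measurableT mh h0.
have E n : (\int[P]_w (h n w)%:E = (Q n.+1 / a n.+1)%:E)%E.
  have i : intg (fun w => \sum_(1 <= k < n.+2) truncX k w).
    by apply: intg_sum => k; exact: truncX_intg.
  have i' : intg (h n).
    rewrite (_ : h n = (fun w => (a n.+1)^-1 * \sum_(1 <= k < n.+2) truncX k w)).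
      exact: intgZ.
    by apply/funext => w; rewrite /h mulrC.
  rewrite -EFin_Ex //; congr EFin.
  have -> : h n = (fun w => (a n.+1)^-1 * \sum_(1 <= k < n.+2) truncX k w).
    by apply/funext => w; rewrite /h mulrC.
  rewrite mulrC; move: (a n.+1)^-1 => c; rewrite ExZ //; congr (_ * _).
  by apply: Ex_sum => k; exact: truncX_intg.
have cE : (fun n => \int[P]_w (h n w)%:E)%E @ \oo --> 0%E.
  under eq_fun do rewrite E.
  apply: cvg_EFin; first exact: nearW.
  have := truncX_mean_cvg0; rewrite -(cvg_shiftS (fun n => Q n / a n)); exact.
rewrite (cvg_limn_einf_sup cE) in fat.
have l0 w : (0 <= limn_einf (fun n => (h n w)%:E))%E.
  rewrite limn_einf_lim; apply: lime_ge; first exact: is_cvg_einfs.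
  by apply: nearW => n; apply: le_ereal_inf_tmp => _ [k _ <-]; exact: h0.
have ml : measurable_fun setT (fun w => limn_einf (fun n => (h n w)%:E)).
  rewrite /limn_einf; apply: measurableT_comp => //.
  by apply: measurable_fun_limn_esup => n; exact: measurableT_comp.
have := ae_eq_integral_abs P measurableT ml => -[+ _].
have -> : (\int[P]_(x0 in setT) `|limn_einf (fun n => (h n x0)%:E)|)%E = 0%E.
  apply/eqP; rewrite eq_le; apply/andP; split; last exact: integral_ge0.
  by under eq_integral do rewrite gee0_abs //.
by move=> /(_ erefl); apply: filterS => w; apply.
Qed.

End Critical.

(** * Moments of the echo law near order 1, and the vanishing limit *)

Section CriticalLimit.
Context {R : realType} d {T : measurableType d} (P : probability T R).
Local Notation intg f := (P.-integrable setT (EFin \o f)).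
Local Notation Ex f := (\int[P]_w f w)%R.

Lemma ae_Ex (f g : T -> R) : measurable_fun setT f -> measurable_fun setT g ->
  {ae P, forall w, f w = g w} -> Ex f = Ex g.
Proof.
move=> mf mg fg; rewrite /Rintegral; congr fine.
by apply: ae_eq_integral => //; [exact/measurable_EFinP..|apply: filterS fg => w -> _].
Qed.

Lemma Ex_eq0_ae (f : T -> R) : intg f -> (forall w, 0 <= f w) -> Ex f = 0 ->
  {ae P, forall w, f w = 0}.
Proof.
move=> fi f0 E; have [+ _] := ae_eq_integral_abs P measurableT (measurable_int _ fi).
have -> : (\int[P]_(w in setT) `|(EFin \o f) w| = 0)%E.
  rewrite -[RHS]/(0%R%:E) -E EFin_Ex //.
  by apply: eq_integral => w _; rewrite gee0_abs ?lee_fin.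
by move=> /(_ erefl); apply: filterS => w /(_ I) [].
Qed.

Lemma Ex_dominated_cvg (f : nat -> T -> R) (g h : T -> R) :
  (forall n, measurable_fun setT (f n)) -> (forall w, f n w @[n --> \oo] --> g w) ->
  (forall n w, `|f n w| <= h w) -> intg h ->
  intg g /\ Ex (f n) @[n --> \oo] --> Ex g.
Proof.
move=> mf fg fh ih.
have mg : measurable_fun setT g by apply: (@measurable_fun_cvg _ _ _ _ f) => // w _; exact: fg.
have cw w : (f n w)%:E @[n --> \oo] --> (g w)%:E by apply: cvg_EFin; [exact: nearW|exact: fg].
have le n w : (`|(f n w)%:E| <= (h w)%:E)%E by rewrite lee_fin.
have [ig _ c] := dominated_convergence measurableT
  (fun n => (measurable_EFinP _ _).2 (mf n)) ((measurable_EFinP _ _).2 mg)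
  (aeW P (fun w _ => cw w)) ih (aeW P (fun w n _ => le n w)).
split=> //.
by rewrite -EFin_Ex // in c; exact: fine_cvg c.
Qed.

Lemma truncated_moment_gt (xi : T -> R) (p c : R) : 0 < p -> measurable_fun setT xi ->
  (forall w, 0 <= xi w) -> intg (fun w => xi w `^ p) -> c < Ex (fun w => xi w `^ p) ->
  exists2 B, 0 < B & c < Ex (fun w => (xi w * ((xi w <= B)%R)%:R) `^ p).
Proof.
move=> p0 mxi xi0 ip cp.
pose f n w := (xi w * ((xi w <= n.+1%:R)%R)%:R) `^ p.
have mf n : measurable_fun setT (f n).
  apply: measurable_powRc; apply: measurable_funM => //; apply: measurable_natr_bool.
  exact: measurable_fun_ler.
have fle n w : 0 <= f n w <= xi w `^ p.
  rewrite powR_ge0 /=; apply: ge0_ler_powR; rewrite ?nnegrE ?mulr_ge0 ?(ltW p0) //.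
  by apply: ler_piMr => //; rewrite lern1 leq_b1.
have fcvg w : f n w @[n --> \oo] --> xi w `^ p.
  apply: (@cvg_trans _ ((xi w `^ p) @[n --> \oo])); last exact: cvg_cst.
  apply: near_eq_cvg; near=> n; rewrite /f (_ : xi w <= n.+1%:R) ?mulr1 //.
  near: n; exists (Num.truncn (xi w)) => // n /= tn.
  by apply: le_trans (ltW (truncnS_gt _)) _; rewrite ler_nat ltnS.
have fn n w : `|f n w| <= xi w `^ p by have /andP[f0 ?] := fle n w; rewrite ger0_norm.
have [_ cE] := Ex_dominated_cvg mf fcvg fn ip.
have := cvgr_gt _ cE _ cp => -[N _ /(_ N (leqnn N)) hN].
by exists N.+1%:R.
Unshelve. all: end_near. Qed.

(** The difference quotients at [e / n.+1] converge in mean to the derivative of the moment at order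
    1. Their domination by [norm_powR_incr_ratio_le] is the reason for a moment of order
    [1 + 2 e]. *)
Lemma subcritical_exponent (xi : T -> R) (e : R) : 0 < e -> measurable_fun setT xi ->
  (forall w, 0 <= xi w) -> intg xi -> intg (fun w => xi w `^ (1 + (e + e))) ->
  Ex (fun w => xi w * ln (xi w)) < Ex xi ->
  exists s, [/\ 0 < s, intg (fun w => xi w `^ (1 + s)) &
    Ex (fun w => xi w `^ (1 + s)) < (1 + s) * Ex xi].
Proof.
move=> e0 mxi xi0 ix ie lam.
pose s (n : nat) := e / n.+1%:R.
have s0 n : 0 < s n by rewrite divr_gt0.
have se n : s n <= e by rewrite ler_pdivrMr // ler_peMr ?(ltW e0) // ler1n.
pose f n w := (xi w `^ (1 + s n) - xi w) / s n.
have mf n : measurable_fun setT (f n).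
  by apply: measurable_funM => //; apply: measurable_funB => //; exact: measurable_powRc.
have fh n w : `|f n w| <= 1 + xi w `^ (1 + (e + e)) / e.
  by apply: norm_powR_incr_ratio_le => //; rewrite s0 se.
have ih : intg (fun w => 1 + xi w `^ (1 + (e + e)) / e).
  apply: intgD; first exact: intg_cst.
  rewrite (_ : (fun w => _) = (fun w => e^-1 * xi w `^ (1 + (e + e)))); first exact: intgZ.
  by apply/funext => w; rewrite mulrC.
have scvg : s n @[n --> \oo] --> 0.
  rewrite -(mulr0 e); apply: cvgM; [exact: cvg_cst|exact: cvg_harmonic].
have fcvg w : f n w @[n --> \oo] --> xi w * ln (xi w).
  have := xi0 w; rewrite le_eqVlt => /predU1P[x0|x0].
    rewrite -x0 mul0r (_ : f^~ w = cst 0); first exact: cvg_cst.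
    apply/funext => n; rewrite /f -x0 powR0 ?subrr ?mul0r // gt_eqF //.
    by have := s0 n; lra.
  apply: (@squeeze_cvgr _ _ _ _ (cst (xi w * ln (xi w)))
    (fun n => xi w * ln (xi w) * xi w `^ s n)).
  - by apply: nearW => n; apply: powR_incr_ratio_bounds.
  - exact: cvg_cst.
  - rewrite -[X in _ --> X]mulr1; apply: cvgM; first exact: cvg_cst.
    rewrite (_ : (fun n => xi w `^ s n) = (fun n => expR (s n * ln (xi w)))); last first.
      by apply/funext => n; rewrite powRE.
    rewrite -expR0; apply: (@continuous_cvg _ _ _ _ _ _ expR); first exact: continuous_expR.
    rewrite -(mul0r (ln (xi w))); apply: cvgM => //; exact: cvg_cst.
have [_ cE] := Ex_dominated_cvg mf fcvg fh ih.
have := cvgr_lt _ cE _ lam => -[N _ /(_ N (leqnn N)) hN].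
exists (s N).
have iN : intg (fun w => xi w `^ (1 + s N)).
  rewrite (_ : (fun w => _) = (fun w => xi w + s N * f N w)); last first.
    by apply/funext => w; rewrite /f (mulrC (s N)) divfK ?gt_eqF // [RHS]addrC subrK.
  apply: intgD => //; apply: intgZ; exact: intg_le (fh N) ih.
split=> //; move: hN => /=.
rewrite (_ : f N = (fun w => (s N)^-1 * (xi w `^ (1 + s N) - xi w))); last first.
  by apply/funext => w; rewrite mulrC.
rewrite ExZ ?ExB //; last exact: intgB.
by rewrite mulrC ltr_pdivrMr // mulrDl mul1r mulrC ltrBlDl.
Qed.

(** [powR1D_ge] gives the weak inequality. Equality would force [xi * ln xi = 0] almost surely by
    [powR1D_gt], against [0 < Ex xi <= Ex (xi * ln xi)]. *)
Lemma power_moment_gt (xi : T -> R) (s : R) : 0 < s -> measurable_fun setT xi ->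
  (forall w, 0 <= xi w) -> intg xi -> intg (fun w => xi w * ln (xi w)) ->
  intg (fun w => xi w `^ (1 + s)) -> 0 < Ex xi ->
  Ex xi <= Ex (fun w => xi w * ln (xi w)) ->
  (1 + s) * Ex xi < Ex (fun w => xi w `^ (1 + s)).
Proof.
move=> s0 mxi xi0 ix il ip m0 lam.
have is' : intg (fun w => xi w + s * (xi w * ln (xi w))) by apply: intgD => //; exact: intgZ.
have ExE : Ex (fun w => xi w + s * (xi w * ln (xi w))) =
    Ex xi + s * Ex (fun w => xi w * ln (xi w)) by rewrite ExD ?ExZ //; exact: intgZ.
have h1 : Ex (fun w => xi w + s * (xi w * ln (xi w))) <= Ex (fun w => xi w `^ (1 + s)).
  by apply: Ex_le => // w; apply: powR1D_ge => //; exact: ltW.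
rewrite lt_neqAle; apply/andP; split; last first.
  apply: le_trans h1; rewrite ExE; have := ler_wpM2l (ltW s0) lam.
  by move: (Ex xi) (Ex _) => A1 A2; lra.
apply/negP => /eqP E.
have iD := intgB ip is'.
have D0 : Ex (fun w => xi w `^ (1 + s) - (xi w + s * (xi w * ln (xi w)))) = 0.
  apply/eqP; rewrite eq_le; apply/andP; split; last first.
    by apply: Ex_ge0 => w; rewrite subr_ge0; apply: powR1D_ge => //; exact: ltW.
  rewrite ExB // -E ExE; have := ler_wpM2l (ltW s0) lam.
  by move: (Ex xi) (Ex _) => A1 A2; lra.
have D0w w : 0 <= xi w `^ (1 + s) - (xi w + s * (xi w * ln (xi w))).
  by rewrite subr_ge0; apply: powR1D_ge => //; exact: ltW.
have ae0 : {ae P, forall w, xi w * ln (xi w) = 0}.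
  apply: filterS (Ex_eq0_ae iD D0w D0) => w /eqP.
  rewrite subr_eq0 => /eqP e; have := xi0 w; rewrite le_eqVlt => /predU1P[<-|x0].
    by rewrite mul0r.
  have [->|x1] := eqVneq (xi w) 1; first by rewrite ln1 mulr0.
  by have := powR1D_gt x0 s0 x1; rewrite e ltxx.
have l0 : Ex (fun w => xi w * ln (xi w)) = 0.
  by rewrite (ae_Ex _ _ ae0) ?Ex_cst //; exact: (intg_meas il).
by rewrite l0 leNgt m0 in lam.
Qed.

Variables (xi : T -> R) (x : nat -> T -> R) (u : nat -> T -> nat) (F : nat -> set (set T)).
Hypothesis EM : echo_model P xi x u F.
Hypothesis xi_intg : intg xi.
Hypothesis xi_mean_gt0 : 0 < Ex xi.

(** The truncation constant runs over the positive integers, so that one null set serves all of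
    them. A convergent path of [echoM] is bounded, hence coincides with its truncation for one of
    these constants. *)
Lemma critical_limit0 (s : R) (L : T -> R) : 0 < s -> intg (fun w => xi w `^ (1 + s)) ->
  intg (fun w => xi w * ln (xi w)) -> Ex xi <= Ex (fun w => xi w * ln (xi w)) ->
  {ae P, forall w, echoM P xi x u n w @[n --> \oo] --> L w} ->
  {ae P, forall w, L w = 0}.
Proof.
move=> s0 ip il lam cL.
have mp := power_moment_gt s0 (em_xi_meas EM) (em_xi_ge0 EM) xi_intg il ip xi_mean_gt0 lam.
have s1 : 0 < 1 + s by lra.
have [B B0 hB] := truncated_moment_gt s1 (em_xi_meas EM) (em_xi_ge0 EM) ip mp.
have K1 k : 1 <= k.+1%:R :> R by rewrite ler1n.
have /ae_foralln := fun k => truncX_liminf0 EM xi_intg xi_mean_gt0 s0 (K1 k) ip il B0 hB lam.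
apply: filterS2 cL => w cw hk.
have [C [_ hC]] := cvg_seq_bounded (cvgP _ cw).
have {}hC n : echoM P xi x u n w <= C + 1.
  by have := hC (C + 1) ltac:(by rewrite ltrDl) n I; exact: le_trans (ler_norm _).
have Xb j : echoX x u j w <= (Num.truncn (C + 1)).+1%:R * echo_norm (Ex xi) j.
  have aj i := echo_norm_mean_gt0 xi_mean_gt0 i.
  case: j => [|j]; first by rewrite mulr_ge0 // ltW.
  apply: (le_trans (echoX_le_echoS EM w (leqnn j.+1 : 1 <= j.+1 <= j.+1)%N)).
  rewrite -ler_pdivrMr //; apply: (le_trans (hC j)); exact: ltW (truncnS_gt _).
have := hk (Num.truncn (C + 1)); under eq_fun => n.
  rewrite (eq_bigr (fun k => echoX x u k w)); last first.
    by move=> k _; apply: truncX_eq => //; exact: ler1n.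
  over.
have cE : (echoM P xi x u n w)%:E @[n --> \oo] --> (L w)%:E by apply: cvg_EFin => //; exact: nearW.
rewrite -[X in limn_einf X]/(fun n => (echoM P xi x u n w)%:E).
by rewrite (cvg_limn_einf_sup cE) => -[].
Qed.

End CriticalLimit.

(** * The subcritical limit: moments, mean and non-degeneracy *)

Section Subcritical.
Context {R : realType} d {T : measurableType d} (P : probability T R).
Local Notation intg f := (P.-integrable setT (EFin \o f)).
Local Notation Ex f := (\int[P]_w f w)%R.
Variables (xi : T -> R) (x : nat -> T -> R) (u : nat -> T -> nat) (F : nat -> set (set T)).
Hypothesis EM : echo_model P xi x u F.
Hypothesis xi_intg : intg xi.
Hypothesis xi_mean_gt0 : 0 < Ex xi.
Local Notation m := (Ex xi).
Local Notation a := (echo_norm m).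
Local Notation X := (echoX x u).
Local Notation S := (echoS x u).
Local Notation M := (echoM P xi x u).

(** When the parent is vertex 1, whose step is 1, the new step equals [x n.+1]. This has probability
    [1 / n] independently of [x n.+1], so the product rule for the distance to [c] transfers the
    constancy to [xi]. *)
Lemma echoX_const n (c : R) : (0 < n)%N -> {ae P, forall w, X n.+1 w = c} ->
  {ae P, forall w, xi w = c}.
Proof.
move=> n0 Xc.
pose g : R -> R := fun y => `|y - c|.
have mg : measurable_fun setT g.
  by apply: measurableT_comp => //; exact: measurable_funB.
have ig : intg (g \o xi).
  by apply: integrable_norm; apply: (@intgB _ _ _ P xi (fun=> c)) => //; exact: intg_cst.
have s1 : sigma_fun (F n) (fun=> 1 : R) by exact: measurable_cst.
have [i e] := em_rule EM (n0 : 1 <= 1 <= n)%N s1 (intg_cst P 1) mg ig.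
have E0 : Ex (fun w => 1 * (u n.+1 w == 1%N)%:R * g (x n.+1 w)) = 0.
  rewrite -(Ex_cst P 0); apply: ae_Ex => //; first exact: (intg_meas i).
  apply: filterS Xc => w Xw; rewrite mul1r; case: eqP => [u1|_]; last by rewrite mul0r.
  by rewrite /g -Xw echoXS // parentE u1 n0 /= {1}/echoX fstep1 mulr1 subrr normr0 mulr0.
rewrite E0 Ex_cst mul1r in e.
have g0 : Ex (g \o xi) = 0.
  move/esym/eqP : e; by rewrite mulf_eq0 invr_eq0 pnatr_eq0 eqn0Ngt n0 orbF => /eqP.
apply: filterS (Ex_eq0_ae ig (fun w => normr_ge0 _) g0) => w /eqP.
by rewrite normr_eq0 subr_eq0 => /eqP.
Qed.

Variables (p : R) (L : T -> R).
Hypothesis p_gt1 : 1 < p.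
Hypothesis xip_intg : intg (fun w => xi w `^ p).
Hypothesis xip_lt : Ex (fun w => xi w `^ p) < p * m.
Hypothesis L_meas : measurable_fun setT L.
Hypothesis L_cvg : {ae P, forall w, M n w @[n --> \oo] --> L w}.

Let F_meas n : F n.+1 `<=` measurable.
Proof. exact: (em_F_meas EM). Qed.
Let M_adapted n k : (k <= n)%N -> sigma_fun (F n.+1) (M k).
Proof. exact: (echoM_adapted EM). Qed.
Let M_ge0 := echoM_ge0 EM xi_mean_gt0.
Let M0_intg := echoM0_intg P xi x u.
Let M_step := echoM_step EM xi_intg xi_mean_gt0.
Let Mp_intg := echoM_powR_intg EM xi_mean_gt0 p_gt1 xip_intg.

Lemma echoM_limit_bounded (H : T -> R) (c : R) : measurable_fun setT H ->
  (forall w, `|H w| <= c) -> intg (fun w => H w * L w) /\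
  Ex (fun w => H w * M n w) @[n --> \oo] --> Ex (fun w => H w * L w).
Proof.
have [K hK] := echoM_powR_bounded EM xi_intg xi_mean_gt0 p_gt1 xip_intg xip_lt.
exact: (@limit_bounded_cvg _ _ _ P (fun n => F n.+1) M F_meas M_adapted M_ge0 M_step p K p_gt1 Mp_intg hK L L_meas L_cvg).
Qed.

Lemma echoM_limit_Lp : intg (fun w => `|L w| `^ p) /\
  (\int[P]_w (`|M n w - L w| `^ p)%:E @[n --> \oo] --> 0)%E.
Proof.
have [K hK] := echoM_powR_bounded EM xi_intg xi_mean_gt0 p_gt1 xip_intg xip_lt.
split.
  exact: (@limit_powR_intg _ _ _ P (fun n => F n.+1) M F_meas M_adapted M_ge0 M_step p K p_gt1 Mp_intg hK L L_meas L_cvg).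
exact: (@limit_Lp_cvg _ _ _ P (fun n => F n.+1) M F_meas M_adapted M_ge0 M_step p K p_gt1 Mp_intg hK L L_meas L_cvg).
Qed.

(** In other words [M n = E(L | F_{n+1})]: the expectation of [H] times [M k] does not change for
    [k >= n], and it converges to the one with [L]. *)
Lemma echoM_limit_eq n (H : T -> R) (c : R) : sigma_fun (F n.+1) H ->
  (forall w, `|H w| <= c) -> intg (fun w => H w * M n w) /\
  Ex (fun w => H w * L w) = Ex (fun w => H w * M n w).
Proof.
move=> sH Hc; have mH := sigma_fun_measurable (F_meas (n:=n)) sH.
have [iM _] := martingale_intg M0_intg M_step n.
have iHM : intg (fun w => H w * M n w).
  apply: (@intg_le _ _ _ _ _ (fun w => c * M n w)); [|move=> w|exact: intgZ].
    by apply: measurable_funM => //; exact: (echoM_meas EM).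
  by rewrite normrM (ger0_norm (M_ge0 _ _)) ler_wpM2r // M_ge0.
split=> //; have step k : intg (fun w => H w * M (k + n)%N w) /\
    Ex (fun w => H w * M (k + n)%N w) = Ex (fun w => H w * M n w).
  elim: k => // k [ik ek]; rewrite addSn.
  have sH' : sigma_fun (F (k + n).+1) H by apply: (sigma_fun_le EM) sH; rewrite ltnS leq_addl.
  by have [i e] := M_step sH' ik; split=> //; rewrite e.
have [_ cv] := echoM_limit_bounded mH Hc.
have cst_cv : Ex (fun w => H w * M k w) @[k --> \oo] --> Ex (fun w => H w * M n w).
  rewrite -(cvg_shiftn n) /= (_ : (fun k => _) = cst (Ex (fun w => H w * M n w))).
    exact: cvg_cst.
  by apply/funext => k; have [_ ->] := step k.
exact: (cvg_unique _ cv cst_cv).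
Qed.

Lemma echoM_limit_mean : intg L /\ Ex L = 1.
Proof.
have H1 (w : T) : `|1 : R| <= 1 by rewrite normr1.
have [iL _] := echoM_limit_bounded (measurable_cst (1 : R)) H1.
have [_ e] := @echoM_limit_eq 0 (fun=> 1) 1 (measurable_cst _) H1.
have E (f : T -> R) : (fun w => 1 * f w) = f by apply/funext => w; rewrite mul1r.
rewrite !E in iL e; split=> //; rewrite e.
by rewrite (_ : M 0 = fun=> 1) ?Ex_cst //; apply/funext => w; exact: echoM0.
Qed.

(** The mean forces the constant to be 1. Testing with the sign [H] of [M n - 1] then makes the mean
    of the absolute value of [M n - 1] equal to [Ex (H * L) - Ex H = 0]. *)
Lemma echoM_const (c : R) n : {ae P, forall w, L w = c} -> {ae P, forall w, M n w = 1}.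
Proof.
move=> Lc; have [iL EL] := echoM_limit_mean.
have c1 : c = 1 by rewrite -EL (ae_Ex L_meas _ Lc) ?Ex_cst.
rewrite {}c1 in Lc; have [iM EM1] := martingale_intg M0_intg M_step n.
pose H w := Num.sg (M n w - 1).
have sH : sigma_fun (F n.+1) H.
  pose b := fun (y : R) => Num.sg (y - 1).
  have mb : measurable_fun setT b.
    rewrite (_ : b = fun y => ((1 < y)%R)%:R - ((y < 1)%R)%:R).
      by apply: measurable_funB; apply: measurable_natr_bool; exact: measurable_fun_ltr.
    apply/funext => y; rewrite /b; have [y1|y1|->] := ltgtP y 1.
    - by rewrite sub0r ltr0_sg // subr_lt0.
    - by rewrite subr0 gtr0_sg // subr_gt0.
    - by rewrite !subrr sgr0.
  by apply: (measurableT_comp mb); exact: M_adapted.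
have Hc w : `|H w| <= 1 by rewrite /H normr_sg lern1 leq_b1.
have [i e] := echoM_limit_eq sH Hc.
have mH := sigma_fun_measurable (F_meas (n:=n)) sH.
have iH : intg H by apply: intg_le Hc (intg_cst P 1).
have E1 : Ex (fun w => H w * L w) = Ex H.
  apply: ae_Ex => //; first exact: measurable_funM.
  by apply: filterS Lc => w ->; rewrite mulr1.
have NE : (fun w => `|M n w - 1|) = (fun w => H w * M n w - H w).
  by apply/funext => w; rewrite normrEsg /H mulrBr mulr1.
have iN : intg (fun w => `|M n w - 1|) by rewrite NE; exact: intgB.
have N0 : Ex (fun w => `|M n w - 1|) = 0 by rewrite NE ExB // -e E1 subrr.
apply: filterS (Ex_eq0_ae iN (fun w => normr_ge0 _) N0) => w /eqP.
by rewrite normr_eq0 subr_eq0 => /eqP.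
Qed.

(** The steps 2 and 3 are the constants [m] and [(1 + m) * m / 2], and by [echoX_const] both are
    almost sure values of [xi]. Since [m > 0], equating the second with the mean gives [m = 1]. *)
Lemma xi_eq1_of_const_limit (c : R) : {ae P, forall w, L w = c} -> {ae P, forall w, xi w = 1}.
Proof.
move=> Lc; have m0 := xi_mean_gt0.
have Sa n : {ae P, forall w, S n.+1 w = a n.+1}.
  apply: filterS (echoM_const n Lc) => w /(congr1 (fun y => y * a n.+1)).
  by rewrite /echoM divfK ?mul1r // gt_eqF // echo_norm_mean_gt0.
have Xa n : {ae P, forall w, X n.+2 w = a n.+2 - a n.+1}.
  by apply: filterS2 (Sa n.+1) (Sa n) => w e1 e2; rewrite -e1 -e2 echoSS addrAC subrr add0r.
have x2 := echoX_const (isT : 0 < 1)%N (Xa 0%N).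
have x3 := echoX_const (isT : 0 < 2)%N (Xa 1%N).
have a1 : a 1 = 1 by exact: echo_norm1.
have a2 : a 2 = 1 + m by rewrite echo_normS // a1 mul1r divr1.
have a3 : a 3 = (1 + m) * (1 + m / 2) by rewrite echo_normS // a2.
have mxi := em_xi_meas EM.
have := ae_Ex mxi (measurable_cst _) x3; rewrite Ex_cst a3 a2 => e.
have m1 : m = 1.
  have : m * (m - 1) = 0 by move: e; move: (Ex xi) => y; lra.
  by move/eqP; rewrite mulf_eq0 gt_eqF //= subr_eq0 => /eqP.
by apply: filterS x2 => w ->; rewrite a2 a1 addrAC subrr add0r.
Qed.

End Subcritical.

(** * Almost sure modifications and convergence in [L^p] norm *)

Section AlmostEverywhere.
Context {R : realType} d {T : measurableType d} (P : probability T R).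
Local Notation intg f := (P.-integrable setT (EFin \o f)).
Local Notation Ex f := (\int[P]_w f w)%R.

Lemma ae_intg (f g : T -> R) : measurable_fun setT g -> {ae P, forall w, f w = g w} ->
  intg f -> intg g.
Proof.
move=> mg fg fi; have mf := measurable_int _ fi.
apply/integrableP; split; first exact/measurable_EFinP.
have /integrableP[_] := fi; rewrite (@ae_eq_integral _ _ _ P _ (abse \o (EFin \o g))) //.
- exact: measurableT_comp.
- by apply: measurableT_comp => //; exact/measurable_EFinP.
- by apply: filterS fg => w /= -> _.
Qed.

Lemma ae_prob1 (A : set T) : measurable A -> {ae P, forall w, A w} -> P A = 1%E.
Proof.
move=> mA [N [mN PN AN]].
have : P (~` A) = 0%E.
  by apply: (subset_measure0 _ mN _ PN) => //; exact: measurableC.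
by move=> h; rewrite -(setCK A) probability_setC ?h ?sube0 //; exact: measurableC.
Qed.

Lemma prob1_ae (A : set T) : measurable A -> P A = 1%E -> {ae P, forall w, A w}.
Proof.
move=> mA PA; exists (~` A); split; [exact: measurableC| |by []].
by rewrite probability_setC // PA subee.
Qed.

Lemma powR_cvg0 (v : nat -> R) (p : R) : 0 < p -> (forall n, 0 <= v n) ->
  v n @[n --> \oo] --> 0 -> v n `^ p @[n --> \oo] --> 0.
Proof.
move=> p0 v0 cv; apply/cvgrPdist_lt => e e0.
have e1 : 0 < e `^ p^-1 by exact: powR_gt0.
have /cvgrPdist_lt/(_ _ e1) := cv; apply: filterS => n.
rewrite !sub0r !normrN !ger0_norm ?powR_ge0 // => h.
have -> : e = (e `^ p^-1) `^ p by rewrite -powRrM mulVf ?powRr1 ?(ltW e0) // gt_eqF.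
by apply: gt0_ltr_powR; rewrite ?nnegrE ?powR_ge0.
Qed.

Lemma intg_Lfun (f : T -> R) (p : R) : measurable_fun setT f ->
  intg (fun w => `|f w| `^ p) -> f \in Lfun P p%:E.
Proof.
move=> mf fi; rewrite inE; apply/andP; split; rewrite inE //=.
rewrite /finite_norm unlock /=; apply: poweR_lty.
have /integrableP[_] := fi; under eq_integral do rewrite gee0_abs ?lee_fin ?powR_ge0 //.
by [].
Qed.

Lemma Lnorm_cvg0 (f : nat -> T -> R) (p : R) : 0 < p ->
  (forall n, intg (fun w => `|f n w| `^ p)) ->
  Ex (fun w => `|f n w| `^ p) @[n --> \oo] --> 0 ->
  Lnorm P p%:E (fun w => (f n w)%:E) @[n --> \oo] --> 0%E.
Proof.
move=> p0 fi cf.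
have -> : (fun n => Lnorm P p%:E (fun w => (f n w)%:E)) =
    (fun n => (Ex (fun w => `|f n w| `^ p) `^ p^-1)%:E).
  by apply/funext => n; rewrite unlock /= -poweR_EFin EFin_Ex.
apply: cvg_EFin; first exact: nearW.
apply: powR_cvg0 => //; first by rewrite invr_gt0.
by move=> n; apply: Ex_ge0 => w; exact: powR_ge0.
Qed.

End AlmostEverywhere.

(** * From the martingale to the walk divided by [n^m] *)

Section EchoLimit.
Context {R : realType} d {T : measurableType d} (P : probability T R).
Local Notation intg f := (P.-integrable setT (EFin \o f)).
Local Notation Ex f := (\int[P]_w f w)%R.
Variables (xi : T -> R) (x : nat -> T -> R) (u : nat -> T -> nat) (F : nat -> set (set T)).
Hypothesis EM : echo_model P xi x u F.
Hypothesis xi_intg : intg xi.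
Hypothesis xi_mean_gt0 : 0 < Ex xi.
Local Notation m := (Ex xi).
Local Notation a := (echo_norm m).
Local Notation S := (echoS x u).
Local Notation M := (echoM P xi x u).

(** An upper limit is defined at every point and measurable, with no choice of a limit on the
    exceptional set; [fine] sends infinite values to 0. *)
Definition echo_limit w : R := fine (limn_esup (fun n => (M n w)%:E)).

Lemma echo_limit_meas : measurable_fun setT echo_limit.
Proof.
apply: measurableT_comp => //; apply: measurable_fun_limn_esup => n.
by apply/measurable_EFinP; exact: (echoM_meas EM).
Qed.

Lemma echo_limit_cvg : {ae P, forall w, M n w @[n --> \oo] --> echo_limit w}.
Proof.
apply: filterS (echoM_cvg_ae EM xi_intg xi_mean_gt0) => w [l cl].
have cE : (M n w)%:E @[n --> \oo] --> l%:E by apply: cvg_EFin => //; exact: nearW.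
by rewrite /echo_limit (cvg_limn_einf_sup cE).
Qed.

(** Fatou's lemma with the constant mean of [M], so it covers the subcritical and the critical case
    alike. *)
Lemma echo_limit_intg : intg echo_limit.
Proof.
have mM n : measurable_fun setT (fun w => (M n w)%:E).
  by apply/measurable_EFinP; exact: (echoM_meas EM).
have M0 := echoM_ge0 EM xi_mean_gt0.
have M0' n w : setT w -> (0 <= (M n w)%:E)%E by rewrite lee_fin.
have fat := fatou P measurableT mM M0'.
have E n : (\int[P]_w (M n w)%:E = (Ex (M 0%N))%:E)%E.
  have [i e] := @martingale_intg _ _ _ P (fun n => F n.+1) M (echoM0_intg P xi x u)
    (echoM_step EM xi_intg xi_mean_gt0) n.
  by rewrite -EFin_Ex // e.
have {}fat : (\int[P]_w limn_einf (fun n => (M n w)%:E) <= (Ex (M 0%N))%:E)%E.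
  apply: (le_trans fat); under eq_fun do rewrite E.
  by rewrite is_cvg_limn_einfE; [rewrite lim_cst|exact: is_cvg_cst].
have mL := echo_limit_meas.
apply/integrableP; split; first exact/measurable_EFinP.
apply: le_lt_trans (ltry (Ex (M 0%N))); apply: le_trans fat.
rewrite le_eqVlt; apply/orP; left; apply/eqP; apply: ae_eq_integral => //.
- by apply: measurableT_comp => //; exact/measurable_EFinP.
- rewrite /limn_einf; apply: measurableT_comp => //.
  by apply: measurable_fun_limn_esup => n; exact: measurableT_comp.
- apply: filterS echo_limit_cvg => w cw _.
  have cE : (M n w)%:E @[n --> \oo] --> (echo_limit w)%:E.
    by apply: cvg_EFin => //; exact: nearW.
  rewrite (cvg_limn_einf_sup cE) /= ger0_norm //.
  by apply: (cvgr_to_ge cw); exact: nearW.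
Qed.

Local Notation r n := (a n / n%:R `^ m).

Lemma echo_walk_cvg : {ae P, forall w,
  S n w / n%:R `^ m @[n --> \oo] --> echo_limit w / Gamma (1 + m)}.
Proof.
apply: filterS echo_limit_cvg => w cw.
rewrite -(cvg_shiftS (fun n => S n w / n%:R `^ m)) /=.
rewrite (_ : (fun n => _) = (fun n => M n w * r n.+1)); last first.
  apply/funext => n; rewrite /echoM mulrA divfK // gt_eqF //.
  exact: echo_norm_mean_gt0.
apply: cvgM => //.
by rewrite (cvg_shiftS (fun n => r n)); apply: cvg_echo_norm; exact: ltW.
Qed.

Lemma echo_walk_Lp_cvg (p : R) : 1 < p -> intg (fun w => xi w `^ p) ->
  Ex (fun w => xi w `^ p) < p * m ->
  (forall n, intg (fun w => `|S n w / n%:R `^ m - echo_limit w / Gamma (1 + m)| `^ p)) /\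
  Ex (fun w => `|S n w / n%:R `^ m - echo_limit w / Gamma (1 + m)| `^ p)
    @[n --> \oo] --> 0.
Proof.
move=> p1 ip lt; have p0 : 0 < p by lra.
have mL := echo_limit_meas.
have [iL cI] := echoM_limit_Lp EM xi_intg xi_mean_gt0 p1 ip lt mL echo_limit_cvg.
set c := Gamma (1 + m).
pose D : nat -> T -> R := fun n w => `|S n w / n%:R `^ m - echo_limit w / c|.
have D0 n w : 0 <= D n w by exact: normr_ge0.
have mS n : measurable_fun setT (S n) by exact: (echoS_meas EM).
have mD n : measurable_fun setT (fun w => D n w `^ p).
  apply: measurable_powRc; apply: measurableT_comp => //.
  by apply: measurable_funB; apply: measurable_funM.
have iD n : intg (fun w => D n w `^ p).
  apply: (@ge0_intg_le _ _ _ _ _ (fun w => 2 `^ p * ((n%:R `^ m)^-1 `^ p * S n w `^ p +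
     `|c^-1| `^ p * `|echo_limit w| `^ p))) => //; last first.
    apply: intgZ; apply: intgD; apply: intgZ => //.
    exact: (echoS_powR_intg EM p1 ip).
  move=> w; rewrite powR_ge0 /=.
  have nv : 0 <= (n%:R `^ m)^-1 by rewrite invr_ge0 powR_ge0.
  apply: (@le_trans _ _ ((S n w / n%:R `^ m + `|echo_limit w / c|) `^ p)).
    apply: ge0_ler_powR; rewrite ?nnegrE ?D0 ?addr_ge0 ?mulr_ge0 ?(echoS_ge0 EM) ?(ltW p0) //.
    rewrite /D; apply: le_trans (ler_normB _ _) _.
    by rewrite (ger0_norm (mulr_ge0 (echoS_ge0 EM _ _) nv)).
  apply: le_trans (powRD_le (ltW p0) (mulr_ge0 (echoS_ge0 EM _ _) nv) (normr_ge0 _)) _.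
  rewrite normrM !powRM ?(echoS_ge0 EM) //.
  by rewrite (mulrC (S n w `^ p)) (mulrC (`|echo_limit w| `^ p)).
split=> //.
have mM n : measurable_fun setT (M n) by exact: (echoM_meas EM).
have iM n : intg (fun w => `|M n w - echo_limit w| `^ p).
  have Mi := echoM_powR_intg EM xi_mean_gt0 p1 ip n.
  apply: (@ge0_intg_le _ _ _ _ _ (fun w => 2 `^ p * (M n w `^ p + `|echo_limit w| `^ p))).
  - by apply: measurable_powRc; apply: measurableT_comp => //; exact: measurable_funB.
  - move=> w; rewrite powR_ge0 /=; have M0 := echoM_ge0 EM xi_mean_gt0 n w.
    apply: le_trans (powRD_le (ltW p0) M0 (normr_ge0 _)).
    apply: ge0_ler_powR; rewrite ?nnegrE ?addr_ge0 ?(ltW p0) //.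
    by apply: le_trans (ler_normB _ _) _; rewrite (ger0_norm M0).
  - by apply: intgZ; exact: intgD.
pose I_ n := Ex (fun w => `|M n w - echo_limit w| `^ p).
pose J := Ex (fun w => `|echo_limit w| `^ p).
have cI' : I_ n @[n --> \oo] --> 0 by exact: (fine_cvg cI).
have cr : r n.+1 @[n --> \oo] --> c^-1.
  by rewrite (cvg_shiftS (fun n => r n)); apply: cvg_echo_norm; exact: ltW.
have r0 n : 0 <= r n.
  by rewrite divr_ge0 ?powR_ge0 // ltW // echo_norm_mean_gt0.
have [C [_ hC]] := cvg_seq_bounded (cvgP _ cr).
have {}hC n : r n.+1 <= C + 1.
  by have := hC (C + 1) ltac:(by rewrite ltrDl) n I; exact: le_trans (ler_norm _).
have bound n : Ex (fun w => D n.+1 w `^ p) <=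
    2 `^ p * ((C + 1) `^ p * I_ n + `|r n.+1 - c^-1| `^ p * J).
  have i1 := intgZ ((C + 1) `^ p) (iM n); have i2 := intgZ (`|r n.+1 - c^-1| `^ p) iL.
  rewrite /I_ /J -(ExZ ((C + 1) `^ p)) // -(ExZ (`|r n.+1 - c^-1| `^ p)) // -ExD // -ExZ.
    apply: Ex_le => //; first by apply: intgZ; exact: intgD.
    move=> w.
    (* The error is split into [M - echo_limit] times the bounded factor [r] and [echo_limit] times
       the vanishing factor [r - c^-1]. *)
    have E : S n.+1 w / n.+1%:R `^ m - echo_limit w / c =
        r n.+1 * (M n w - echo_limit w) + (r n.+1 - c^-1) * echo_limit w.
      have -> : S n.+1 w = M n w * a n.+1 by rewrite /echoM divfK // gt_eqF // echo_norm_mean_gt0.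
      by ring.
    have C0 : 0 <= C + 1 by exact: le_trans (r0 n.+1) (hC n).
    apply: (@le_trans _ _ (((C + 1) * `|M n w - echo_limit w| +
        `|r n.+1 - c^-1| * `|echo_limit w|) `^ p)).
      apply: ge0_ler_powR; rewrite ?nnegrE ?D0 ?addr_ge0 ?mulr_ge0 ?(ltW p0) //.
      rewrite /D E; apply: le_trans (ler_normD _ _) _.
      rewrite !normrM lerD2r ler_wpM2r //.
      by rewrite -normrM (ger0_norm (r0 _)).
    apply: le_trans (powRD_le (ltW p0) (mulr_ge0 C0 (normr_ge0 _)) (mulr_ge0 (normr_ge0 _) (normr_ge0 _))) _.
    by rewrite !powRM.
  exact: intgD.
rewrite -(cvg_shiftS (fun n => Ex (fun w => D n w `^ p))) /=.
apply: (@squeeze_cvgr _ _ _ _ (cst 0)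
  (fun n => 2 `^ p * ((C + 1) `^ p * I_ n + `|r n.+1 - c^-1| `^ p * J))).
- by apply: nearW => n; rewrite bound andbT; apply: Ex_ge0 => w; exact: powR_ge0.
- exact: cvg_cst.
- rewrite -[X in _ --> X](mulr0 (2 `^ p)); apply: cvgM; first exact: cvg_cst.
  rewrite -[X in _ --> X]addr0; apply: cvgD.
    by rewrite -[X in _ --> X](mulr0 ((C + 1) `^ p)); apply: cvgM => //; exact: cvg_cst.
  rewrite -[X in _ --> X](mul0r J); apply: cvgM; last exact: cvg_cst.
  apply: powR_cvg0 => //; rewrite -(normr0 R) -(subrr c^-1).
  by apply: cvg_norm; apply: cvgB => //; exact: cvg_cst.
Qed.

End EchoLimit.

(** * Reduction to echoes that are nonnegative everywhere *)

Section NonnegativeParts.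
Context {R : realType} d {T : measurableType d} (P : probability T R).
Variables (xi : {RV P >-> R}) (xis : nat -> {RV P >-> R}) (U : nat -> {RV P >-> nat}).
Hypothesis xis_law : forall n, (2 <= n)%N -> same_law P (xis n) xi.
Hypothesis xis_indep :
  mutually_independent P [set n | (2 <= n)%N] (fun n => xis n : T -> R).
Hypothesis U_law : forall n, (2 <= n)%N -> uniform_on_lt P n (U n).
Hypothesis U_indep : mutually_independent P [set n | (2 <= n)%N] (fun n => U n : T -> nat).
Hypothesis xis_U_indep : independent_systems P
  (family_sigma [set n | (2 <= n)%N] (fun n => xis n : T -> R))
  (family_sigma [set n | (2 <= n)%N] (fun n => U n : T -> nat)).

(* The steps are nonnegative only almost surely; their positive parts are so everywhere. *)
Definition pospart (y : R) : R := Num.max y 0.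

Lemma measurable_pospart : measurable_fun setT pospart.
Proof. exact: measurable_maxr. Qed.

Lemma pospart_ge0 y : 0 <= pospart y.
Proof. by rewrite /pospart le_max lexx orbT. Qed.

Lemma pospart_id y : 0 <= y -> pospart y = y.
Proof. by move=> y0; rewrite /pospart; apply/max_idPl. Qed.

(** The filtration remains that of the original variables; the product rule for positive parts is
    the original one with [g \o pospart] in place of [g]. *)
Lemma pospart_echo_model : echo_model P (pospart \o xi)
  (fun n => pospart \o xis n) (fun n => U n) (fun n => rects xis U n n).
Proof.
split.
- by move=> n; exact: rects_measurable.
- by move=> n k nk; exact: rects_sub.
- exact: (measurableT_comp measurable_pospart).
- by move=> w; exact: pospart_ge0.
- by move=> n w; exact: pospart_ge0.
- move=> k n kn; apply: (measurableT_comp measurable_pospart).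
  exact: (sigma_fun_x (x := xis) (u := U) (m := n) kn).
- move=> k n j kn.
  have := @sigma_fun_indic R _ T (rects xis U n n) (U k @^-1` [set j]) (sigma_u _ kn).
  congr sigma_fun; apply/funext => w; rewrite indicE; congr (nat_of_bool _)%:R.
  by apply/idP/eqP => [/set_mem//|h]; exact/mem_set.
- move=> n k H g kn sH iH mg ig.
  have mg' : measurable_fun setT (g \o pospart).
    by apply: measurableT_comp => //; exact: measurable_pospart.
  exact: (product_rule xis_indep U_indep xis_U_indep xis_law U_law kn sH iH mg' ig).
Qed.

Hypothesis xi_ge0 : {ae P, forall w, 0 <= xi w}.

Lemma ae_xis_ge0 : {ae P, forall w, forall n, (2 <= n)%N -> 0 <= xis n w}.
Proof.
apply/ae_foralln => n; have [n2|_] := boolP (2 <= n)%N; last exact: nearW.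
have mA (Y : {RV P >-> R}) : measurable (Y @^-1` `[0, +oo[).
  by rewrite -[X in measurable X]setTI; exact: measurable_funP.
have /(_ `[0, +oo[%classic) := xis_law n2.
have -> : P (xi @^-1` `[0, +oo[) = 1%E.
  apply: ae_prob1 => //; apply: filterS xi_ge0 => w; by rewrite /= in_itv /= andbT.
move=> /(_ (measurable_itv _)) e.
apply: filterS (prob1_ae (mA (xis n)) e) => w /=; by rewrite in_itv /= andbT.
Qed.

Lemma ae_echo_walk : {ae P, forall w, forall n,
  echo_walk (fun k => xis k w) (fun k => U k w) n =
  echoS (fun n => pospart \o xis n) (fun n => U n) n w}.
Proof.
apply: filterS ae_xis_ge0 => w x0 n; rewrite /echo_walk /echoS; apply: eq_bigr => k _.
rewrite /echoX /fstep -echo_step_filtered; apply: eq_echo_step => i i2.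
by rewrite /= pospart_id // x0.
Qed.

Lemma echo_walk_meas n :
  measurable_fun setT (fun w => echo_walk (fun k => xis k w) (fun k => U k w) n).
Proof.
rewrite /echo_walk; apply: measurable_sum => k.
under eq_fun do rewrite echo_step_filtered.
apply: (@measurable_filtered_step _ _ T (fun=> id) xis U k k) => // i j _.
by apply: measurable_natr_bool; apply: (measurableT_comp (f := fun l => l == j)).
Qed.

End NonnegativeParts.

Theorem proposition3p1 (R : realType) (d : measure_display)
    (T : measurableType d) (P : probability T R)
    (xi : {RV P >-> R})
    (xi_ge0 : {ae P, forall w, 0 <= xi w})
    (xi_neq0 : (P [set w | xi w = 0%R] < 1)%E)
    (xi_Lalpha : exists2 alpha : R, 1 < alpha & (xi : T -> R) \in Lfun P alpha%:E)
    (xis : nat -> {RV P >-> R}) (U : nat -> {RV P >-> nat})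
    (xis_law : forall n, (2 <= n)%N -> same_law P (xis n) xi)
    (xis_indep : mutually_independent P [set n | (2 <= n)%N] (fun n => xis n : T -> R))
    (U_law : forall n, (2 <= n)%N -> uniform_on_lt P n (U n))
    (U_indep : mutually_independent P [set n | (2 <= n)%N] (fun n => U n : T -> nat))
    (xis_U_indep : independent_systems P
       (family_sigma [set n | (2 <= n)%N] (fun n => xis n : T -> R))
       (family_sigma [set n | (2 <= n)%N] (fun n => U n : T -> nat))) :
  let S (n : nat) (w : T) : R := echo_walk (fun k => xis k w) (fun k => U k w) n in
  let m1 : R := fine (moment P xi 1) in
  exists L : {RV P >-> R},
  [/\ (L : T -> R) \in Lfun P 1%E,
      {ae P, forall w, (S n w / n%:R `^ m1) @[n --> \oo] --> L w},
      (mean_xlogx P xi < m1%:E)%E ->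
      [/\ forall gamma : R, 1 < gamma -> (moment P xi gamma < (gamma * m1)%:E)%E ->
            cvg_Lp P gamma (fun n w => S n w / n%:R `^ m1) L /\
            (L : T -> R) \in Lfun P gamma%:E,
          (P [set w | xi w = 1%R] < 1)%E -> non_degenerate P L &
          ('E_P[L] = ((Gamma (1 + m1))^-1)%:E)%E] &
      (m1%:E <= mean_xlogx P xi)%E -> {ae P, forall w, L w = 0}].
Proof.
move=> S m1; have [alpha a1 xiL] := xi_Lalpha.
pose xp := pospart \o xi.
have EM := pospart_echo_model xis_law xis_indep U_law U_indep xis_U_indep.
have mxi : measurable_fun setT xi by [].
have mxp : measurable_fun setT xp by exact: (em_xi_meas EM).
have xp0 w : 0 <= xp w by exact: pospart_ge0.
have aexp : {ae P, forall w, xi w = xp w}.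
  by apply: filterS xi_ge0 => w h; rewrite /xp /= pospart_id.
have xple w : `|xp w| <= `|xi w|.
  by rewrite ger0_norm // ge_max ler_norm normr_ge0.
have ixi : P.-integrable setT (EFin \o xi).
  apply/Lfun1_integrable.
  apply: (@Lfun_subset _ _ _ P 1%E alpha%:E) => //; rewrite ?lee_fin ?(ltW a1) //.
  exact: fin_num_measure.
have ixp : P.-integrable setT (EFin \o xp) by exact: ae_intg aexp ixi.
have ixpa : P.-integrable setT (EFin \o (fun w => xp w `^ alpha)).
  apply: (@ge0_intg_le _ _ _ _ _ (fun w => `|xi w| `^ alpha)); first exact: measurable_powRc.
    move=> w; rewrite powR_ge0 /=; apply: ge0_ler_powR; rewrite ?nnegrE //; first lra.
    by rewrite -(ger0_norm (xp0 w)).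
  exact: (Lfun_integrable (ltW a1) xiL).
have momE g : moment P xi g = (\int[P]_w (xp w `^ g)%:E)%E.
  rewrite /moment unlock; apply: ae_eq_integral => //.
  - by apply/measurable_EFinP; exact: measurable_powRc.
  - by apply/measurable_EFinP; exact: measurable_powRc.
  - by apply: filterS aexp => w /= -> _.
have m1E : m1 = (\int[P]_w xp w)%R.
  rewrite /m1 momE; congr fine; apply: eq_integral => w _.
  by rewrite powRr1.
(* A nonnegative variable of mean 0 vanishes almost surely, which [xi_neq0] excludes. *)
have m0 : 0 < (\int[P]_w xp w)%R.
  rewrite lt_neqAle Ex_ge0 // andbT; apply/negP => /eqP/esym E.
  move: xi_neq0; rewrite lt_neqAle => /andP[/eqP + _]; apply.
  apply: ae_prob1; first by rewrite -[X in measurable X]setTI; exact: (mxi measurableT [set 0]).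
  by apply: filterS2 aexp (Ex_eq0_ae ixp xp0 E) => w /= -> ->.
have ae0 : 0 < alpha - 1 by lra.
have alE : alpha = 1 + (alpha - 1) by lra.
have ilx : P.-integrable setT (EFin \o (fun w => xp w * ln (xp w))).
  apply: (@intg_le _ _ _ _ _ (fun w => 1 + (alpha - 1)^-1 * xp w `^ alpha)).
  - apply: measurable_funM => //; exact: (measurableT_comp (@measurable_ln R)).
  - by move=> w; have := norm_xlnx_le ae0 (xp0 w); rewrite -alE (mulrC (_^-1)).
  - by apply: intgD; [exact: intg_cst|exact: intgZ].
have lamE : mean_xlogx P xi = ((\int[P]_w (xp w * ln (xp w)))%R)%:E.
  rewrite EFin_Ex // /mean_xlogx unlock; apply: ae_eq_integral => //.
  - apply/measurable_EFinP; apply: measurable_funM => //.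
    exact: (measurableT_comp (@measurable_ln R)).
  - exact: (measurable_int _ ilx).
  - by apply: filterS aexp => w /= -> _.
pose x' n := pospart \o xis n; pose u' n : T -> nat := U n.
pose Y := echo_limit P xp x' u'.
set c := Gamma (1 + m1).
have c0 : 0 < c by apply: Gamma_gt0; rewrite m1E; lra.
have mY : measurable_fun setT Y by exact: (echo_limit_meas EM).
have mL : measurable_fun setT (fun w => Y w / c) by exact: measurable_funM.
have cY := echo_limit_cvg EM ixp m0.
pose L : {RV P >-> R} := HB.pack (fun w => Y w / c) (isMeasurableFun.Build _ _ _ _ _ mL).
have iL : P.-integrable setT (EFin \o L).
  rewrite (_ : EFin \o L = EFin \o (fun w => c^-1 * Y w)).
    by apply: intgZ; exact: (echo_limit_intg EM).
  by apply/funext => w /=; rewrite mulrC.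
have SS := ae_echo_walk U xis_law xi_ge0.
have mS n : measurable_fun setT (S n) by exact: echo_walk_meas.
have Labs (g : R) : 1 < g -> P.-integrable setT (EFin \o (fun w => `|Y w| `^ g)) ->
    (L : T -> R) \in Lfun P g%:E.
  move=> g1 i; apply: intg_Lfun => //.
  rewrite (_ : (fun w => _) = (fun w => c^-1 `^ g * `|Y w| `^ g)); first exact: intgZ.
  apply/funext => w /=; rewrite normrM powRM // mulrC; congr (_ `^ _ * _).
  by rewrite ger0_norm // invr_ge0 ltW.
exists L; split.
- exact/Lfun1_integrable.
- apply: filterS2 (echo_walk_cvg EM ixp m0) SS => w h1 h2.
  by rewrite m1E; under eq_fun do rewrite /S h2; rewrite /= /c m1E; exact: h1.
- rewrite lamE lte_fin m1E => lam.
  (* The choice [e = (alpha - 1) / 2] makes the order [1 + (e + e)] equal to [alpha]. The exponent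
     [1 + s] found here yields the mean and the non-degeneracy. *)
  have [s [s0 is' ms]] : exists s, [/\ 0 < s,
      P.-integrable setT (EFin \o (fun w => xp w `^ (1 + s))) &
      (\int[P]_w (xp w `^ (1 + s)) < (1 + s) * \int[P]_w xp w)%R].
    apply: (@subcritical_exponent _ _ _ P xp ((alpha - 1) / 2)) => //; first lra.
    by rewrite (_ : 1 + _ = alpha) //; lra.
  have s1 : 1 < 1 + s by lra.
  have [iY EY] := echoM_limit_mean EM ixp m0 s1 is' ms mY cY.
  split.
  + move=> g g1; rewrite momE => lt.
    (* A moment below [g * m1] is finite, so integrability holds for such [g] even beyond
       [alpha]. *)
    have ig : P.-integrable setT (EFin \o (fun w => xp w `^ g)).
      apply: ge0_intg_lty; [exact: measurable_powRc|by move=> w; exact: powR_ge0|].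
      exact: lt_trans lt (ltry _).
    rewrite -EFin_Ex // lte_fin in lt.
    have [iYg _] := echoM_limit_Lp EM ixp m0 g1 ig lt mY cY.
    have LL := Labs g g1 iYg.
    split=> //; have [iD cD] := echo_walk_Lp_cvg EM ixp m0 g1 ig lt.
    have mf n : measurable_fun setT (fun w => S n w / n%:R `^ (\int[P]_w xp w)%R).
      exact: measurable_funM.
    have mD n : measurable_fun setT
        (fun w => `|S n w / n%:R `^ (\int[P]_w xp w)%R - Y w / c| `^ g).
      apply: measurable_powRc; apply: measurableT_comp => //.
      exact: measurable_funB.
    have aeD n : {ae P, forall w,
        `|echoS x' u' n w / n%:R `^ (\int[P]_w xp w)%R - Y w / Gamma (1 + \int[P]_w xp w)%R| `^ g =
        `|S n w / n%:R `^ (\int[P]_w xp w)%R - Y w / c| `^ g}.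
      by apply: filterS SS => w h; rewrite /S h /c m1E.
    have iD' n := ae_intg (mD n) (aeD n) (iD n).
    split=> //.
    * move=> n; apply: intg_Lfun => //.
      have Si := echoS_powR_intg EM g1 ig n.
      apply: (ae_intg (f := fun w => (n%:R `^ (\int[P]_w xp w)%R)^-1 `^ g * echoS x' u' n w `^ g)).
      - by apply: measurable_powRc; exact: measurableT_comp.
      - apply: filterS SS => w h; rewrite /S h normrM powRM // mulrC.
        by congr (_ `^ _ * _ `^ _); rewrite ger0_norm ?(echoS_ge0 EM) // invr_ge0 powR_ge0.
      - exact: intgZ.
    * have g0 : 0 < g by lra.
      apply: (@Lnorm_cvg0 _ _ _ P _ g g0 iD').
      apply: cvg_trans cD; apply: near_eq_cvg; apply: nearW => n.
      by apply: ae_Ex (aeD n); [exact: (intg_meas (iD n))|exact: mD].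
  + move=> xi1 [k Lk].
    have Yk : {ae P, forall w, Y w = k * c}.
      by apply: filterS Lk => w <- /=; rewrite divfK // gt_eqF.
    have := xi_eq1_of_const_limit EM ixp m0 s1 is' ms mY cY Yk => xp1.
    move: xi1; rewrite lt_neqAle => /andP[/eqP + _]; apply.
    apply: ae_prob1; first by rewrite -[X in measurable X]setTI; exact: (mxi measurableT [set 1]).
    by apply: filterS2 aexp xp1 => w e1 e2 /=; rewrite e1.
  + have EL : (\int[P]_w L w)%R = c^-1.
      transitivity (\int[P]_w (c^-1 * Y w))%R.
        by apply: eq_Rintegral => w _; rewrite mulrC.
      by rewrite (ExZ c^-1 iY) EY mulr1.
    by rewrite unlock -EL (EFin_Ex iL).
- rewrite lamE lee_fin m1E => lam.
  have ia : P.-integrable setT (EFin \o (fun w => xp w `^ (1 + (alpha - 1)))).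
    by rewrite -alE.
  have := critical_limit0 EM ixp m0 ae0 ia ilx lam cY.
  by apply: filterS => w h /=; rewrite -/Y -/(Y w) in h *; rewrite h mul0r.
Qed.
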